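(* Let $(M,g,\xi,\mu)$ be a Ricci soliton with potential vector field $\xi\in\Gamma(TM)$ and let $F:(M^m,g)\to(N^n,h)$ be a horizontally conformal submersion between Riemannian manifolds such that $\mathrm{Ker}F_\ast$ and $(\mathrm{Ker}F_\ast)^\perp$ are totally geodesic. Then the following statements are true: (i) If $\xi=W\in\Gamma(\mathrm{Ker}F_\ast)$, then any fiber of $F$ is a Ricci soliton. (ii) If $\xi=X\in\Gamma((\mathrm{Ker}F_\ast)^\perp)$, then any fiber of $F$ is Einstein.
   Context: A Ricci soliton $(M,g,\xi,\mu)$ is a Riemannian manifold $(M,g)$ with a smooth vector field $\xi$ (the potential vector field) and a constant $\mu\in\mathbb{R}$ such that $\frac12L_\xi g+\mathrm{Ric}+\mu g=0$, where $L_\xi g$ is the Lie derivative of $g$ and $\mathrm{Ric}$ the Ricci tensor; a Riemannian manifold is called a Ricci soliton if such a vector field and constant exist on it. A horizontally conformal submersion with dilation $\lambda$ is a surjective smooth submersion $F:(M,g)\to(N,h)$ between Riemannian manifolds together with a smooth function $\lambda:M\to\mathbb{R}^+$ such that $h(F_\ast X,F_\ast Y)=\lambda^2(p)\,g(X,Y)$ for all $p\in M$ and all $X,Y\in(\mathrm{Ker}F_{\ast p})^\perp$. $\mathrm{Ker}F_\ast$ is the vertical distribution, $(\mathrm{Ker}F_\ast)^\perp$ the horizontal distribution. A distribution $D$ on $M$ is totally geodesic if $\nabla_XY\in\Gamma(D)$ for all $X,Y\in\Gamma(D)$, $\nabla$ being the Levi-Civita connection of $g$. Fibers carry the induced Riemannian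 metric. *)

(* Defs.v *)
From HB Require Import structures.
From mathcomp Require Import all_boot all_order all_algebra.
From mathcomp Require Import all_classical all_reals all_analysis.
Import numFieldNormedType.Exports.

Set Implicit Arguments.
Unset Strict Implicit.
Unset Printing Implicit Defensive.

Import Order.TTheory GRing.Theory Num.Theory.

Local Open Scope classical_set_scope.
Local Open Scope ring_scope.

(* Calculus and Riemannian geometry in coordinates: points and vectors of R^m *)
(* are row vectors, a vector field is a function X : 'rV_m -> 'rV_m, and a    *)
(* metric is its Gram matrix G : 'rV_m -> 'M_m in the coordinate frame. These *)
(* are total functions, used only at points of an open set on which they are  *)
(* smooth.                                                                    *)
Section Coordinates.
Context {R : realType} {m : nat}.
Implicit Types (G : 'rV[R]_m -> 'M[R]_m) (X Y Z : 'rV[R]_m -> 'rV[R]_m).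

Definition basis_vec (i : 'I_m) : 'rV[R]_m := delta_mx 0 i.

Definition pder {W : normedModType R} (i : 'I_m) (f : 'rV[R]_m -> W) :
    'rV[R]_m -> W :=
  fun x => 'D_(basis_vec i) f x.

(* C^infinity: every iterated partial derivative, f itself included, is       *)
(* Frechet differentiable at every point of U (U is open in all uses).        *)
Definition smooth_on {W : normedModType R} (U : set 'rV[R]_m)
    (f : 'rV[R]_m -> W) : Prop :=
  forall (s : seq 'I_m) x, U x -> differentiable (foldr pder f s) x.

Definition inner (A : 'M[R]_m) (u v : 'rV[R]_m) : R := (u *m A *m v^T) 0 0.

(* Gamma^k_{ij} *)
Definition christoffel G (i j k : 'I_m) (x : 'rV[R]_m) : R :=
  2^-1 * \sum_(l < m)
    (pder i G x j l + pder j G x i l - pder l G x i j) * invmx (G x) l k.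

Definition nabla G X Y : 'rV[R]_m -> 'rV[R]_m := fun x =>
  'D_(X x) Y x +
  \row_(k < m) \sum_(i < m) \sum_(j < m)
    X x 0 i * Y x 0 j * christoffel G i j k x.

Definition bracket X Y : 'rV[R]_m -> 'rV[R]_m := fun x =>
  'D_(X x) Y x - 'D_(Y x) X x.

Definition curvature G X Y Z : 'rV[R]_m -> 'rV[R]_m := fun x =>
  nabla G X (nabla G Y Z) x - nabla G Y (nabla G X Z) x
  - nabla G (bracket X Y) Z x.

(* Ric(Y, Z) = tr (X |-> R(X, Y) Z), positive on round spheres. *)
Definition ricci G (x : 'rV[R]_m) : 'M[R]_m := \matrix_(i < m, j < m)
  \sum_(k < m)
    curvature G (cst (basis_vec k)) (cst (basis_vec i)) (cst (basis_vec j))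
      x 0 k.

(* (L_X g)(Y, Z) = X (g(Y, Z)) - g([X, Y], Z) - g(Y, [X, Z]) *)
Definition lie_metric G X (x : 'rV[R]_m) : 'M[R]_m :=
  \matrix_(i < m, j < m)
    ('D_(X x) (fun y => inner (G y) (basis_vec i) (basis_vec j)) x
     - inner (G x) (bracket X (cst (basis_vec i)) x) (basis_vec j)
     - inner (G x) (basis_vec i) (bracket X (cst (basis_vec j)) x)).

End Coordinates.

(* [cmap] and [cinv] are total; only their restrictions to [dom] and to       *)
(* [cod] are meaningful.                                                      *)
Record chart (R : realType) (T : topologicalType) (m : nat) := Chart {
  dom : set T;
  cmap : T -> 'rV[R]_m;
  cinv : 'rV[R]_m -> T }.

HB.instance Definition _ R T m := gen_eqMixin (@chart R T m).
HB.instance Definition _ R T m := gen_choiceMixin (@chart R T m).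

Definition cod R T m (phi : @chart R T m) : set 'rV[R]_m :=
  cmap phi @` dom phi.

Definition homeomorphic_chart R T m (phi : @chart R T m) : Prop :=
  [/\ open (dom phi), open (cod phi),
      {in dom phi, cancel (cmap phi) (cinv phi)},
      {within dom phi, continuous (cmap phi)} &
      {within cod phi, continuous (cinv phi)}].

Section Coordinate_expression.
Context {R : realType} {S T : topologicalType} {k m : nat}.
Variables (f : S -> T) (phi : chart R S k) (psi : chart R T m).

Definition coord_map : 'rV[R]_k -> 'rV[R]_m := cmap psi \o f \o cinv phi.

Definition coord_dom : set 'rV[R]_k :=
  cmap phi @` (dom phi `&` f @^-1` dom psi).

(* Matrix of the differential of f at p: a tangent vector with components u   *)
(* in phi is sent to the one with components u *m coord_diff p in psi.        *)
Definition coord_diff (p : S) : 'M[R]_(k, m) := 'J coord_map (cmap phi p).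

End Coordinate_expression.

(* The data of a Riemannian manifold: a space, an atlas, and the Gram matrix  *)
(* [metric phi p] of g at p in the coordinate frame of the chart phi. The     *)
(* axioms are [riemannian_manifold] below; keeping them apart from the data   *)
(* lets the Riemannian structure of a submanifold be written down explicitly. *)
Record riemannian_data (R : realType) (m : nat) := RiemannianData {
  carrier :> topologicalType;
  atlas : set (chart R carrier m);
  metric : chart R carrier m -> carrier -> 'M[R]_m }.

Arguments atlas {R m} M : rename.

Section Manifolds.
Context {R : realType} {m : nat}.
Implicit Types (M : riemannian_data R m).

Definition smooth_manifold M : Prop :=
  [/\ hausdorff_space M, @second_countable M,
      (forall phi, atlas M phi -> homeomorphic_chart phi),
      (forall p : M, exists2 phi, atlas M phi & dom phi p) &
      (forall phi psi, atlas M phi -> atlas M psi ->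
        smooth_on (coord_dom id phi psi) (coord_map id phi psi))].

Definition riemannian_metric M : Prop :=
  [/\ (forall phi p, atlas M phi -> dom phi p ->
        (metric phi p)^T = metric phi p
        /\ forall v, v != 0 -> 0 < inner (metric phi p) v v),
      (forall phi, atlas M phi ->
        smooth_on (cod phi) (metric phi \o cinv phi)) &
      (forall phi psi p, atlas M phi -> atlas M psi -> dom phi p -> dom psi p ->
        metric phi p = coord_diff id phi psi p *m metric psi p
                       *m (coord_diff id phi psi p)^T)].

Definition riemannian_manifold M : Prop :=
  smooth_manifold M /\ riemannian_metric M.

Definition smooth_function M (f : M -> R) : Prop :=
  forall phi, atlas M phi ->
    smooth_on (cod phi) (f \o cinv phi).

(* A vector field is given by its components [X phi p] at p in each chart;    *)
(* its values on charts outside the atlas or at points outside their domain   *)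
(* are irrelevant.                                                            *)
Definition field_data M := chart R M m -> M -> 'rV[R]_m.

Definition vector_field M (X : field_data M) : Prop :=
  (forall phi psi p, atlas M phi -> atlas M psi -> dom phi p -> dom psi p ->
     X psi p = X phi p *m coord_diff id phi psi p)
  /\ (forall phi, atlas M phi -> smooth_on (cod phi) (X phi \o cinv phi)).

(* [D phi p v]: the tangent vector at p with components v in the chart phi    *)
(* belongs to the distribution D.                                             *)
Definition distribution M := chart R M m -> M -> 'rV[R]_m -> Prop.

Definition section M (D : distribution M) (X : field_data M) : Prop :=
  vector_field X
  /\ forall phi p, atlas M phi -> dom phi p -> D phi p (X phi p).

Definition levi_civita M (X Y : field_data M) : field_data M := fun phi p =>
  nabla (metric phi \o cinv phi) (X phi \o cinv phi) (Y phi \o cinv phi)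
    (cmap phi p).

Definition totally_geodesic M (D : distribution M) : Prop :=
  forall X Y, section D X -> section D Y -> section D (levi_civita X Y).

Definition ricci_soliton M (xi : field_data M) (mu : R) : Prop :=
  [/\ riemannian_manifold M, vector_field xi &
      forall phi x, atlas M phi -> cod phi x ->
        let G := metric phi \o cinv phi in
        2^-1 *: lie_metric G (xi phi \o cinv phi) x + ricci G x + mu *: G x
        = 0].

Definition is_ricci_soliton M : Prop :=
  exists (xi : field_data M) (mu : R), ricci_soliton xi mu.

Definition is_einstein M : Prop :=
  riemannian_manifold M /\
  exists c : R, forall phi x, atlas M phi -> cod phi x ->
    let G := metric phi \o cinv phi in ricci G x = c *: G x.

(* Some chart of the atlas around p (an arbitrary one if there is none). *)
Definition chart_at M (p : M) : chart R M m :=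
  xget (Chart setT (fun=> 0) (fun=> p))
    [set phi | atlas M phi /\ dom phi p].

(* The k-dimensional embedded submanifold A of M with its induced metric: A   *)
(* has the subspace topology, its charts are the inverses of all smooth       *)
(* immersive local parametrizations of A that are homeomorphisms onto open    *)
(* subsets of A, and its metric is the pull-back of g under the inclusion.    *)
Definition submanifold M (k : nat) (A : set M) : riemannian_data R k :=
  @RiemannianData R k (set_type A : topologicalType)
    [set c | homeomorphic_chart c /\
       forall phi, atlas M phi ->
         smooth_on (coord_dom (@set_val M A) c phi)
                   (coord_map (@set_val M A) c phi)
         /\ forall q, dom c q -> dom phi (set_val q) ->
              row_free (coord_diff (@set_val M A) c phi q)]
    (fun c q => let phi := chart_at (set_val q) in
       coord_diff (@set_val M A) c phi q *m metric phi (set_val q)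
       *m (coord_diff (@set_val M A) c phi q)^T).

End Manifolds.

Section Submersions.
Context {R : realType} {m n : nat}.
Context {M : riemannian_data R m} {N : riemannian_data R n}.
Implicit Types (F : M -> N) (lambda : M -> R).

Definition smooth_map F : Prop :=
  continuous F /\
  forall phi psi, atlas M phi -> atlas N psi ->
    smooth_on (coord_dom F phi psi) (coord_map F phi psi).

Definition submersion F : Prop :=
  smooth_map F /\
  forall phi psi p, atlas M phi -> atlas N psi -> dom phi p -> dom psi (F p) ->
    row_full (coord_diff F phi psi p).

(* Ker F_* *)
Definition vertical F : distribution M := fun phi p v =>
  forall psi, atlas N psi -> dom psi (F p) -> v *m coord_diff F phi psi p = 0.

(* (Ker F_* )^perp *)
Definition horizontal F : distribution M := fun phi p v =>
  forall w, vertical F phi p w -> inner (metric phi p) v w = 0.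

Definition horizontally_conformal_submersion F lambda : Prop :=
  [/\ submersion F, range F = setT, smooth_function lambda,
      forall p, 0 < lambda p &
      forall phi psi p v w, atlas M phi -> atlas N psi ->
        dom phi p -> dom psi (F p) ->
        horizontal F phi p v -> horizontal F phi p w ->
        inner (metric psi (F p)) (v *m coord_diff F phi psi p)
                                 (w *m coord_diff F phi psi p)
        = lambda p ^+ 2 * inner (metric phi p) v w].

Definition fiber F (y : N) : riemannian_data R (m - n) :=
  submanifold (m - n) (F @^-1` [set y]).

End Submersions.

(* Main.v *)
Require Import Defs.
From HB Require Import structures.
From mathcomp Require Import all_boot all_order all_algebra.
From mathcomp Require Import all_classical all_reals all_analysis.
From mathcomp Require Import ring lra.
Import numFieldNormedType.Exports.

Set Implicit Arguments.
Unset Strict Implicit.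
Unset Printing Implicit Defensive.

Import Order.TTheory GRing.Theory Num.Theory.

Local Open Scope classical_set_scope.
Local Open Scope ring_scope.

(** Let P be the orthogonal projection of T M onto Ker F_*. The proof rests on
    the fact that P is parallel if both distributions are totally geodesic
    ([vertical_projection_parallel]). Total geodesy is a condition on global
    sections, so the local sections v P and v (1 - P) have to be cut off
    ([cutoff], [spread_vector_field]). This does no harm, because the part of a
    covariant derivative that leaves a distribution is tensorial
    ([totally_geodesic_local]). It gives the derivative of vertical fields along
    vertical ones and of horizontal fields along horizontal ones; the mixed
    cases follow from the orthogonality of the two distributions
    ([parallel_projection]).

    Let sigma parametrize an open piece of a fiber and let J be its differential.
    As J P = J and P is parallel, covariant derivatives of tangent fields of the
    fiber are tangent to it. So the Levi-Civita connection of M restricts to that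
    of the fiber ([leaf_conn]), and the curvature to its curvature. Moreover the
    curvature R(v, Y) of M commutes with P. Hence, for Y and Z tangent to the
    fiber, v |-> R(v, Y) Z takes values in the tangent space of the fiber, and its
    trace over T M is its trace over that subspace: the Ricci tensor of M
    restricts to that of the fiber ([leaf_ricci]).

    Now restrict the soliton equation of M to the fiber. A vertical potential
    field is tangent to the fiber, and the Lie derivative of the metric along it
    restricts to the one of the induced metric ([lie_metric_pull]): the fiber is a
    soliton with the same constant. If the potential field X is horizontal, so is
    its covariant derivative, P being parallel; the Lie derivative then vanishes
    on the fiber ([lie_metric_orthogonal]), which leaves Ric = - mu g.

    That a fiber is a Riemannian manifold comes from the inverse function theorem
    ([inverse_function]), used twice: it straightens a submersion, which provides
    charts of the fiber ([fiber_cover]), and it provides local left inverses of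
    immersions, which makes the transition between two parametrizations smooth
    ([sub_transition_smooth]). *)

(** * Differentiability and partial derivatives *)

Section Differentials.
Context {R : realType} {V W : normedModType R}.
Implicit Types (f g : V -> W) (x : V).

Lemma differentiable_expand f x : differentiable f x ->
  forall e, 0 < e ->
    \forall h \near 0, `|f (h + x) - f x - 'd f x h| <= e * `|h|.
Proof.
move=> /diff_locally /eqaddoP fx e e0.
by have := fx e e0; apply: filterS => h /=; rewrite opprD addrA.
Qed.

Lemma expand_differentiable f x (L : {linear V -> W}) : continuous L ->
  (forall e, 0 < e -> \forall h \near 0, `|f (h + x) - f x - L h| <= e * `|h|) ->
  differentiable f x /\ 'd f x = L :> (V -> W).
Proof.
move=> Lc Lx.
have fL : f \o shift x = cst (f x) + L +o_ 0 id.
  apply/eqaddoP => e e0; have := Lx e e0; apply: filterS => h /=.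
  by rewrite opprD addrA.
have dL := diff_unique Lc fL.
by split => //; apply/diff_locallyP; rewrite dL.
Qed.

Lemma near_eq_differentiable f g x : {near x, f =1 g} ->
  differentiable f x -> differentiable g x.
Proof.
move=> fg df.
have fg0 : \forall h \near 0, f (h + x) = g (h + x).
  by move: fg; rewrite (near_shift 0) subr0 => fg; near=> h; near: h.
have := @expand_differentiable g x ('d f x) (diff_continuous df).
case=> // e e0.
have /nbhs_singleton := fg; move=> fgx.
near=> h; rewrite -fgx -(near fg0 h) //; near: h.
exact: differentiable_expand.
Unshelve. all: by end_near. Qed.

End Differentials.

Section Partials.
Context {R : realType} {m : nat} {W : normedModType R}.
Implicit Types (f g : 'rV[R]_m -> W) (x : 'rV[R]_m) (i : 'I_m).

Lemma near_eq_pder f g x i : {near x, f =1 g} -> pder i f x = pder i g x.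
Proof. exact: near_eq_derive. Qed.

Lemma deriv_pder f x v : differentiable f x ->
  'D_v f x = \sum_(i < m) v 0 i *: pder i f x.
Proof.
move=> df; rewrite deriveE // {1}[v]row_sum_delta linear_sum /=.
by apply: eq_bigr => i _; rewrite linearZ /= /pder deriveE.
Qed.

End Partials.

Section Entries.
Context {R : realType} {V : normedModType R} {p q : nat}.
Implicit Types (A : V -> 'M[R]_(p, q)) (x : V).

Lemma differentiable_entry A x r c :
  differentiable A x -> differentiable (fun y => A y r c) x.
Proof.
move=> dA; apply: (@differentiable_comp _ _ _ _ A (fun B => B r c)) => //.
exact: differentiable_coord.
Qed.

Lemma differentiable_mx A x :
  (forall r c, differentiable (fun y => A y r c) x) -> differentiable A x.
Proof.
move=> dA.
have -> : A = \sum_(r < p) \sum_(c < q) (fun y => A y r c *: delta_mx r c).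
  apply/funext => y; rewrite {1}[A y]matrix_sum_delta fct_sumE.
  by apply: eq_bigr => r _; rewrite fct_sumE.
by do 2!apply: differentiable_sum => ?; exact: differentiableZl.
Qed.

Lemma derive_entry A x v r c : differentiable A x ->
  ('D_v A x) r c = 'D_v (fun y => A y r c) x.
Proof. by move=> dA; rewrite derive_mx ?mxE//; exact: diff_derivable. Qed.

End Entries.

Section Partial_rules.
Context {R : realType} {m : nat}.
Implicit Types (f g : 'rV[R]_m -> R) (x : 'rV[R]_m) (i : 'I_m).

Lemma pder_entry p q (A : 'rV[R]_m -> 'M[R]_(p, q)) x i r c :
  differentiable A x -> pder i A x r c = pder i (fun y => A y r c) x.
Proof. exact: derive_entry. Qed.

Lemma pder_cst (W : normedModType R) (a : W) x i : pder i (fun=> a) x = 0.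
Proof. exact: derive_cst. Qed.

Lemma pder_add (W : normedModType R) (f g : 'rV[R]_m -> W) x i :
  differentiable f x -> differentiable g x ->
  pder i (fun y => f y + g y) x = pder i f x + pder i g x.
Proof. by move=> df dg; apply: deriveD; exact: diff_derivable. Qed.

Lemma pder_sub (W : normedModType R) (f g : 'rV[R]_m -> W) x i :
  differentiable f x -> differentiable g x ->
  pder i (fun y => f y - g y) x = pder i f x - pder i g x.
Proof. by move=> df dg; apply: deriveB; exact: diff_derivable. Qed.

Lemma pder_sum (W : normedModType R) p (f : 'I_p -> 'rV[R]_m -> W) x i :
  (forall a, differentiable (f a) x) ->
  pder i (fun y => \sum_a f a y) x = \sum_a pder i (f a) x.
Proof.
move=> df; rewrite /pder -derive_sum => [|a]; last exact: diff_derivable.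
by congr (derive _ _ _); apply/funext => y; rewrite fct_sumE.
Qed.

Lemma pder_mul f g x i : differentiable f x -> differentiable g x ->
  pder i (fun y => f y * g y) x = pder i f x * g x + f x * pder i g x.
Proof.
move=> df dg; rewrite /pder (@deriveM _ _ f g); try exact: diff_derivable.
by rewrite addrC /GRing.scale /= [g x * _]mulrC.
Qed.

Lemma differentiable_fsum (W : normedModType R) p (f : 'I_p -> 'rV[R]_m -> W) x :
  (forall a, differentiable (f a) x) -> differentiable (fun y => \sum_a f a y) x.
Proof.
move=> df; rewrite (_ : (fun _ => _) = \sum_a f a); last first.
  by apply/funext => y; rewrite fct_sumE.
exact: differentiable_sum.
Qed.

Lemma differentiable_mulmx p q r (A : 'rV[R]_m -> 'M[R]_(p, q))
    (B : 'rV[R]_m -> 'M[R]_(q, r)) x :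
  differentiable A x -> differentiable B x ->
  differentiable (fun y => A y *m B y) x.
Proof.
move=> dA dB; apply: differentiable_mx => a c.
under eq_fun do rewrite mxE.
apply: differentiable_fsum => b.
by apply: differentiableM; exact: differentiable_entry.
Qed.

Lemma pder_mulmx p q r (A : 'rV[R]_m -> 'M[R]_(p, q))
    (B : 'rV[R]_m -> 'M[R]_(q, r)) x i :
  differentiable A x -> differentiable B x ->
  pder i (fun y => A y *m B y) x = pder i A x *m B x + A x *m pder i B x.
Proof.
move=> dA dB; apply/matrixP => a c.
rewrite pder_entry; last exact: differentiable_mulmx.
rewrite !mxE; under eq_fun do rewrite mxE.
have dAe := differentiable_entry a _ dA; have dBe := differentiable_entry _ c dB.
rewrite pder_sum => [|b]; last exact: differentiableM.
rewrite -big_split; apply: eq_bigr => b _ /=.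
by rewrite pder_mul // !pder_entry.
Qed.

Lemma differentiable_scale p q (f : 'rV[R]_m -> R) (A : 'rV[R]_m -> 'M[R]_(p, q)) x :
  differentiable f x -> differentiable A x ->
  differentiable (fun y => f y *: A y) x.
Proof.
move=> df dA; apply: differentiable_mx => a c.
under eq_fun do rewrite mxE.
by apply: differentiableM => //; exact: differentiable_entry.
Qed.

Lemma pder_scale p q (f : 'rV[R]_m -> R) (A : 'rV[R]_m -> 'M[R]_(p, q)) x i :
  differentiable f x -> differentiable A x ->
  pder i (fun y => f y *: A y) x = pder i f x *: A x + f x *: pder i A x.
Proof.
move=> df dA; apply/matrixP => a c.
apply: (etrans (pder_entry i a c (differentiable_scale df dA))).
under eq_fun do rewrite mxE.
have dAe := differentiable_entry a c dA.
apply: (etrans (pder_mul i df dAe)).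
by rewrite [RHS]mxE [X in _ = X + _]mxE [X in _ = _ + X]mxE (pder_entry i a c dA).
Qed.

Lemma differentiable_trmx p q (A : 'rV[R]_m -> 'M[R]_(p, q)) x :
  differentiable A x -> differentiable (fun y => (A y)^T) x.
Proof.
move=> dA; apply: differentiable_mx => a c.
by under eq_fun do rewrite mxE; exact: differentiable_entry.
Qed.

Lemma pder_trmx p q (A : 'rV[R]_m -> 'M[R]_(p, q)) x i :
  differentiable A x -> pder i (fun y => (A y)^T) x = (pder i A x)^T.
Proof.
move=> dA; apply/matrixP => a c; rewrite pder_entry; last first.
  exact: differentiable_trmx.
by rewrite mxE pder_entry //; under eq_fun do rewrite mxE.
Qed.

Lemma pder_comp p (W : normedModType R) (g : 'rV[R]_m -> 'rV[R]_p)
    (f : 'rV[R]_p -> W) x i :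
  differentiable g x -> differentiable f (g x) ->
  pder i (fun y => f (g y)) x
  = \sum_a pder i (fun y => g y 0 a) x *: pder a f (g x).
Proof.
move=> dg df; rewrite {1}/pder deriveE; last exact: differentiable_comp.
rewrite (@diff_comp _ _ _ _ g f) //= -deriveE // -[X in derive f (g x) X]deriveE //.
rewrite deriv_pder //; apply: eq_bigr => a _.
by rewrite -/(pder i g x) pder_entry.
Qed.

Lemma jacobianE p (f : 'rV[R]_m -> 'rV[R]_p) x i a : differentiable f x ->
  ('J f x) i a = pder i (fun y => f y 0 a) x.
Proof.
move=> df; rewrite -pder_entry // /pder deriveE // /jacobian mxE.
by rewrite -/(basis_vec i).
Qed.

Lemma row_jacobian p (f : 'rV[R]_m -> 'rV[R]_p) x i : differentiable f x ->
  row i ('J f x) = pder i f x.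
Proof.
by move=> df; apply/rowP => a; rewrite mxE jacobianE // pder_entry.
Qed.

Lemma near_eq_jacobian p (f g : 'rV[R]_m -> 'rV[R]_p) x :
  {near x, f =1 g} -> differentiable f x -> 'J f x = 'J g x.
Proof.
move=> fg df; have dg := near_eq_differentiable fg df.
apply/row_matrixP => i.
apply: (etrans (row_jacobian i df)); apply: (etrans _ (esym (row_jacobian i dg))).
exact: near_eq_pder.
Qed.

Lemma jacobian_id x : 'J (fun y : 'rV[R]_m => y) x = 1%:M.
Proof.
apply/row_matrixP => i; rewrite row_jacobian ?row1; last exact: ex_diff.
exact: derive_id.
Qed.

End Partial_rules.

Lemma jacobian_comp {R : realType} {m p q : nat} (g : 'rV[R]_m -> 'rV[R]_p)
    (f : 'rV[R]_p -> 'rV[R]_q) x :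
  differentiable g x -> differentiable f (g x) ->
  'J (fun y => f (g y)) x = 'J g x *m 'J f (g x).
Proof.
move=> dg df; have dfg := differentiable_comp dg df.
apply/matrixP => i b; rewrite jacobianE // mxE.
rewrite (@pder_comp _ _ _ _ g (fun y => f y 0 b)) //; last first.
  exact: differentiable_entry.
by apply: eq_bigr => a _; rewrite !jacobianE.
Qed.

(** * Smooth functions *)

(** Differentiability of all iterated partial derivatives of order at most n.
    Unlike [smooth_on] it supports induction on n with the function varying,
    which is how closure under composition and inversion is proved. *)
Fixpoint ndiff {R : realType} {m : nat} {W : normedModType R} (n : nat)
    (U : set 'rV[R]_m) (f : 'rV[R]_m -> W) : Prop :=
  (forall x, U x -> differentiable f x) /\
  if n is n'.+1 then forall i, ndiff n' U (pder i f) else True.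

Section Ndiff.
Context {R : realType} {m : nat}.
Implicit Types (W : normedModType R) (U : set 'rV[R]_m).

Lemma ndiff_differentiable n W U (f : 'rV[R]_m -> W) x :
  ndiff n U f -> U x -> differentiable f x.
Proof. by case: n => [|n] [df _]; exact: df. Qed.

Lemma ndiff_pder n W U (f : 'rV[R]_m -> W) i :
  ndiff n.+1 U f -> ndiff n U (pder i f).
Proof. by case=> _; exact. Qed.

Lemma ndiff_pred n W U (f : 'rV[R]_m -> W) : ndiff n.+1 U f -> ndiff n U f.
Proof.
elim: n f => [|n IHn] f [df dpf]; first by split.
by split => // i; exact: IHn.
Qed.

Lemma smooth_onP W U (f : 'rV[R]_m -> W) :
  smooth_on U f <-> forall n, ndiff n U f.
Proof.
split=> [sf n|df s].
  elim: n f sf => [|n IHn] f sf.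
    by split => // x; exact: (sf [::]).
  split=> [x|i]; first exact: (sf [::]).
  by apply: IHn => s x Ux; rewrite -foldr_rcons; exact: sf.
elim/last_ind: s f df => [|s i IHs] f df x Ux.
  exact: ndiff_differentiable (df 0%N) Ux.
by rewrite foldr_rcons; apply: IHs => // n; exact/ndiff_pder.
Qed.

Lemma smooth_on_ndiff n W U (f : 'rV[R]_m -> W) : smooth_on U f -> ndiff n U f.
Proof. by move=> /smooth_onP; exact. Qed.

Lemma ndiff_sub n W U V (f : 'rV[R]_m -> W) : V `<=` U ->
  ndiff n U f -> ndiff n V f.
Proof.
move=> VU; elim: n f => [|n IHn] f [df dpf].
  by split => // x /VU; exact: df.
by split=> [x /VU|i]; [exact: df|exact: IHn (dpf i)].
Qed.

Lemma ndiff_eq n W U (f g : 'rV[R]_m -> W) : open U ->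
  (forall x, U x -> f x = g x) -> ndiff n U f -> ndiff n U g.
Proof.
move=> oU; elim: n f g => [|n IHn] f g fg [df dpf].
  split => // x Ux; apply: near_eq_differentiable (df x Ux).
  by near=> y; apply: fg; near: y; exact: open_nbhs_nbhs.
split=> [x Ux|i].
  apply: near_eq_differentiable (df x Ux).
  by near=> y; apply: fg; near: y; exact: open_nbhs_nbhs.
apply: IHn (dpf i) => x Ux; apply: near_eq_pder.
by near=> y; apply: fg; near: y; exact: open_nbhs_nbhs.
Unshelve. all: by end_near. Qed.

Lemma ndiff_cst n W U (a : W) : ndiff n U (fun=> a).
Proof.
elim: n a => [|n IHn] a; first by split => // x _; exact: differentiable_cst.
split=> [x _|i]; first exact: differentiable_cst.
rewrite (_ : pder i _ = fun=> 0); first exact: IHn.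
by apply/funext => x; exact: pder_cst.
Qed.

Lemma ndiff_add n W U (f g : 'rV[R]_m -> W) : open U ->
  ndiff n U f -> ndiff n U g -> ndiff n U (fun x => f x + g x).
Proof.
move=> oU; elim: n f g => [|n IHn] f g [df dpf] [dg dpg].
  split => // x Ux; exact: differentiableD (df x Ux) (dg x Ux).
split=> [x Ux|i]; first exact: differentiableD (df x Ux) (dg x Ux).
apply: ndiff_eq (IHn _ _ (dpf i) (dpg i)) => // x Ux.
by rewrite pder_add //; [exact: df|exact: dg].
Qed.

Lemma ndiff_sum n W U I (r : seq I) (P : pred I) (f : I -> 'rV[R]_m -> W) :
  open U -> (forall a, ndiff n U (f a)) ->
  ndiff n U (fun x => \sum_(a <- r | P a) f a x).
Proof.
move=> oU df; elim: r => [|a r IHr].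
  by under eq_fun do rewrite big_nil; exact: ndiff_cst.
under eq_fun do rewrite big_cons.
by case: (P a) => //; exact: ndiff_add.
Qed.

Lemma ndiff_mul n U (f g : 'rV[R]_m -> R) : open U ->
  ndiff n U f -> ndiff n U g -> ndiff n U (fun x => f x * g x).
Proof.
move=> oU; elim: n f g => [|n IHn] f g nf ng.
  split => // x Ux.
  by apply: differentiableM; [case: nf|case: ng] => + _; exact.
split=> [x Ux|i].
  by apply: differentiableM; [case: nf|case: ng] => + _; exact.
apply: (@ndiff_eq n _ U (fun x => pder i f x * g x + f x * pder i g x)) => //.
  by move=> x Ux; rewrite pder_mul //; [case: nf|case: ng] => + _; exact.
apply: ndiff_add => //; apply: IHn.
- exact: ndiff_pder.
- exact: ndiff_pred.
- exact: ndiff_pred.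
- exact: ndiff_pder.
Qed.

Lemma ndiff_prod n U I (r : seq I) (P : pred I) (f : I -> 'rV[R]_m -> R) :
  open U -> (forall a, ndiff n U (f a)) ->
  ndiff n U (fun x => \prod_(a <- r | P a) f a x).
Proof.
move=> oU df; elim: r => [|a r IHr].
  by under eq_fun do rewrite big_nil; exact: ndiff_cst.
under eq_fun do rewrite big_cons.
by case: (P a) => //; exact: ndiff_mul.
Qed.

Lemma ndiff_entries n U p q (A : 'rV[R]_m -> 'M[R]_(p, q)) : open U ->
  ndiff n U A <-> forall r c, ndiff n U (fun x => A x r c).
Proof.
move=> oU; split=> [|dA].
  elim: n A => [|n IHn] A [dA dpA] r c.
    by split => // x Ux; exact/differentiable_entry/dA.
  split=> [x Ux|i]; first exact/differentiable_entry/dA.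
  apply: ndiff_eq (IHn _ (dpA i) r c) => // x Ux.
  exact/pder_entry/dA.
elim: n A dA => [|n IHn] A dA.
  by split => // x Ux; apply: differentiable_mx => r c; have [+ _] := dA r c; exact.
have dA' x : U x -> differentiable A x.
  by move=> Ux; apply: differentiable_mx => r c; have [+ _] := dA r c; exact.
split=> // i; apply: IHn => r c.
apply: ndiff_eq (ndiff_pder i (dA r c)) => // x Ux.
by rewrite pder_entry //; exact: dA'.
Qed.

Lemma ndiff_mulmx n U p q r (A : 'rV[R]_m -> 'M[R]_(p, q))
    (B : 'rV[R]_m -> 'M[R]_(q, r)) : open U ->
  ndiff n U A -> ndiff n U B -> ndiff n U (fun x => A x *m B x).
Proof.
move=> oU /(ndiff_entries _ _ oU) dA /(ndiff_entries _ _ oU) dB.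
apply/ndiff_entries => // a c; under eq_fun do rewrite mxE.
by apply: ndiff_sum => // b; exact: ndiff_mul.
Qed.

Lemma ndiff_scale n U p q (f : 'rV[R]_m -> R) (A : 'rV[R]_m -> 'M[R]_(p, q)) :
  open U -> ndiff n U f -> ndiff n U A -> ndiff n U (fun x => f x *: A x).
Proof.
move=> oU df /(ndiff_entries _ _ oU) dA.
apply/ndiff_entries => // a c; under eq_fun do rewrite mxE.
exact: ndiff_mul.
Qed.

Lemma ndiff_trmx n U p q (A : 'rV[R]_m -> 'M[R]_(p, q)) : open U ->
  ndiff n U A -> ndiff n U (fun x => (A x)^T).
Proof.
move=> oU /(ndiff_entries _ _ oU) dA.
by apply/ndiff_entries => // a c; under eq_fun do rewrite mxE.
Qed.

Lemma ndiff_opp n U p q (A : 'rV[R]_m -> 'M[R]_(p, q)) : open U ->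
  ndiff n U A -> ndiff n U (fun x => - A x).
Proof.
move=> oU dA; under eq_fun do rewrite -scaleN1r.
by apply: ndiff_scale => //; exact: ndiff_cst.
Qed.

Lemma ndiff_coord n U a : ndiff n U (fun x : 'rV[R]_m => x 0 a).
Proof.
case: n => [|n]; first by split => // x _; exact: differentiable_coord.
split=> [x _|i]; first exact: differentiable_coord.
rewrite (_ : pder i _ = fun=> (basis_vec i : 'rV[R]_m) 0 a).
  exact: ndiff_cst.
apply/funext => x; rewrite -(@pder_entry _ _ _ _ (fun y => y)).
  by rewrite /pder derive_id.
exact: ex_diff.
Qed.

Lemma ndiff_id n U : open U -> ndiff n U (fun x : 'rV[R]_m => x).
Proof.
move=> oU; apply/ndiff_entries => // r c; rewrite ord1; exact: ndiff_coord.
Qed.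

(** A family of functions of one variable that is closed under differentiation
    consists of smooth functions; this form handles the inverse and the
    functions used to build bumps without computing their higher derivatives. *)
Lemma ndiff_comp1 (D : set R) (C : set (R -> R)) n U (u : 'rV[R]_m -> R) :
  (forall h, C h -> exists2 h', C h' & forall t, D t -> is_derive t 1 h (h' t)) ->
  open U -> (forall x, U x -> D (u x)) -> ndiff n U u ->
  forall h, C h -> ndiff n U (fun x => h (u x)).
Proof.
move=> CD oU UD.
have dcomp x h : C h -> U x -> differentiable u x ->
    differentiable (fun x => h (u x)) x.
  move=> /CD[h' _ dh] Ux du; apply: (differentiable_comp du).
  by apply/derivable1_diffP; have [] := dh _ (UD _ Ux).
elim: n => [|n IHn] du h Ch.
  by split => // x Ux; apply: dcomp => //; exact: ndiff_differentiable du Ux.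
split=> [x Ux|i].
  by apply: dcomp => //; exact: ndiff_differentiable du Ux.
have [h' Ch' dh] := CD h Ch.
apply: (@ndiff_eq n _ U (fun x => h' (u x) * pder i u x)) => //; last first.
  by apply: ndiff_mul => //; [exact/IHn/Ch'/ndiff_pred|exact: ndiff_pder].
move=> x Ux; have dux := ndiff_differentiable du Ux.
have dhx := dh _ (UD _ Ux).
rewrite /pder (deriveE _ (dcomp _ _ Ch Ux dux)) (@diff_comp _ _ _ _ u h) //; last first.
  by apply/derivable1_diffP; have [] := dhx.
rewrite /= deriv1E; last by have [] := dhx.
by rewrite derive1E derive_val -deriveE // /GRing.scale /= mulrC.
Qed.

Lemma ndiff_inv n U (f : 'rV[R]_m -> R) : open U ->
  (forall x, U x -> f x != 0) -> ndiff n U f -> ndiff n U (fun x => (f x)^-1).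
Proof.
move=> oU f0 df.
pose C : set (R -> R) := [set h | exists c k, h = fun t => c * t^-1 ^+ k].
apply: (@ndiff_comp1 [set t | t != 0] C n U f _ oU f0 df (fun t => t^-1)).
  move=> _ [c [k ->]].
  exists (fun t => (- k%:R * c) * t^-1 ^+ k.+1); first by exists (- k%:R * c), k.+1.
  move=> t t0; case: k => [|k].
    under eq_fun do rewrite expr0.
    by rewrite oppr0 mul0r mul0r; exact: is_derive_cst.
  have dt : is_derive t 1 (fun t : R => t^-1) (- t ^- 2).
    apply: DeriveDef; first by apply: derivableV => //; exact: derivable_id.
    rewrite deriveV //; first by rewrite derive_id /GRing.scale /= mulr1.
  have h := is_deriveZ c (is_deriveX k.+1 dt).
  rewrite (_ : (fun s : R => _) = c \*: (GRing.inv ^+ k.+1)); last first.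
    by apply/funext => s /=; rewrite exprfctE.
  apply: (is_derive_eq h).
  rewrite /GRing.scale /= -!exprVn mulNr mulNr !mulrN; congr (- _).
  by rewrite -[k.+2]addn2 exprD; ring.
by exists 1, 1%N; apply/funext => t; rewrite mul1r expr1.
Qed.

Lemma ndiff_det n U p (A : 'rV[R]_m -> 'M[R]_p) : open U ->
  ndiff n U A -> ndiff n U (fun x => \det (A x)).
Proof.
move=> oU /(ndiff_entries _ _ oU) dA.
apply: ndiff_sum => // s; apply: ndiff_mul => //; first exact: ndiff_cst.
exact: ndiff_prod.
Qed.

Lemma ndiff_invmx n U p (A : 'rV[R]_m -> 'M[R]_p) : open U ->
  (forall x, U x -> A x \in unitmx) -> ndiff n U A ->
  ndiff n U (fun x => invmx (A x)).
Proof.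
move=> oU Au dA.
apply: (@ndiff_eq n _ U (fun x => (\det (A x))^-1 *: \adj (A x))) => //.
  by move=> x Ux; rewrite /invmx Au.
apply: ndiff_scale => //.
  apply: ndiff_inv => //; last exact: ndiff_det.
  by move=> x Ux; have := Au x Ux; rewrite unitmxE unitfE.
apply/ndiff_entries => // r c; under eq_fun do rewrite mxE.
apply: ndiff_mul => //; first exact: ndiff_cst.
apply: ndiff_det => //; apply/ndiff_entries => // a b.
under eq_fun do rewrite !mxE.
by move/(ndiff_entries _ _ oU) : dA; exact.
Qed.

Lemma smooth_on_local W U (f : 'rV[R]_m -> W) :
  (forall x, U x -> exists (V : set _) g,
    [/\ open V, V x, smooth_on V g & forall y, V y -> g y = f y]) ->
  smooth_on U f.
Proof.
move=> floc s x /floc[V [g [oV Vx sg gf]]].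
have /smooth_onP sgV := sg; have : smooth_on V f.
  by apply/smooth_onP => n; exact: ndiff_eq gf (sgV n).
exact.
Qed.

End Ndiff.

(** The chain rule expresses the partial derivatives of a composite by those
    of its factors, so that induction on the order applies. *)
Lemma ndiff_comp {R : realType} {m p q r : nat} n (U : set 'rV[R]_m)
    (V : set 'rV[R]_p) (g : 'rV[R]_m -> 'rV[R]_p)
    (f : 'rV[R]_p -> 'M[R]_(q, r)) : open U ->
  (forall x, U x -> V (g x)) -> ndiff n U g -> ndiff n V f ->
  ndiff n U (fun x => f (g x)).
Proof.
move=> oU UV; elim: n f => [|n IHn] f dg df.
  by split => // x Ux; apply: (differentiable_comp (ndiff_differentiable dg Ux));
    exact: ndiff_differentiable df (UV _ Ux).
split=> [x Ux|i].
  apply: (differentiable_comp (ndiff_differentiable dg Ux)).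
  exact: ndiff_differentiable df (UV _ Ux).
apply: (@ndiff_eq _ _ n _ U (fun x => \sum_a pder i (fun y => g y 0 a) x
                                             *: pder a f (g x))) => //.
  move=> x Ux; rewrite pder_comp //; first exact: ndiff_differentiable dg Ux.
  exact: ndiff_differentiable df (UV _ Ux).
apply: ndiff_sum => // a; apply: ndiff_scale => //.
  by apply: ndiff_pder; move: dg => /(ndiff_entries _ _ oU).
by apply: IHn; [exact: ndiff_pred|exact: ndiff_pder].
Qed.

(** * Symmetry of second derivatives *)

Section Norms.
Context {R : realType} {p q : nat}.
Implicit Types A : 'M[R]_(p, q).

Lemma mx_norm_le A e : 0 <= e -> (forall r c, `|A r c| <= e) -> `|A| <= e.
Proof.
move=> e0 Ae; rewrite [leLHS]/Num.Def.normr /= mx_normrE.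
by apply: bigmax_le => // -[r c] _; exact: Ae.
Qed.

Lemma entry_le_norm A r c : `|A r c| <= `|A|.
Proof.
rewrite [leRHS]/Num.Def.normr /= mx_normrE.
exact: (le_bigmax _ (fun ij => `|A ij.1 ij.2|) (r, c)).
Qed.

End Norms.

Lemma basis_vec_norm {R : realType} {m : nat} (i : 'I_m) :
  `|basis_vec i : 'rV[R]_m| <= 1.
Proof.
apply: mx_norm_le => // r c; rewrite /basis_vec mxE.
by case: (_ && _); rewrite ?normr1 ?normr0.
Qed.

Lemma no_common_approximation {R : realType} (a b c c' : R) : c = c' ->
  `|b - c| < `|a - b| / 2 -> `|a - c'| < `|a - b| / 2 -> False.
Proof. by move=> ->; rewrite distrC => d1 d2; have := ler_distD c' a b; lra. Qed.

Section Mean_value.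
Context {R : realType} {m : nat}.
Implicit Types (f : 'rV[R]_m -> R) (x v : 'rV[R]_m).

Lemma is_derive_line f x v t : differentiable f (x + t *: v) ->
  is_derive t 1 (fun s => f (x + s *: v)) ('D_v f (x + t *: v)).
Proof.
move=> df.
have dl : is_diff t (fun s : R => x + s *: v) (fun s => s *: v).
  have dv : is_diff t ( *:%R ^~ v) ( *:%R ^~ v) by exact: is_diff_scalel.
  have := is_diffD (is_diff_cst x t) dv.
  by rewrite add0r.
have dfl := @is_diff_comp _ _ _ _ _ _ _ _ t dl (differentiableP df).
apply: DeriveDef; first by apply/derivable1_diffP; case: dfl.
rewrite deriveE; last by case: dfl.
have [_ ->] := dfl.
by rewrite /= scale1r deriveE.
Qed.

Lemma mean_value_line f x v r : 0 <= r ->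
  (forall t, 0 <= t <= r -> differentiable f (x + t *: v)) ->
  exists2 t, 0 <= t <= r & f (x + r *: v) - f x = r * 'D_v f (x + t *: v).
Proof.
move=> r0 df.
have dl t : 0 <= t <= r -> is_derive t 1 (fun s => f (x + s *: v))
    ('D_v f (x + t *: v)) by move=> /df; exact: is_derive_line.
have [] := @MVT_segment R (fun t => f (x + t *: v))
  (fun t => 'D_v f (x + t *: v)) 0 r r0.
- by move=> t; rewrite in_itv /= => /andP[t0 tr]; apply: dl; rewrite !ltW.
- apply: derivable_within_continuous => t; rewrite in_itv /= => tr.
  by have [] := dl t tr.
move=> t; rewrite in_itv /= => tr e; exists t => //.
by rewrite scale0r addr0 subr0 in e; rewrite e mulrC.
Qed.

(** The second difference of f on a square of side r is r^2 times a mixed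
    derivative somewhere on the square. Being symmetric in the two directions,
    it forces both mixed derivatives to have the same limit. *)
Lemma second_difference f x i j r : 0 <= r ->
  (forall s t, 0 <= s <= r -> 0 <= t <= r ->
    differentiable f (x + s *: basis_vec i + t *: basis_vec j) /\
    differentiable (pder i f) (x + s *: basis_vec i + t *: basis_vec j)) ->
  exists s t, [/\ 0 <= s <= r, 0 <= t <= r &
    f (x + r *: basis_vec i + r *: basis_vec j) - f (x + r *: basis_vec j)
    - (f (x + r *: basis_vec i) - f x)
    = r * (r * pder j (pder i f) (x + s *: basis_vec i + t *: basis_vec j))].
Proof.
move=> r0 df.
have r0r : 0 <= r <= r by rewrite r0 lexx.
have r00 : (0 : R) <= 0 <= r by apply/andP; split.
pose g y := f (y + r *: basis_vec j) - f y.
have dg s : 0 <= s <= r -> differentiable g (x + s *: basis_vec i).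
  move=> sr; apply: differentiableB.
    apply: (@differentiable_comp _ _ _ _ (fun y => y + r *: basis_vec j) f).
      by apply: differentiableD; [exact: ex_diff|exact: differentiable_cst].
    exact: (df s r sr r0r).1.
  by have := (df s 0 sr r00).1; rewrite scale0r addr0.
have [s sr es] := mean_value_line r0 dg.
have [t tr et] : exists2 t, 0 <= t <= r &
    pder i f (x + s *: basis_vec i + r *: basis_vec j)
    - pder i f (x + s *: basis_vec i)
    = r * 'D_(basis_vec j) (pder i f) (x + s *: basis_vec i + t *: basis_vec j).
  by apply: mean_value_line => // t tr; exact: (df s t sr tr).2.
exists s, t; split => //; rewrite [in RHS]/pder -et.
transitivity (g (x + r *: basis_vec i) - g x).
  by rewrite /g; ring.
rewrite es; congr (_ * _); rewrite /g.
have d0 : differentiable f (x + s *: basis_vec i).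
  by have := (df s 0 sr r00).1; rewrite scale0r addr0.
have dr := (df s r sr r0r).1.
have dsh : differentiable (fun y => y + r *: basis_vec j) (x + s *: basis_vec i).
  by apply: differentiableD; [exact: ex_diff|exact: differentiable_cst].
have dfr := @differentiable_comp _ _ _ _ (fun y => y + r *: basis_vec j) f
  (x + s *: basis_vec i) dsh dr.
rewrite -/(pder i _ _) (@pder_sub _ _ _ _ f _ i dfr d0); congr (_ - _).
rewrite /pder (deriveE _ dfr) (@diff_comp _ _ _ _ (fun y => y + r *: basis_vec j)
  f _ dsh dr) /= (deriveE _ dr); congr ('d _ _ _).
rewrite -deriveE // (@deriveD _ _ _ id (fun=> r *: basis_vec j)) //.
by rewrite derive_id derive_cst addr0.
Qed.

Lemma pder_comm_scalar f (U : set 'rV[R]_m) x i j : open U -> U x ->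
  ndiff 2 U f -> pder i (pder j f) x = pder j (pder i f) x.
Proof.
move=> oU Ux df; apply: contrapT => /eqP ab.
set a := pder i (pder j f) x in ab *; set b := pder j (pder i f) x in ab *.
have e0 : 0 < `|a - b| / 2 by rewrite divr_gt0 // normr_gt0 subr_eq0.
have cts k l : {for x, continuous (pder k (pder l f))}.
  apply: differentiable_continuous.
  exact: ndiff_differentiable (ndiff_pder _ (ndiff_pder _ df)) Ux.
have : \forall y \near x, [/\ U y, `|a - pder i (pder j f) y| < `|a - b| / 2 &
    `|b - pder j (pder i f) y| < `|a - b| / 2].
  have nU : \forall y \near x, U y by exact: open_nbhs_nbhs.
  have /cvgrPdist_lt /(_ _ e0) na := cts i j.
  have /cvgrPdist_lt /(_ _ e0) nb := cts j i.
  by near=> y; split; [exact: (near nU y)|exact: (near na y)|exact: (near nb y)].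
move=> /nbhs_ballP[d /= d0 dP].
pose r := d / 3.
have r0 : 0 <= r by rewrite divr_ge0 // ltW.
have rB k l s t : 0 <= s <= r -> 0 <= t <= r ->
    ball x d (x + s *: basis_vec k + t *: basis_vec l).
  move=> /andP[s0 sr] /andP[t0 tr]; rewrite -ball_normE /ball_ /=.
  rewrite -addrA opprD addNKr -normrN opprK.
  rewrite (le_lt_trans (ler_normD _ _)) // !normrZ !ger0_norm //.
  have := @basis_vec_norm R m k; have := @basis_vec_norm R m l.
  move=> nl nk; have h1 := ler_wpM2l s0 nk; have h2 := ler_wpM2l t0 nl.
  move: r0 d0 sr tr; rewrite /r; move: h1 h2; lra.
have dfU k l s t : 0 <= s <= r -> 0 <= t <= r ->
    differentiable f (x + s *: basis_vec k + t *: basis_vec l) /\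
    differentiable (pder k f) (x + s *: basis_vec k + t *: basis_vec l).
  move=> sr tr; have [Uy _ _] := dP _ (rB k l s t sr tr); split.
    exact: ndiff_differentiable df Uy.
  exact: ndiff_differentiable (ndiff_pder k df) Uy.
have [s [t [sr tr e1]]] := second_difference r0 (dfU i j).
have [s' [t' [sr' tr' e2]]] := second_difference r0 (dfU j i).
have [_ _ d1] := dP _ (rB i j s t sr tr).
have [_ d2 _] := dP _ (rB j i s' t' sr' tr').
have rn0 : r != 0 by rewrite gt_eqF // divr_gt0.
apply: (no_common_approximation _ d1 d2).
apply: (mulfI rn0); apply: (mulfI rn0).
apply: (etrans (esym e1)); apply: (etrans _ e2).
have swap (a' b' c' d' : R) : a' - b' - (c' - d') = a' - c' - (b' - d') by ring.
by rewrite (addrAC x (r *: basis_vec j)); exact: swap.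
Unshelve. all: by end_near. Qed.

End Mean_value.

Lemma pder_comm {R : realType} {m p q : nat} (A : 'rV[R]_m -> 'M[R]_(p, q))
    (U : set 'rV[R]_m) x i j : open U -> U x -> ndiff 2 U A ->
  pder i (pder j A) x = pder j (pder i A) x.
Proof.
move=> oU Ux dA; have /(ndiff_entries _ _ oU) dAe := dA.
apply/matrixP => r c.
have entry2 k l : pder k (pder l A) x r c = pder k (pder l (fun y => A y r c)) x.
  rewrite pder_entry; last exact: ndiff_differentiable (ndiff_pder l dA) Ux.
  apply: near_eq_pder; near=> y; apply: pder_entry.
  by apply: (ndiff_differentiable dA); near: y; exact: open_nbhs_nbhs.
apply: (etrans (entry2 i j)); apply: (etrans _ (esym (entry2 j i))).
exact: pder_comm_scalar oU Ux _.
Unshelve. all: by end_near. Qed.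

(** * The inverse function theorem *)

HB.instance Definition _ (R : realType) (p q : nat) :=
  Complete.on 'M[R]_(p, q).

Section Contraction.
Context {R : realType} {X : completeNormedModType R}.

Lemma contraction_fixed_point (B : set X) (T : X -> X) (b : X) : closed B -> B b ->
  (forall x, B x -> B (T x)) ->
  (forall x y, B x -> B y -> `|T x - T y| <= 2^-1 * `|x - y|) ->
  exists2 x, B x & x = T x.
Proof.
move=> cB Bb TB TL.
pose T' : {fun B >-> B} := HB.pack T (isFun.Build _ _ B B T TB).
apply: (@banach_fixed_point _ _ _ T') => //; last by exists b.
have h0 : (0 : R) <= 2^-1 by rewrite invr_ge0.
exists (NngNum h0); split => /=; first by rewrite invf_lt1 // ltr1n.
by move=> [x y] [/= Bx By]; exact: TL.
Qed.

End Contraction.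

Section Local_inverse.
Context {R : realType} {m : nat}.
Implicit Types (f g : 'rV[R]_m -> 'rV[R]_m) (U V W : set 'rV[R]_m).
Implicit Types (x y : 'rV[R]_m).

Lemma ball_normP x y d : ball x d y <-> `|y - x| < d.
Proof. by rewrite -ball_normE /= distrC. Qed.

Lemma ball_segment x y z d t : 0 <= t <= 1 -> ball x d y -> ball x d z ->
  ball x d (y + t *: (z - y)).
Proof.
move=> /andP[t0 t1] /ball_normP yd /ball_normP zd; apply/ball_normP.
have -> : y + t *: (z - y) - x = (1 - t) *: (y - x) + t *: (z - x).
  by apply/rowP => i; rewrite !mxE; ring.
rewrite (le_lt_trans (ler_normD _ _)) // !normrZ !ger0_norm ?subr_ge0 //.
move: `|y - x| `|z - x| yd zd => a b ad bd.
have [->|tn0] := eqVneq t 0; first by rewrite subr0 mul1r mul0r addr0.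
have tpos : 0 < t by rewrite lt0r tn0.
rewrite [ltRHS](_ : d = (1 - t) * d + t * d); last by ring.
apply: ler_ltD.
  by apply: ler_wpM2l; [rewrite subr_ge0|exact: ltW].
by rewrite ltr_pM2l.
Qed.

(** Near a point where the differential of f is the identity, f - id has a
    small differential, hence contracts distances. *)
Lemma near_identity f W x0 : open W -> W x0 -> ndiff 1 W f -> 'J f x0 = 1%:M ->
  exists2 d, 0 < d & ball x0 d `<=` W /\
    forall x y, ball x0 d x -> ball x0 d y ->
      `|(f x - x) - (f y - y)| <= 2^-1 * `|x - y|.
Proof.
move=> oW Wx0 df Jf.
pose r y := f y - y.
have dr : ndiff 1 W r.
  by apply: ndiff_add => //; apply: ndiff_opp => //; exact: ndiff_id.
have dre := (ndiff_entries 1 r oW).1 dr 0.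
(* The m partial derivatives in a direction, each below e, add up to at most 1/2;
   m + 1 instead of m covers the case m = 0. *)
pose e : R := (2 * m.+1%:R)^-1.
have e0 : 0 < e by rewrite invr_gt0 mulr_gt0.
have pr0 i a : pder i (fun y => r y 0 a) x0 = 0.
  have dfx := ndiff_differentiable df Wx0.
  have di : differentiable (fun y : 'rV[R]_m => y) x0 by exact: ex_diff.
  rewrite -pder_entry; last exact: ndiff_differentiable dr Wx0.
  rewrite (pder_sub i dfx di) mxE [X in _ + X]mxE.
  rewrite (pder_entry i 0 a dfx) (pder_entry i 0 a di).
  by rewrite -(jacobianE i a dfx) -(jacobianE i a di) Jf jacobian_id subrr.
have : \forall y \near x0, W y /\ forall i a, `|pder i (fun y => r y 0 a) y| < e.
  have nW : \forall y \near x0, W y by exact: open_nbhs_nbhs.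
  have nr : \forall y \near x0,
      forall ia : 'I_m * 'I_m, `|pder ia.1 (fun y => r y 0 ia.2) y| < e.
    apply: (@filter_forall _ ('I_m * 'I_m)%type
      (fun ia y => `|pder ia.1 (fun y => r y 0 ia.2) y| < e) _
      (nbhs_filter x0)) => -[i a] /=.
    have : {for x0, continuous (pder i (fun y => r y 0 a))}.
      apply: differentiable_continuous.
      exact: ndiff_differentiable (ndiff_pder i (dre a)) Wx0.
    move=> /cvgrPdist_lt /(_ _ e0); rewrite pr0.
    by apply: filterS => y; rewrite sub0r normrN.
  by near=> y; split; [exact: (near nW y)|move=> i a; exact: (near nr y _ (i, a))].
move=> /nbhs_ballP[d /= d0 dP]; exists d => //; split=> [y /dP[]//|x y xd yd].
apply: mx_norm_le => [|c a]; first by rewrite mulr_ge0 // invr_ge0.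
rewrite ord1 {c}.
have drl t : 0 <= t <= 1 -> differentiable (fun y => r y 0 a) (y + t *: (x - y)).
  move=> t01; have [Wz _] := dP _ (ball_segment t01 yd xd).
  exact: ndiff_differentiable (dre a) Wz.
have [t t01] := mean_value_line ler01 drl.
rewrite scale1r mul1r subrKC => ra.
have -> : ((f x - x) - (f y - y)) 0 a = r x 0 a - r y 0 a.
  by rewrite [LHS]mxE [X in _ + X]mxE.
rewrite ra deriv_pder; last exact: drl.
have [_ pe] := dP _ (ball_segment t01 yd xd).
apply: (le_trans (ler_norm_sum _ _ _)).
apply: (@le_trans _ _ (\sum_(i < m) `|x - y| * e)).
  apply: ler_sum => i _; rewrite /GRing.scale /= normrM ler_pM //.
    exact: entry_le_norm.
  exact/ltW/pe.
rewrite sumr_const card_ord -[leLHS]mulr_natr -mulrA mulrC ler_wpM2r //.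
rewrite /e invfM -mulrA ler_piMr ?invr_ge0 // mulrC ler_pdivrMr // mul1r ler_nat.
exact: leqnSn.
Unshelve. all: by end_near. Qed.

(** Such an f satisfies |f y - f z| >= |y - z| / 2, so no nonzero vector lies in
    the kernel of its differential. *)
Lemma near_identity_unitmx f x d : (0 < d) ->
  (forall y z, ball x d y -> ball x d z ->
      `|(f y - y) - (f z - z)| <= 2^-1 * `|y - z|) ->
  differentiable f x -> 'J f x \in unitmx.
Proof.
move=> d0 fL df; rewrite -row_free_unit -kermx_eq0; apply/rowV0P => v.
move=> /sub_kermxP vJ; have Dv : 'D_v f x = 0 by rewrite deriveEjacobian.
apply/eqP; rewrite -normr_le0.
have h4 : (0 : R) < 4^-1 by rewrite invr_gt0.
have /nbhs_ballP[e /= e0 eP] := differentiable_expand df h4.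
pose s := Num.min d e / (2 * (`|v| + 1)).
have s0 : 0 < s by rewrite divr_gt0 ?lt_min ?d0 // mulr_gt0 // ltr_wpDl.
have sv : `|s *: v| < Num.min d e.
  rewrite normrZ gtr0_norm // /s mulrAC ltr_pdivrMr ?mulr_gt0 ?ltr_wpDl //.
  rewrite ltr_pM2l ?lt_min ?d0 //; have := normr_ge0 v; lra.
move: sv; rewrite lt_min => /andP[svd sve].
have := eP (s *: v); rewrite ball_normP subr0 => /(_ sve).
rewrite linearZ /= -deriveE // Dv scaler0 subr0.
have bx : ball x d (s *: v + x) by apply/ball_normP; rewrite addrK.
have bxx : ball x d x by exact: ballxx.
have := fL _ _ bx bxx.
have -> : f (s *: v + x) - (s *: v + x) - (f x - x)
    = f (s *: v + x) - f x - s *: v.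
  by apply/rowP => i; rewrite !mxE; ring.
rewrite addrK; move: (f (s *: v + x) - f x) => w h1 h2.
have := ler_normB (w) (w - s *: v); rewrite subKr.
rewrite normrZ gtr0_norm // in h1 h2 * => h3.
rewrite -(pmulr_rle0 _ s0).
move: h1 h2 h3; move: (s * `|v|) `|w - _| `|w| => a b c; lra.
Qed.

Lemma ndiff_jacobian n p W (f : 'rV[R]_m -> 'rV[R]_p) : open W ->
  ndiff n.+1 W f -> ndiff n W (fun x => 'J f x).
Proof.
move=> oW df; apply/ndiff_entries => // i a.
apply: (@ndiff_eq _ _ n _ W (pder i (fun y => f y 0 a))) => //.
  by move=> x Wx; rewrite jacobianE //; exact: ndiff_differentiable df Wx.
by apply: ndiff_pder; move/(ndiff_entries _ _ oW) : df; exact.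
Qed.

Lemma mulmx_linear_continuous p (A : 'M[R]_(m, p)) :
  exists2 L : {linear 'rV[R]_m -> 'rV[R]_p}, continuous L & forall v, L v = v *m A.
Proof.
exists (mulmxr A : {linear 'rV[R]_m -> 'rV[R]_p}) => // x.
apply: differentiable_continuous; apply: (@differentiable_mulmx _ _ _ _ _ id (cst A)).
  exact: ex_diff.
exact: differentiable_cst.
Qed.

(** The expansion of f at g y has an error small against g z - g y, thus also
    against z - y by the Lipschitz bound; apply the inverse matrix to it. *)
Lemma inverse_differentiable f g x y : f x = y -> g y = x ->
  differentiable f x -> 'J f x \in unitmx ->
  (\forall z \near y, f (g z) = z /\ `|g z - g y| <= 2 * `|z - y|) ->
  differentiable g y /\ 'J g y = invmx ('J f x).
Proof.
move=> + gyx; rewrite -{x}gyx => fx df Ju near_g.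
have [L Lc LE] := mulmx_linear_continuous (invmx ('J f (g y))).
have [C C0 CL] := linear_lipschitz Lc.
have [] := @expand_differentiable _ _ _ g y L Lc; last first.
  move=> dg dgL; split => //; apply/row_matrixP => i.
  apply: (etrans (row_jacobian i dg)).
  by rewrite /pder deriveE // dgL LE rowE.
move=> e e0.
have e'0 : 0 < e / (C * 2) by rewrite divr_gt0 // mulr_gt0.
have := differentiable_expand df e'0 => /nbhs_ballP[s /= s0 sP].
have ng : \forall h \near 0, f (g (h + y)) = h + y /\ `|g (h + y) - g y| <= 2 * `|h|.
  move: near_g; rewrite (near_shift 0) subr0.
  by apply: filterS => h /=; rewrite addrK.
have nh : \forall h \near (0 : 'rV[R]_m), `|h| < s / 2.
  apply/nbhs_ballP; exists (s / 2) => /=; first by rewrite divr_gt0.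
  by move=> h /ball_normP; rewrite subr0.
near=> h.
have [fg gL] : f (g (h + y)) = h + y /\ `|g (h + y) - g y| <= 2 * `|h|.
  exact: (near ng h).
have hs : `|h| < s / 2 by exact: (near nh h).
have := sP (g (h + y) - g y).
rewrite /= subrK fg fx addrK -deriveE // deriveEjacobian // => hk.
have {}hk : `|h - (g (h + y) - g y) *m 'J f (g y)| <= e / (C * 2) * `|g (h + y) - g y|.
  apply: hk; apply/ball_normP; rewrite subr0 (le_lt_trans gL) //.
  by move: hs; rewrite ltr_pdivlMr // mulrC.
set k := g (h + y) - g y in gL hk *.
have -> : k - L h = - L (h - k *m 'J f (g y)).
  by rewrite linearB /= !LE mulmxK // opprB.
rewrite normrN (le_trans (CL _)) //.
rewrite (@le_trans _ _ (C * (e / (C * 2) * (2 * `|h|)))) //.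
  by rewrite ler_pM2l // (le_trans hk) // ler_pM2l.
rewrite le_eqVlt; apply/orP; left; apply/eqP.
by field; rewrite gt_eqF.
Unshelve. all: by end_near. Qed.

(** The inverse g is the fixed point of x |-> y - (f x - x), which is a
    contraction near x0. It is smooth by bootstrapping: its differential is the
    inverse matrix of that of f at g, and thus as differentiable as g is. *)
Theorem inverse_function f W x0 : open W -> W x0 -> (forall n, ndiff n W f) ->
  'J f x0 = 1%:M ->
  exists U V g, [/\ open U, open V, U x0 & U `<=` W] /\
    [/\ forall x, U x -> V (f x) /\ g (f x) = x,
        forall y, V y -> U (g y) /\ f (g y) = y &
        forall n, ndiff n V g].
Proof.
move=> oW Wx0 df Jf.
have [d d0 [dW fL]] := near_identity oW Wx0 (df 1%N) Jf.
pose rho := d / 2.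
have rho0 : 0 < rho by rewrite divr_gt0.
have rhod : rho < d by rewrite /rho ltr_pdivrMr // ltr_pMr // ltr1n.
have sub_rho : ball x0 rho `<=` ball x0 d by apply: le_ball; exact: ltW.
have expanding x y : ball x0 d x -> ball x0 d y -> `|x - y| <= 2 * `|f x - f y|.
  move=> xd yd; have := fL _ _ xd yd.
  have := ler_normB (f x - f y) ((f x - x) - (f y - y)).
  have -> : f x - f y - (f x - x - (f y - y)) = x - y.
    by apply/rowP => i; rewrite !mxE; ring.
  move: `|x - y| `|f x - f y| `|_ - _| => a b c; lra.
pose V := ball (f x0) (rho / 2).
pose U := ball x0 rho `&` f @^-1` V.
have solve y : V y -> exists x, ball x0 rho x /\ f x = y.
  move=> /ball_normP yV.
  pose s := 2 * `|y - f x0|.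
  have srho : s < rho by rewrite /s mulrC -ltr_pdivlMr.
  have s0 : 0 <= s by rewrite mulr_ge0.
  pose B := closed_ball_ (fun x : 'rV[R]_m => `|x|) x0 s.
  have Bd x : B x -> ball x0 rho x.
    rewrite /B /closed_ball_ /= distrC => xs; apply/ball_normP.
    exact: le_lt_trans srho.
  have [||||x Bx xE] := @contraction_fixed_point _ _ B (fun x => y - (f x - x)) x0.
  - exact: closed_closed_ball_.
  - by rewrite /B /closed_ball_ /= subrr normr0.
  - move=> x Bx; have := fL _ _ (sub_rho _ (Bd _ Bx)) (ballxx x0 d0).
    move: Bx; rewrite /B /closed_ball_ /= distrC => Bx rx.
    rewrite (_ : x0 - _ = (f x - x) - (f x0 - x0) - (y - f x0)); last first.
      by apply/rowP => i; rewrite !mxE; ring.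
    rewrite (le_trans (ler_normB _ _)) // (le_trans (lerD rx (lexx _))) //.
    move: Bx; rewrite /s; move: `|x - x0| `|y - f x0| => a b; lra.
  - move=> x z Bx Bz; have := fL _ _ (sub_rho _ (Bd _ Bx)) (sub_rho _ (Bd _ Bz)).
    rewrite (_ : y - _ - _ = - ((f x - x) - (f z - z))) ?normrN //.
    by apply/rowP => i; rewrite !mxE; ring.
  exists x; split; first exact: Bd.
  have := xE; rewrite opprB addrCA => /esym/eqP.
  by rewrite -subr_eq0 addrAC subrr add0r subr_eq0 => /eqP.
pose g y := xget x0 [set x | ball x0 rho x /\ f x = y].
have gV y : V y -> ball x0 rho (g y) /\ f (g y) = y.
  move=> /solve[x xy].
  exact: (@xgetPex _ x0 [set x | ball x0 rho x /\ f x = y] (ex_intro _ x xy)).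
have gU y : V y -> U (g y) /\ f (g y) = y.
  by move=> Vy; have [gb fg] := gV y Vy; split => //; split => //=; rewrite fg.
have oV : open V by exact: ball_open.
have fU x : U x -> V (f x) /\ g (f x) = x.
  move=> [xr Vfx]; split => //; have [gb fg] := gV _ Vfx.
  have := expanding _ _ (sub_rho _ gb) (sub_rho _ xr).
  by rewrite fg subrr normr0 mulr0 normr_le0 subr_eq0 => /eqP.
exists U, V, g; split; split => //.
- rewrite openE => x [xr Vfx]; apply: filterI.
    by apply: open_nbhs_nbhs; split => //; exact: ball_open.
  have : {for x, continuous f}.
    apply: differentiable_continuous; apply: ndiff_differentiable (df 0%N) _.
    exact/dW/sub_rho.
  by apply; apply: open_nbhs_nbhs.
- by split; [exact: ballxx|apply: ballxx; rewrite divr_gt0].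
- by move=> x [xr _]; exact/dW/sub_rho.
have dg y : V y -> differentiable g y /\ 'J g y = invmx ('J f (g y)).
  move=> Vy; have [gb fg] := gV _ Vy.
  have dfg : differentiable f (g y).
    by apply: ndiff_differentiable (df 0%N) _; exact/dW/sub_rho.
  apply: inverse_differentiable => //.
    apply: (@near_identity_unitmx f (g y) rho) => // u v ud vd.
    have nearer w : ball (g y) rho w -> ball x0 d w.
      by move=> gw; rewrite [d]splitr; exact: ball_triangle gb gw.
    by apply: fL; exact: nearer.
  have nV : \forall z \near y, V z by exact: open_nbhs_nbhs.
  near=> z; have Vz : V z by exact: (near nV z).
  have [gzb fgz] := gV _ Vz; split => //.
  have := expanding _ _ (sub_rho _ gzb) (sub_rho _ gb).
  by rewrite fgz fg.
elim=> [|n IHn]; first by split => // y /dg[].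
split=> [y /dg[]//|i].
apply: (@ndiff_eq _ _ n _ V (fun y => delta_mx 0 i *m invmx ('J f (g y)))) => //.
  move=> y Vy; have [dgy <-] := dg _ Vy.
  by rewrite -rowE; exact: row_jacobian.
apply: ndiff_mulmx => //; first exact: ndiff_cst.
apply: ndiff_invmx => // [y Vy|].
  have [gb _] := gV _ Vy; apply: (@near_identity_unitmx f (g y) rho) => //.
    move=> u v ud vd.
    have nearer w : ball (g y) rho w -> ball x0 d w.
      by move=> gw; rewrite [d]splitr; exact: ball_triangle gb gw.
    by apply: fL; exact: nearer.
  by apply: ndiff_differentiable (df 0%N) _; exact/dW/sub_rho.
apply: (@ndiff_comp _ _ _ _ _ n V W g (fun x => 'J f x)) => //.
  by move=> y /gV[gb _]; exact/dW/sub_rho.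
exact: ndiff_jacobian.
Unshelve. all: by end_near. Qed.

End Local_inverse.

(** * Bump functions *)

Section Flat.
Context {R : realType}.
Implicit Types (P : {poly R}) (t u : R).

(** Sums of functions t^-k exp(-1/t), extended by 0 to the half-line t <= 0:
    a family closed under differentiation. *)
Definition flat P t : R := if 0 < t then P.[t^-1] * expR (- t^-1) else 0.

Lemma horner_le_expR P : exists2 C, 0 <= C &
  forall u, 0 <= u -> `|P.[u]| <= C * expR u.
Proof.
exists (\sum_(i < size P) `|P`_i| * i`!%:R).
  by apply: sumr_ge0 => i _; rewrite mulr_ge0.
move=> u u0; rewrite horner_coef (le_trans (ler_norm_sum _ _ _)) // mulr_suml.
apply: ler_sum => i _; rewrite normrM -mulrA ler_wpM2l // normrX ger0_norm //.
case: (nat_of_ord i) => [|k]; first by rewrite expr0 fact0 mul1r -expR0 ler_expR.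
rewrite mulrC -ler_pdivrMr ?ltr0n ?fact_gt0 //.
by apply: le_trans (expR_ge1Dxn k u0); rewrite lerDr.
Qed.

Lemma is_derive_flat P t :
  is_derive t 1 (flat P) (flat ('X ^+ 2 * (P - P^`())) t).
Proof.
case: (ltgtP t 0) => [t0|t0|->].
- rewrite {2}/flat ltNge (ltW t0) /=.
  apply: (@near_eq_is_derive _ _ _ (fun=> 0)).
  have nt : \forall s \near t, s < 0 by exact: lt_nbhsl.
  by near=> s; rewrite /flat ltNge (ltW (near nt s _)).
- rewrite {2}/flat t0.
  pose f := (horner P \o GRing.inv) * (expR \o (fun t => - t^-1)).
  apply: (@near_eq_is_derive _ _ _ f).
    have nt : \forall s \near t, 0 < s by exact: lt_nbhsr.
    by near=> s; rewrite /flat (near nt s _).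
  have dV : is_derive t 1 (GRing.inv : R -> R) (- t ^- 2).
    apply: DeriveDef; first by apply: derivableV; rewrite ?gt_eqF.
    by rewrite deriveV ?gt_eqF // derive_id /GRing.scale /= mulr1.
  have dN := is_deriveN dV.
  have dP := @is_derive1_comp _ (horner P) GRing.inv t _ _ (is_derive_poly P t^-1) dV.
  have dE := @is_derive1_comp _ expR (- (GRing.inv : R -> R)) t _ _
    (is_derive_expR _) dN.
  apply: (is_derive_eq (is_deriveM dP dE)).
  rewrite /GRing.scale /= hornerM hornerXn hornerD hornerN opprK -exprVn fctE.
  ring.
- rewrite {2}/flat ltxx; have f0 : flat P 0 = 0 by rewrite /flat ltxx.
  have [C C0 PC] := horner_le_expR ('X * ('X * P)).
  suff cv : h^-1 *: ((flat P \o shift 0) (h *: 1) - flat P 0) @[h --> 0^'] --> (0 : R).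
    by apply: DeriveDef; [apply/cvg_ex; exists 0|exact: cvg_lim cv].
  apply/cvgrPdist_le => e e0.
  have C1 : 0 < C + 1 by rewrite ltr_wpDl.
  have ns : \forall s \near (0 : R)^', `|s| < e / (C + 1).
    by apply: dnbhs0_lt; rewrite divr_gt0.
  near=> s; have s_small : `|s| < e / (C + 1) by exact: (near ns s).
  rewrite sub0r normrN f0 subr0 /= addr0 [_%:A]mulr1 /GRing.scale /= /flat.
  case: ltP => [s0|_]; last by rewrite mulr0 normr0 ltW.
  have u0 : 0 <= s^-1 by rewrite invr_ge0 ltW.
  have := PC _ u0; rewrite !hornerM !hornerX !normrM (ger0_norm u0) => h.
  rewrite (gtr0_norm (expR_gt0 _)) expRN.
  rewrite mulrA ler_pdivrMr ?expR_gt0 //.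
  have := ler_wpM2l (ltW s0) h.
  rewrite !mulrA mulfV ?gt_eqF // mul1r => /le_trans; apply.
  rewrite ler_wpM2r ?expR_ge0 //.
  rewrite (@le_trans _ _ (s * (C + 1))) //; first by rewrite ler_pM2l // lerDl.
  by move: s_small; rewrite gtr0_norm // ltr_pdivlMr // => /ltW.
Unshelve. all: by end_near. Qed.

Lemma flat_gt0 t : 0 < t -> 0 < flat 1 t.
Proof. by move=> t0; rewrite /flat t0 hornerE mul1r expR_gt0. Qed.

Lemma ndiff_flat m n (U : set 'rV[R]_m) (f : 'rV[R]_m -> R) P : open U ->
  ndiff n U f -> ndiff n U (fun x => flat P (f x)).
Proof.
move=> oU df.
apply: (@ndiff_comp1 _ _ setT [set h | exists P, h = flat P] n U f) => //.
  move=> _ [Q ->]; exists (flat ('X ^+ 2 * (Q - Q^`()))).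
    by exists ('X ^+ 2 * (Q - Q^`())).
  by move=> t _; exact: is_derive_flat.
by exists P.
Qed.

Lemma bump_function m (a : 'rV[R]_m) r : 0 < r -> exists rho : 'rV[R]_m -> R,
  [/\ forall n, ndiff n setT rho, rho a != 0 &
      forall x, r <= `|x - a| -> rho x = 0].
Proof.
move=> r0.
exists (fun x => \prod_(i < m) flat 1 (r ^+ 2 - (x 0 i - a 0 i) ^+ 2)); split.
- move=> n; have oT : open [set: 'rV[R]_m] by exact: openT.
  apply: ndiff_prod => // i; apply: ndiff_flat => //.
  have dx : ndiff n setT (fun x : 'rV[R]_m => x 0 i - a 0 i).
    by apply: ndiff_add; [by []|exact: ndiff_coord|exact: ndiff_cst].
  apply: (@ndiff_eq _ _ n _ setT
    (fun x => r ^+ 2 + (- 1) * ((x 0 i - a 0 i) * (x 0 i - a 0 i)))) => //.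
    by move=> x _; rewrite mulN1r expr2.
  apply: ndiff_add => //; first exact: ndiff_cst.
  by apply: ndiff_mul => //; [exact: ndiff_cst|exact: ndiff_mul].
- apply/prodf_neq0 => i _; rewrite subrr expr0n subr0 gt_eqF // flat_gt0 //.
  exact: exprn_gt0.
- move=> x rx; case: (pselect (exists i, r <= `|x 0 i - a 0 i|)) => [[i ri]|nri].
    rewrite (bigD1 i) //= {1}/flat ltNge subr_le0 -[X in _ <= X]real_normK ?num_real //.
    by rewrite ler_sqr ?nnegrE ?normr_ge0 ?(ltW r0) // ri mul0r.
  have : `|x - a| < r; last by rewrite ltNge rx.
  rewrite [ltLHS]/Num.Def.normr /= mx_normrE; apply: bigmax_lt => // -[j i] _.
  by rewrite ord1 !mxE ltNge; apply/negP => ri; apply: nri; exists i.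
Qed.

End Flat.

(** * Connections in coordinates *)

Section Curvature_of_connections.
Context {R : realType} {p : nat}.

(** The curvature dB - B /\ B of the connection v |-> dv + v B on the trivial
    bundle of row vectors of length q. *)
Definition curv {q} (B : 'I_p -> 'rV[R]_p -> 'M[R]_q) (i j : 'I_p)
    (x : 'rV[R]_p) : 'M[R]_q :=
  pder i (B j) x - pder j (B i) x + B j x *m B i x - B i x *m B j x.

(** A parallel bundle map intertwines the curvatures: equate the two mixed
    second derivatives of S. *)
Lemma curv_intertwine q r (A : 'I_p -> 'rV[R]_p -> 'M[R]_q)
    (B : 'I_p -> 'rV[R]_p -> 'M[R]_r) (S : 'rV[R]_p -> 'M[R]_(q, r))
    (U : set 'rV[R]_p) x i j : open U -> U x ->
  (forall a, ndiff 1 U (A a)) -> (forall a, ndiff 1 U (B a)) -> ndiff 2 U S ->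
  (forall a y, U y -> pder a S y = A a y *m S y - S y *m B a y) ->
  curv A i j x *m S x = S x *m curv B i j x.
Proof.
move=> oU Ux dA dB dS SP.
have dAx a := ndiff_differentiable (dA a) Ux.
have dBx a := ndiff_differentiable (dB a) Ux.
have dSx := ndiff_differentiable dS Ux.
have second a b : pder a (pder b S) x =
    pder a (A b) x *m S x + A b x *m (A a x *m S x - S x *m B a x)
    - ((A a x *m S x - S x *m B a x) *m B b x + S x *m pder a (B b) x).
  have -> : pder a (pder b S) x = pder a (fun y => A b y *m S y - S y *m B b y) x.
    apply: near_eq_pder.
    have nU : \forall y \near x, U y by exact: open_nbhs_nbhs.
    by near=> y; apply: SP; exact: (near nU y).
  rewrite (@pder_sub _ _ _ (fun y => A b y *m S y) (fun y => S y *m B b y)).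
  - by rewrite (pder_mulmx a (dAx b) dSx) (pder_mulmx a dSx (dBx b)) SP.
  - exact: differentiable_mulmx.
  - exact: differentiable_mulmx.
have := etrans (esym (second i j)) (etrans (pder_comm i j oU Ux dS) (second j i)).
rewrite /curv !(mulmxDl, mulmxDr, mulmxBl, mulmxBr, mulmxN, mulNmx) !mulmxA.
move: (pder i (A j) x *m S x) (pder j (A i) x *m S x)
  (S x *m pder i (B j) x) (S x *m pder j (B i) x)
  (A j x *m A i x *m S x) (A i x *m A j x *m S x)
  (S x *m B j x *m B i x) (S x *m B i x *m B j x)
  (A i x *m S x *m B j x) (A j x *m S x *m B i x).
move=> a1 a2 b1 b2 c1 c2 d1 d2 e1 e2 /matrixP E.
by apply/matrixP => k l; have := E k l; rewrite !mxE; lra.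
Unshelve. all: by end_near. Qed.

End Curvature_of_connections.

Section Pullback_connection.
Context {R : realType} {k m q : nat}.
Variables (sigma : 'rV[R]_k -> 'rV[R]_m) (V : set 'rV[R]_k) (U : set 'rV[R]_m).
Variable (B : 'I_m -> 'rV[R]_m -> 'M[R]_q).
Hypotheses (oV : open V) (oU : open U) (VU : forall u, V u -> U (sigma u)).
Hypotheses (ds : forall n, ndiff n V sigma) (dB : forall n a, ndiff n U (B a)).

(** The pull-back along sigma of the connection with matrices B. *)
Definition pull_conn (i : 'I_k) (u : 'rV[R]_k) : 'M[R]_q :=
  \sum_a 'J sigma u i a *: B a (sigma u).

Let ds0 u (Vu : V u) : differentiable sigma u := ndiff_differentiable (ds 0) Vu.

Lemma ndiff_pull n p r (A : 'rV[R]_m -> 'M[R]_(p, r)) :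
  ndiff n U A -> ndiff n V (fun u => A (sigma u)).
Proof. by move=> dA; exact: ndiff_comp VU (ds n) dA. Qed.

Lemma pder_pull p r (A : 'rV[R]_m -> 'M[R]_(p, r)) u i : V u -> ndiff 0 U A ->
  pder i (fun v => A (sigma v)) u = \sum_a 'J sigma u i a *: pder a A (sigma u).
Proof.
move=> Vu dA; rewrite pder_comp; first last.
- exact: ndiff_differentiable dA (VU Vu).
- exact: ds0.
by apply: eq_bigr => a _; congr (_ *: _); apply/esym/jacobianE; exact: ds0.
Qed.

Lemma ndiff_jac n : ndiff n V (fun u => 'J sigma u).
Proof. exact: ndiff_jacobian. Qed.

Lemma ndiff_jac_entry n i a : ndiff n V (fun u => 'J sigma u i a).
Proof. by have /(ndiff_entries _ _ oV) := ndiff_jac n; exact. Qed.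

Lemma ndiff_pull_conn n i : ndiff n V (pull_conn i).
Proof.
apply: ndiff_sum => // a; apply: ndiff_scale => //; first exact: ndiff_jac_entry.
exact: ndiff_pull.
Qed.

Lemma pder_jac_sym u i j a : V u ->
  pder i (fun v => 'J sigma v j a) u = pder j (fun v => 'J sigma v i a) u.
Proof.
move=> Vu.
have nV : \forall v \near u, V v by exact: open_nbhs_nbhs.
have e b c : pder b (fun v => 'J sigma v c a) u
    = pder b (pder c (fun v => sigma v 0 a)) u.
  apply: near_eq_pder; near=> v; apply: jacobianE; apply: ds0.
  exact: (near nV v).
apply: (etrans (e i j)); apply: (etrans _ (esym (e j i))).
apply: (pder_comm_scalar i j oV Vu).
by have /(ndiff_entries _ _ oV) := ds 2; exact.
Unshelve. all: by end_near. Qed.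

Lemma row_pder_jac_sym u i j : V u ->
  row j (pder i (fun v => 'J sigma v) u) = row i (pder j (fun v => 'J sigma v) u).
Proof.
move=> Vu; have dJ := ndiff_differentiable (ndiff_jac 0) Vu.
apply/rowP => a; rewrite [LHS]mxE [RHS]mxE.
apply: (etrans (pder_entry i j a dJ)); apply: (etrans _ (esym (pder_entry j i a dJ))).
exact: pder_jac_sym.
Qed.

(** The second derivatives of sigma cancel by symmetry, which leaves only the
    curvature of B. *)
Lemma curv_pull i j u : V u -> curv pull_conn i j u
  = \sum_a \sum_b ('J sigma u i a * 'J sigma u j b) *: curv B a b (sigma u).
Proof.
move=> Vu.
have d1 a b : pder a (pull_conn b) u =
    \sum_c pder a (fun v => 'J sigma v b c) u *: B c (sigma u)
    + \sum_c \sum_d ('J sigma u a d * 'J sigma u b c) *: pder d (B c) (sigma u).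
  rewrite pder_sum => [|c]; last first.
    apply: ndiff_differentiable Vu.
    apply: (ndiff_scale (n := 0)) => //; first exact: ndiff_jac_entry.
    exact: ndiff_pull.
  rewrite -big_split; apply: eq_bigr => c _ /=.
  have dJc := ndiff_differentiable (ndiff_jac_entry 0 b c) Vu.
  have dBc := ndiff_differentiable (ndiff_pull (dB 0 c)) Vu.
  apply: (etrans (pder_scale a dJc dBc)); congr (_ + _).
  rewrite (pder_pull a Vu (dB 0 c)) scaler_sumr; apply: eq_bigr => d _.
  by rewrite scalerA mulrC.
rewrite /curv (d1 i j) (d1 j i).
have -> : \sum_c pder i (fun v => 'J sigma v j c) u *: B c (sigma u)
    = \sum_c pder j (fun v => 'J sigma v i c) u *: B c (sigma u).
  by apply: eq_bigr => c _; congr (_ *: _); exact: pder_jac_sym.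
rewrite opprD addrACA subrr add0r.
rewrite exchange_big /=.
rewrite /pull_conn.
have mm a b : (\sum_c 'J sigma u a c *: B c (sigma u)) *m
      (\sum_c 'J sigma u b c *: B c (sigma u))
    = \sum_c \sum_d ('J sigma u a c * 'J sigma u b d)
        *: (B c (sigma u) *m B d (sigma u)).
  rewrite mulmx_suml; apply: eq_bigr => c _.
  rewrite mulmx_sumr; apply: eq_bigr => d _.
  by rewrite -scalemxAl -scalemxAr scalerA.
rewrite !mm [X in _ + X - _]exchange_big /=.
rewrite -!sumrB -big_split -sumrB /=; apply: eq_bigr => a _.
rewrite -!sumrB -big_split -sumrB /=; apply: eq_bigr => b _.
rewrite [X in _ - X *: _]mulrC ['J sigma u j b * _]mulrC /curv.
by rewrite !scalerBr scalerDr scalerBr.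
Qed.

End Pullback_connection.

(** * The Levi-Civita connection in coordinates *)

(** The algebra of the Koszul formula: D i stands for the derivative of a metric
    in the direction i, and K i for its Christoffel symbols of the first kind. *)
Section Koszul.
Context {R : realType} {m : nat}.
Implicit Types D K : 'I_m -> 'M[R]_m.

Definition koszul D (i : 'I_m) : 'M[R]_m :=
  2^-1 *: \matrix_(j, l) (D i j l + D j i l - D l i j).

Lemma koszul_metric D i : (forall a, (D a)^T = D a) ->
  D i = koszul D i + (koszul D i)^T.
Proof.
move=> Dsym; have sym a b c : D a b c = D a c b by rewrite -{1}Dsym mxE.
apply/matrixP => j l; rewrite !mxE (sym i l j) (sym j i l) (sym l i j).
by lra.
Qed.

Lemma koszul_unique D K i : (forall a, D a = K a + (K a)^T) ->
  (forall a b, row b (K a) = row a (K b)) -> K i = koszul D i.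
Proof.
move=> DK Ksym.
have S a b c : K a b c = K b a c.
  by have /rowP/(_ c) := Ksym a b; rewrite !mxE.
apply/matrixP => j l; rewrite !mxE !DK !mxE.
rewrite (S j i l) (S l i j) (S l j i) (S j l i) (S i l j).
by lra.
Qed.

End Koszul.

Section Levi_Civita.
Context {R : realType} {m : nat}.
Implicit Types (G : 'rV[R]_m -> 'M[R]_m) (X Y Z : 'rV[R]_m -> 'rV[R]_m).

(** The connection matrices of the Levi-Civita connection in the coordinate
    frame: row j of [conn G i] is nabla_i e_j. *)
Definition conn G (i : 'I_m) (x : 'rV[R]_m) : 'M[R]_m :=
  \matrix_(j, k) christoffel G i j k x.

Lemma connE G i x : conn G i x = koszul (fun a => pder a G x) i *m invmx (G x).
Proof.
apply/matrixP => j k; rewrite mxE /christoffel mxE mulr_sumr.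
by apply: eq_bigr => l _; rewrite mulrA [X in _ = X * _]mxE [X in _ = _ * X * _]mxE.
Qed.

Lemma nablaE G X Y x :
  nabla G X Y x = 'D_(X x) Y x + \sum_i X x 0 i *: (Y x *m conn G i x).
Proof.
rewrite /nabla; congr (_ + _); apply/rowP => k.
rewrite mxE summxE; apply: eq_bigr => i _.
rewrite mxE [in RHS]mxE mulr_sumr; apply: eq_bigr => j _.
by rewrite [X in _ = _ * (_ * X)]mxE mulrA.
Qed.

Section Metric.
Variables (G : 'rV[R]_m -> 'M[R]_m) (U : set 'rV[R]_m).
Hypotheses (oU : open U) (dG : forall n, ndiff n U G).
Hypotheses (Gsym : forall x, U x -> (G x)^T = G x).
Hypotheses (Gunit : forall x, U x -> G x \in unitmx).

Lemma pder_metric_sym i x : U x -> (pder i G x)^T = pder i G x.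
Proof.
move=> Ux; rewrite -pder_trmx; last exact: ndiff_differentiable (dG 0) Ux.
apply: near_eq_pder; have nU : \forall y \near x, U y by exact: open_nbhs_nbhs.
by near=> y; apply: Gsym; exact: (near nU y).
Unshelve. all: by end_near. Qed.

Lemma conn_mul_metric i x : U x ->
  conn G i x *m G x = koszul (fun a => pder a G x) i.
Proof. by move=> Ux; rewrite connE mulmxKV // Gunit. Qed.

Lemma metric_compatible i x : U x ->
  pder i G x = conn G i x *m G x + (conn G i x *m G x)^T.
Proof.
move=> Ux; rewrite conn_mul_metric //.
by apply: (@koszul_metric _ _ (fun a => pder a G x)) => a; exact: pder_metric_sym.
Qed.

Lemma row_conn_sym i j x : U x -> row j (conn G i x) = row i (conn G j x).
Proof.
move=> Ux; apply/rowP => k; rewrite [LHS]mxE [LHS]mxE [RHS]mxE [RHS]mxE.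
rewrite /christoffel; congr (_ * _); apply: eq_bigr => l _; congr (_ * _).
have e : pder l G x j i = pder l G x i j.
  by rewrite -{1}(pder_metric_sym l Ux) [LHS]mxE.
by rewrite e [pder i G x j l + _]addrC.
Qed.

Lemma conn_unique x (C : 'I_m -> 'M[R]_m) : U x ->
  (forall i, pder i G x = C i *m G x + (C i *m G x)^T) ->
  (forall i j, row j (C i) = row i (C j)) ->
  forall i, C i = conn G i x.
Proof.
move=> Ux CG Csym i; apply: (can_inj (mulmxK (Gunit Ux))).
rewrite conn_mul_metric //.
apply: (@koszul_unique _ _ (fun a => pder a G x) (fun a => C a *m G x)) => // a b.
by rewrite !row_mul Csym.
Qed.

Lemma ndiff_conn n i : ndiff n U (conn G i).
Proof.
apply: (@ndiff_eq _ _ n _ U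
  (fun x => koszul (fun a => pder a G x) i *m invmx (G x))) => //.
  by move=> x _; rewrite connE.
apply: ndiff_mulmx => //; last by apply: ndiff_invmx => //; exact: dG.
apply: ndiff_scale => //; first exact: ndiff_cst.
apply/ndiff_entries => // j l; under eq_fun do rewrite mxE.
have e a b c : ndiff n U (fun x => pder a G x b c).
  by have /(ndiff_entries _ _ oU) := ndiff_pder a (dG n.+1); exact.
apply: ndiff_add => //; first exact: ndiff_add.
apply: (@ndiff_eq _ _ n _ U (fun x => (-1) * pder l G x i j)) => //.
  by move=> x _; rewrite mulN1r.
by apply: ndiff_mul => //; exact: ndiff_cst.
Qed.

Lemma curvature_basis i j l x : U x ->
  curvature G (cst (basis_vec i)) (cst (basis_vec j)) (cst (basis_vec l)) x
  = row l (curv (conn G) i j x).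
Proof.
move=> Ux.
have first_order a b : nabla G (cst (basis_vec a)) (cst (basis_vec b))
    = fun y => basis_vec b *m conn G a y.
  apply/funext => y; rewrite nablaE derive_cst add0r (bigD1 a) //=.
  rewrite big1 ?addr0 => [|c ca]; first by rewrite mxE !eqxx scale1r.
  by rewrite mxE (negPf ca) scale0r.
have second_order a b c :
    nabla G (cst (basis_vec a)) (nabla G (cst (basis_vec b)) (cst (basis_vec c))) x
    = basis_vec c *m (pder a (conn G b) x + conn G b x *m conn G a x).
  rewrite nablaE first_order mulmxDr; congr (_ + _).
    have dc := ndiff_differentiable (ndiff_conn 0 b) Ux.
    have dv := differentiable_cst (basis_vec c : 'rV[R]_m) x.
    apply: (etrans (pder_mulmx a dv dc)).
    by rewrite (pder_cst (basis_vec c : 'rV[R]_m)) mul0mx add0r.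
  rewrite (bigD1 a) //= big1 ?addr0 => [|d da]; last first.
    by rewrite mxE (negPf da) scale0r.
  by rewrite mxE !eqxx scale1r mulmxA.
rewrite /curvature !second_order.
have -> : nabla G (bracket (cst (basis_vec i)) (cst (basis_vec j)))
    (cst (basis_vec l)) x = 0.
  rewrite nablaE /bracket !derive_cst subrr add0r big1 // => c _.
  by rewrite mxE scale0r.
rewrite subr0 -mulmxBr /basis_vec -rowE /curv; congr (row _ _).
rewrite opprD addrACA -!addrA; congr (_ + (_ + _)).
Qed.

Lemma ricciE x i j : U x ->
  ricci G x i j = \sum_k curv (conn G) k i x j k.
Proof.
move=> Ux; rewrite [LHS]mxE; apply: eq_bigr => k _.
by rewrite curvature_basis // [LHS]mxE.
Qed.

Lemma lie_metricE X x : U x -> differentiable X x ->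
  lie_metric G X x = \sum_a X x 0 a *: pder a G x
    + 'J X x *m G x + ('J X x *m G x)^T.
Proof.
move=> Ux dX; apply/matrixP => i j.
have bra k : bracket X (cst (basis_vec k)) x = - row k ('J X x).
  by rewrite /bracket derive_cst sub0r (row_jacobian k dX).
have innerE (A : 'M[R]_m) k l : inner A (basis_vec k) (basis_vec l) = A k l.
  by rewrite /inner /basis_vec -rowE trmx_delta -colE [LHS]mxE mxE.
have dGx := ndiff_differentiable (dG 0) Ux.
rewrite [LHS]mxE [RHS]mxE [X in _ = X + _]mxE !bra.
have -> : inner (G x) (- row i ('J X x)) (basis_vec j) = - ('J X x *m G x) i j.
  rewrite /inner /basis_vec trmx_delta -colE [LHS]mxE mulNmx -row_mul.
  by rewrite [LHS]mxE [X in - X]mxE.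
have -> : inner (G x) (basis_vec i) (- row j ('J X x)) = - ('J X x *m G x) j i.
  have -> u v : inner (G x) u v = inner (G x) v u.
    rewrite /inner -{1}[u *m G x *m v^T]trmxK [LHS]mxE.
    by rewrite !trmx_mul trmxK Gsym // mulmxA.
  rewrite /inner /basis_vec trmx_delta -colE [LHS]mxE mulNmx -row_mul.
  by rewrite [LHS]mxE [X in - X]mxE.
rewrite !opprK [X in _ = _ + X]mxE; congr (_ + _ + _).
under eq_fun do rewrite innerE.
rewrite (deriv_pder _ (differentiable_entry i j dGx)) summxE.
apply: eq_bigr => a _; rewrite [RHS]mxE; congr (_ * _).
exact/esym/pder_entry.
Qed.

End Metric.
End Levi_Civita.

(** * Parallel distributions and their leaves *)

Lemma mulmx_row_eq {R : nzRingType} {p q} (A B : 'M[R]_(p, q)) :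
  (forall v : 'rV_p, v *m A = v *m B) -> A = B.
Proof. by move=> AB; apply/row_matrixP => i; rewrite !rowE. Qed.

Lemma row_sum_sym {R : comNzRingType} {p q} (D : 'I_p -> 'M[R]_(p, q))
    (w : 'rV[R]_p) i : (forall a b, row b (D a) = row a (D b)) ->
  row i (\sum_a w 0 a *: D a) = w *m D i.
Proof.
move=> Dsym; rewrite mulmx_sum_row linear_sum; apply: eq_bigr => a _ /=.
by rewrite linearZ /= Dsym.
Qed.

Section Parallel.
Context {R : realType} {m : nat}.
Implicit Types (G P : 'rV[R]_m -> 'M[R]_m).

(** The component of the covariant derivative outside the range of P is
    tensorial, so a cut-off factor rho only contributes its value. *)
Lemma nabla_projected G P (Q : 'M[R]_m) (rho : 'rV[R]_m -> R) x (v w : 'rV[R]_m) :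
  differentiable P x -> differentiable rho x -> P x *m Q = 0 ->
  nabla G (fun y => rho y *: (v *m P y)) (fun y => rho y *: (w *m P y)) x *m Q
  = rho x ^+ 2 *: (w *m \sum_i (v *m P x) 0 i *:
      ((pder i P x + P x *m conn G i x) *m Q)).
Proof.
move=> dP dr PQ.
have dw : differentiable (fun y => w *m P y) x.
  by apply: (@differentiable_mulmx _ _ _ _ _ (cst w)) => //; exact: differentiable_cst.
have dY := differentiable_scale dr dw.
rewrite nablaE (deriv_pder _ dY) -big_split mulmx_suml mulmx_sumr scaler_sumr /=.
apply: eq_bigr => i _.
have -> : pder i (fun y => rho y *: (w *m P y)) x
    = pder i rho x *: (w *m P x) + rho x *: (w *m pder i P x).
  apply: (etrans (pder_scale i dr dw)); congr (_ + _ *: _).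
  apply: (etrans (pder_mulmx i (differentiable_cst w x) dP)).
  by rewrite (pder_cst w) mul0mx add0r.
set a := w *m P x; set b := w *m pder i P x.
have aQ : a *m Q = 0 by rewrite -mulmxA PQ mulmx0.
rewrite [X in X *: (_ + _)]mxE [X in _ + X *: _]mxE.
set c := (v *m P x) 0 i.
have -> : (rho x * c) *: (pder i rho x *: a + rho x *: b)
    + (rho x * c) *: ((rho x *: a) *m conn G i x)
    = (rho x * c * pder i rho x) *: a + (rho x * c * rho x) *: (b + a *m conn G i x).
  by rewrite -scalemxAl !scalerDr !scalerA addrA.
rewrite mulmxDl -!scalemxAl aQ scaler0 add0r -scalemxAr scalerA.
by rewrite mulmxA mulmxDr mulmxA -/a -/b; congr (_ *: _); ring.
Qed.

(** The two sums vanish when the range and the kernel of P are totally geodesic: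
    N and N' below measure how far each of them is from being parallel.
    Differentiating their orthogonality shows that N and N' determine each other
    in every direction, so both vanish along the range and along the kernel. *)
Lemma parallel_projection G P (U : set 'rV[R]_m) x : open U -> U x ->
  (forall n, ndiff n U G) -> (forall y, U y -> (G y)^T = G y) ->
  (forall y, U y -> G y \in unitmx) -> (forall n, ndiff n U P) ->
  (forall y, U y -> P y *m P y = P y) ->
  (forall y, U y -> P y *m G y = G y *m (P y)^T) ->
  (forall v : 'rV_m, \sum_i (v *m P x) 0 i *:
     ((pder i P x + P x *m conn G i x) *m (1%:M - P x)) = 0) ->
  (forall v : 'rV_m, \sum_i (v *m (1%:M - P x)) 0 i *:
     ((- pder i P x + (1%:M - P x) *m conn G i x) *m P x) = 0) ->
  forall i, pder i P x = conn G i x *m P x - P x *m conn G i x.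
Proof.
move=> oU Ux dG Gsym Gunit dP PP PG h1 h2.
have dPx := ndiff_differentiable (dP 0) Ux.
have dGx := ndiff_differentiable (dG 0) Ux.
pose D i := pder i P x; pose C i := conn G i x; pose p := P x; pose g := G x.
pose N i := (D i + p *m C i) *m (1%:M - p).
pose N' i := (- D i + (1%:M - p) *m C i) *m p.
have pg : p *m g = g *m p^T by exact: PG.
(* Differentiating the orthogonality P G (1 - P)^T = 0. *)
have NN' i : N i *m g = - (g *m (N' i)^T).
  have dQ : differentiable (fun y => (1%:M - P y)^T) x.
    have d1 := differentiable_cst (1%:M : 'M[R]_m) x.
    exact: (differentiable_trmx (differentiableB d1 dPx)).
  have orth : pder i (fun y => P y *m G y *m (1%:M - P y)^T) x = 0.
    apply: (etrans _ (pder_cst (0 : 'M[R]_m) x i)).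
    apply: near_eq_pder; have nU : \forall y \near x, U y by exact: open_nbhs_nbhs.
    near=> y; have Uy : U y by exact: (near nU y).
    rewrite linearB /= trmx1 mulmxBr mulmx1 -[P y *m G y *m _]mulmxA -(PG _ Uy).
    by rewrite (mulmxA (P y) (P y)) (PP _ Uy) subrr.
  have := etrans (esym orth) (pder_mulmx i (differentiable_mulmx dPx dGx) dQ).
  rewrite (pder_mulmx i dPx dGx) (metric_compatible oU dG Gsym Gunit i Ux).
  have -> : pder i (fun y => (1%:M - P y)^T) x = - (D i)^T.
    have d1 := differentiable_cst (1%:M : 'M[R]_m) x.
    apply: (etrans (pder_trmx i (differentiableB d1 dPx))).
    rewrite -linearN /=; congr (_^T); apply: (etrans (pder_sub i d1 dPx)).
    by rewrite (pder_cst (1%:M : 'M[R]_m)) sub0r.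
  rewrite -/(D i) -/(C i) -/p -/g => /esym /eqP.
  have -> : (D i *m g + p *m (C i *m g + (C i *m g)^T)) *m (1%:M - p)^T
      + p *m g *m - (D i)^T = N i *m g + g *m (N' i)^T; last first.
    by rewrite addr_eq0 => /eqP.
  have qg : (1%:M - p) *m g = g *m (1%:M - p)^T.
    by rewrite mulmxBl pg mul1mx linearB /= trmx1 mulmxBr mulmx1.
  have gs : g^T = g by exact: Gsym.
  rewrite /N /N'; move: (1%:M - p) qg => q qg.
  have -> : ((- D i + q *m C i) *m p)^T = p^T *m (- (D i)^T + (C i)^T *m q^T).
    by rewrite trmx_mul raddfD /= raddfN /= trmx_mul.
  rewrite -(mulmxA _ q) qg trmx_mul gs (mulmxA g p^T).
  rewrite -pg !(mulmxDl, mulmxDr, mulmxN, mulNmx) !mulmxA -!addrA.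
  by congr (_ + (_ + _)); rewrite addrC.
have gu : g \in unitmx by exact: Gunit.
have N0 i : N i = 0.
  have sumN (v : 'rV[R]_m) : \sum_j v 0 j *: N j = 0 :> 'M[R]_m.
    have split_v j : v 0 j = (v *m p) 0 j + (v *m (1%:M - p)) 0 j.
      by rewrite mulmxBr mulmx1 [X in _ = _ + X]mxE [X in _ + (_ + X)]mxE subrKC.
    under eq_bigr do rewrite split_v scalerDl.
    rewrite big_split /= h1 add0r; apply: (can_inj (mulmxK gu)).
    rewrite mul0mx mulmx_suml.
    under eq_bigr do rewrite -scalemxAl NN' scalerN scalemxAr -linearZ /=.
    by rewrite sumrN -mulmx_sumr -linear_sum /= h2 trmx0 mulmx0 oppr0.
  have := sumN (delta_mx 0 i); rewrite (bigD1 i) //= big1 ?addr0 => [|j ji].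
    by rewrite mxE !eqxx scale1r.
  by rewrite mxE (negPf ji) scale0r.
move=> i; have := NN' i; rewrite N0 mul0mx => /esym /eqP.
rewrite oppr_eq0 => /eqP gN'.
have N'0 : N' i = 0.
  by apply/trmx_inj; rewrite trmx0; apply: (can_inj (mulKmx gu)); rewrite gN' mulmx0.
have := N0 i; rewrite /N mulmxBr mulmx1 => /subr0_eq E1.
rewrite -/(D i) -/(C i) -/p; apply/eqP; rewrite eq_sym subr_eq; apply/eqP.
rewrite E1; have := N'0; rewrite /N' mulmxBl mul1mx !mulmxDl !mulNmx addrCA.
by move/eqP; rewrite -opprD subr_eq0 => /eqP.
Unshelve. all: by end_near. Qed.

End Parallel.

Section Leaf.
Context {R : realType} {k m : nat}.
Variables (G P : 'rV[R]_m -> 'M[R]_m) (U : set 'rV[R]_m).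
Variables (sigma : 'rV[R]_k -> 'rV[R]_m) (H : 'rV[R]_k -> 'M[R]_k).
Variable (V : set 'rV[R]_k).
Hypotheses (oU : open U) (dG : forall n, ndiff n U G).
Hypotheses (Gsym : forall x, U x -> (G x)^T = G x).
Hypotheses (Gunit : forall x, U x -> G x \in unitmx).
Hypotheses (oV : open V) (VU : forall u, V u -> U (sigma u)).
Hypotheses (ds : forall n, ndiff n V sigma).
Hypotheses (Hpull : forall u, V u ->
  H u = 'J sigma u *m G (sigma u) *m ('J sigma u)^T).

Lemma leaf_metric_sym u : V u -> (H u)^T = H u.
Proof.
move=> Vu; rewrite Hpull // trmx_mul trmxK trmx_mul Gsym ?mulmxA //.
exact: VU.
Qed.

Let dJ n : ndiff n V (fun u => 'J sigma u).
Proof. exact: ndiff_jac. Qed.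

Let dGs n : ndiff n V (fun u => G (sigma u)).
Proof. exact: ndiff_pull (dG n). Qed.

Lemma ndiff_leaf_metric n : ndiff n V H.
Proof.
apply: (@ndiff_eq _ _ n _ V
  (fun u => 'J sigma u *m G (sigma u) *m ('J sigma u)^T)) => //.
  by move=> u Vu; rewrite Hpull.
by apply: ndiff_mulmx => //; [exact: ndiff_mulmx|exact: ndiff_trmx].
Qed.

Lemma pder_leaf_metric i u : V u -> pder i H u =
  pder i (fun v => 'J sigma v) u *m G (sigma u) *m ('J sigma u)^T
  + 'J sigma u *m (\sum_a 'J sigma u i a *: pder a G (sigma u)) *m ('J sigma u)^T
  + 'J sigma u *m G (sigma u) *m (pder i (fun v => 'J sigma v) u)^T.
Proof.
move=> Vu.
have dJu := ndiff_differentiable (dJ 0) Vu.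
have dGu := ndiff_differentiable (dGs 0) Vu.
have dJG := differentiable_mulmx dJu dGu.
have nV : \forall v \near u, V v by exact: open_nbhs_nbhs.
have HE : {near u, H =1 fun v => 'J sigma v *m G (sigma v) *m ('J sigma v)^T}.
  by near=> v; apply: Hpull; exact: (near nV v).
apply: (etrans (near_eq_pder i HE)).
apply: (etrans (pder_mulmx i dJG (differentiable_trmx dJu))).
rewrite (pder_trmx i dJu) (pder_mulmx i dJu dGu) mulmxDl.
by rewrite (pder_pull VU ds i Vu (dG 0)).
Unshelve. all: by end_near. Qed.

Section Lie_derivative.
Variables (X : 'rV[R]_m -> 'rV[R]_m) (w : 'rV[R]_k -> 'rV[R]_k).
Hypotheses (dX : forall n, ndiff n U X) (dw : forall n, ndiff n V w).
Hypotheses (wX : forall u, V u -> w u *m 'J sigma u = X (sigma u)).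

(** Naturality of the Lie derivative: as w and X are related by sigma, the second
    derivatives of sigma enter only through [related]. *)
Lemma lie_metric_pull u : V u -> lie_metric H w u
  = 'J sigma u *m lie_metric G X (sigma u) *m ('J sigma u)^T.
Proof.
move=> Vu; have Usu := VU Vu.
have dJu := ndiff_differentiable (dJ 0) Vu.
have dwu := ndiff_differentiable (dw 0) Vu.
have dXs := ndiff_differentiable (dX 0) Usu.
rewrite (lie_metricE ndiff_leaf_metric leaf_metric_sym) //.
rewrite (lie_metricE dG Gsym) //.
set J := 'J sigma u; set g := G (sigma u).
pose S := \sum_b X (sigma u) 0 b *: pder b G (sigma u).
pose M := \sum_a w u 0 a *: pder a (fun v => 'J sigma v) u.
have related : 'J w u *m J + M = J *m 'J X (sigma u).
  apply/row_matrixP => i.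
  have nV : \forall v \near u, V v by exact: open_nbhs_nbhs.
  have e1 : pder i (fun v => w v *m 'J sigma v) u = pder i (fun v => X (sigma v)) u.
    by apply: near_eq_pder; near=> v; apply: wX; exact: (near nV v).
  have := etrans (esym (pder_mulmx i dwu dJu)) e1.
  rewrite (pder_pull VU ds i Vu (dX 0)) -/J => e2.
  rewrite row_mul linearD /= row_mul (row_jacobian i dwu).
  have -> : row i M = w u *m pder i (fun v => 'J sigma v) u.
    apply: (row_sum_sym (D := fun a => pder a (fun v => 'J sigma v) u)) => a b.
    exact: row_pder_jac_sym oV ds _ _ _ Vu.
  rewrite e2 mulmx_sum_row; apply: eq_bigr => b _.
  by rewrite (row_jacobian b dXs) [in RHS]mxE.
have -> : \sum_a w u 0 a *: pder a H u
    = M *m g *m J^T + J *m S *m J^T + J *m g *m M^T.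
  under eq_bigr do rewrite pder_leaf_metric // !scalerDr.
  rewrite !big_split /= -/J -/g; congr (_ + _ + _).
  - rewrite /M !mulmx_suml; apply: eq_bigr => a _.
    by rewrite -!scalemxAl.
  - rewrite /S mulmx_sumr mulmx_suml.
    under eq_bigr do rewrite mulmx_sumr mulmx_suml scaler_sumr.
    rewrite exchange_big /=; apply: eq_bigr => b _.
    rewrite -wX // mxE -scalemxAr -scalemxAl scaler_suml.
    by apply: eq_bigr => a _; rewrite -scalemxAr -scalemxAl scalerA.
  - rewrite /M linear_sum mulmx_sumr; apply: eq_bigr => a _.
    by rewrite linearZ /= -scalemxAr.
have -> : 'J w u *m H u = 'J w u *m J *m g *m J^T by rewrite Hpull // !mulmxA.
have -> : 'J w u *m J = J *m 'J X (sigma u) - M by rewrite -related addrK.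
have gs : g^T = g by exact: Gsym.
rewrite -/S !(mulmxDl, mulmxDr) !mulNmx !(raddfD, raddfN) /=.
rewrite !trmx_mul !trmxK gs !mulmxA.
move: (M *m g *m J^T) (J *m g *m M^T) (J *m S *m J^T).
move: (J *m 'J X (sigma u) *m g *m J^T) (J *m g *m ('J X (sigma u))^T *m J^T).
move=> a b c d e; apply/matrixP => i j; rewrite !mxE; lra.
Unshelve. all: by end_near. Qed.

End Lie_derivative.

Section Totally_geodesic_leaf.
Hypothesis (dP : forall n, ndiff n U P).
Hypothesis (P_parallel : forall i x, U x ->
  pder i P x = conn G i x *m P x - P x *m conn G i x).
Hypothesis (JP : forall u, V u -> 'J sigma u *m P (sigma u) = 'J sigma u).

(** A field that P annihilates stays so under covariant derivatives; if P is
    self-adjoint, its derivative is then orthogonal to the leaf. *)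
Lemma lie_metric_orthogonal X u : (forall n, ndiff n U X) ->
  (forall x, U x -> X x *m P x = 0) ->
  (forall x, U x -> P x *m G x = G x *m (P x)^T) -> V u ->
  'J sigma u *m lie_metric G X (sigma u) *m ('J sigma u)^T = 0.
Proof.
move=> dX XP PG Vu; have Ux := VU Vu.
set x := sigma u in Ux *; set J := 'J sigma u.
have dXx := ndiff_differentiable (dX 0) Ux.
have dPx := ndiff_differentiable (dP 0) Ux.
pose K := 'J X x + \sum_a X x 0 a *: conn G a x.
have KP : K *m P x = 0.
  apply/row_matrixP => i; rewrite row_mul linearD /= (row_jacobian i dXx).
  have -> : row i (\sum_a X x 0 a *: conn G a x) = X x *m conn G i x.
    apply: (row_sum_sym (D := fun a => conn G a x)) => a b.
    exact: row_conn_sym oU dG Gsym _ _ _ Ux.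
  have XP0 : pder i (fun y => X y *m P y) x = 0.
    apply: (etrans _ (pder_cst (0 : 'rV[R]_m) x i)); apply: near_eq_pder.
    have nU : \forall y \near x, U y by exact: open_nbhs_nbhs.
    by near=> y; apply: XP; exact: (near nU y).
  have := etrans (esym XP0) (pder_mulmx i dXx dPx).
  rewrite P_parallel // mulmxBr !mulmxA XP // mul0mx subr0 mulmxDl row0.
  by move=> <-.
have -> : lie_metric G X x = K *m G x + (K *m G x)^T.
  rewrite (lie_metricE dG Gsym) // /K mulmxDl raddfD /= mulmx_suml.
  have -> : \sum_a X x 0 a *: pder a G x
      = \sum_a X x 0 a *: conn G a x *m G x + (\sum_a X x 0 a *: conn G a x *m G x)^T.
    rewrite raddf_sum -big_split; apply: eq_bigr => a _ /=.
    by rewrite (metric_compatible oU dG Gsym Gunit a Ux) scalerDr -scalemxAl linearZ.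
  by rewrite [RHS]addrACA [RHS]addrC addrA.
have KGJ : K *m G x *m J^T = 0.
  have JPx : J *m P x = J by exact: JP.
  by rewrite -JPx trmx_mul mulmxA -[K *m G x *m _]mulmxA -PG // mulmxA KP !mul0mx.
rewrite mulmxDr mulmxDl -mulmxA KGJ mulmx0 add0r.
have -> : J *m (K *m G x)^T *m J^T = (J *m (K *m G x *m J^T))^T.
  by rewrite !trmx_mul trmxK.
by rewrite KGJ mulmx0 trmx0.
Unshelve. all: by end_near. Qed.

Hypothesis (Jfree : forall u, V u -> row_free ('J sigma u)).
Hypothesis (PJ : forall u, V u -> (P (sigma u) <= 'J sigma u)%MS).
Hypothesis (Hunit : forall u, V u -> H u \in unitmx).

(** Since P is parallel and fixes the tangent vectors of the leaf, their
    covariant derivatives are again tangent; the resulting connection on the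
    leaf is symmetric and metric, hence the one of the induced metric. *)
Lemma leaf_conn i u : V u -> pder i (fun v => 'J sigma v) u
  = conn H i u *m 'J sigma u - 'J sigma u *m pull_conn sigma (conn G) i u.
Proof.
move=> Vu; have Ux := VU Vu.
have dJu := ndiff_differentiable (dJ 0) Vu.
have dPu := ndiff_differentiable (ndiff_pull oV VU ds (dP 0)) Vu.
set x := sigma u in Ux *; set J := 'J sigma u.
pose w a := pull_conn sigma (conn G) a u.
pose D a := pder a (fun v => 'J sigma v) u + J *m w a.
have DP a : D a *m P x = D a.
  have nV : \forall v \near u, V v by exact: open_nbhs_nbhs.
  have e : pder a (fun v => 'J sigma v *m P (sigma v)) u
      = pder a (fun v => 'J sigma v) u.
    by apply: near_eq_pder; near=> v; apply: JP; exact: (near nV v).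
  have := etrans (esym (pder_mulmx a dJu dPu)) e.
  have -> : pder a (fun v => P (sigma v)) u = w a *m P x - P x *m w a.
    rewrite (pder_pull VU ds a Vu (dP 0)) /w /pull_conn mulmx_suml mulmx_sumr -sumrB.
    by apply: eq_bigr => b _; rewrite P_parallel // scalerBr scalemxAl scalemxAr.
  rewrite mulmxBr !mulmxA JP // -/J -/x addrA => e2.
  by rewrite /D mulmxDl -[in RHS]e2 subrK.
pose C a := D a *m P x *m pinvmx J.
have CJ a : C a *m J = D a.
  rewrite /C -{2}(DP a) mulmxKpV //.
  by apply: submx_trans (submxMl _ _) _; exact: PJ.
have CH : forall a, C a = conn H a u.
  apply: (conn_unique Hunit Vu) => [a|a b].
    rewrite pder_leaf_metric // -/J -/x Hpull // -/J -/x !mulmxA CJ.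
    have -> : \sum_b J a b *: pder b G x = w a *m G x + G x *m (w a)^T.
      rewrite /w /pull_conn mulmx_suml raddf_sum mulmx_sumr -big_split.
      apply: eq_bigr => b _ /=.
      rewrite (metric_compatible oU dG Gsym Gunit b Ux) scalerDr scalemxAl.
      by rewrite trmx_mul Gsym // linearZ /= scalemxAr.
    have DT : (D a)^T = (pder a (fun v => 'J sigma v) u)^T + (w a)^T *m J^T.
      by rewrite raddfD /= trmx_mul.
    have gs : (G x)^T = G x by exact: Gsym.
    rewrite !trmx_mul trmxK gs DT /D.
    move: (pder a (fun v => 'J sigma v) u) (w a) (G x) => A B g.
    rewrite !(mulmxDl, mulmxDr) !mulmxA -!addrA; congr (_ + (_ + _)).
    by rewrite addrC.
  have fJ : row_free J by exact: Jfree.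
  apply: (row_free_inj fJ); rewrite -!row_mul !CJ.
  have e1 := row_pder_jac_sym oV ds a b Vu.
  have e2 : row b (J *m w a) = row a (J *m w b).
    rewrite !row_mul /w /pull_conn !mulmx_sumr.
    under eq_bigr do rewrite -scalemxAr mulmx_sum_row scaler_sumr.
    under [RHS]eq_bigr do rewrite -scalemxAr mulmx_sum_row scaler_sumr.
    rewrite exchange_big /=; apply: eq_bigr => d _; apply: eq_bigr => c _.
    rewrite !scalerA (row_conn_sym oU dG Gsym c d Ux).
    by rewrite mulrC [row b J _ _]mxE [row a J _ _]mxE.
  have rowD c d : row c (D d)
      = row c (pder d (fun v => 'J sigma v) u) + row c (J *m w d).
    exact: linearD.
  apply: (etrans (rowD b a)); apply: (etrans _ (esym (rowD a b))).
  exact: (f_equal2 +%R e1 e2).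
by rewrite -CH CJ /D addrK.
Unshelve. all: by end_near. Qed.

(** Gauss equation without second fundamental form. Moreover R(v, Y)Z is
    tangent to the leaf for tangent Z and arbitrary v, because the curvature
    commutes with P; thus directions normal to the leaf do not contribute to
    the trace that defines Ric. *)
Lemma leaf_ricci u : V u ->
  ricci H u = 'J sigma u *m ricci G (sigma u) *m ('J sigma u)^T.
Proof.
move=> Vu; have Ux := VU Vu.
set x := sigma u in Ux *; set J := 'J sigma u.
have fJ : row_free J by exact: Jfree.
have dC n a : ndiff n U (conn G a) by exact: ndiff_conn.
have curvP a b : curv (conn G) a b x *m P x = P x *m curv (conn G) a b x.
  exact: (curv_intertwine _ _ oU Ux (dC 1) (dC 1) (dP 2)
    (fun c y Uy => P_parallel c Uy)).
have gauss i j : curv (conn H) i j u *m J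
    = J *m \sum_a \sum_b (J i a * J j b) *: curv (conn G) a b x.
  rewrite -(curv_pull oV VU ds dC i j Vu).
  apply: (curv_intertwine _ _ oV Vu _ _ (dJ 2) (fun c v Vv => leaf_conn c Vv)).
    move=> a; exact: (ndiff_conn oV ndiff_leaf_metric Hunit).
  by move=> a; exact: (ndiff_pull_conn oV VU ds dC).
pose B := P x *m pinvmx J.
have BJ : B *m J = P x by rewrite mulmxKpV // PJ.
have JB : J *m B = 1%:M.
  by apply: (row_free_inj fJ); rewrite -mulmxA BJ JP // mul1mx.
apply/matrixP => i j; rewrite (ricciE oV ndiff_leaf_metric Hunit) //.
(* T is the matrix of the endomorphism v |-> R(v, J_i) J_j, whose trace is the
   Ricci curvature. *)
pose S l := \sum_c J i c *: curv (conn G) l c x.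
pose T := \matrix_l (row j J *m S l).
have SP l : S l *m P x = P x *m S l.
  rewrite /S mulmx_suml mulmx_sumr; apply: eq_bigr => c _.
  by rewrite -scalemxAl -scalemxAr curvP.
have TP : T *m P x = T.
  apply/row_matrixP => l; rewrite row_mul rowK -mulmxA SP mulmxA -row_mul.
  by rewrite JP.
have JT a : row a (J *m T) = row j (curv (conn H) a i u *m J).
  rewrite gauss row_mul mulmx_sum_row [in RHS]row_mul mulmx_sumr.
  apply: eq_bigr => l _; rewrite rowK [X in X *: _]mxE scalemxAr; congr (_ *m _).
  by rewrite /S scaler_sumr; apply: eq_bigr => c _; rewrite scalerA.
have -> : \sum_a curv (conn H) a i u j a = \tr T.
  rewrite -TP -BJ mulmxA mxtrace_mulC mulmxA; apply: eq_bigr => a _.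
  have := congr1 (fun v => (v *m B) 0 a) (JT a).
  by rewrite -!row_mul -mulmxA JB mulmx1 [LHS]mxE [RHS]mxE.
rewrite [RHS]mxE; under [RHS]eq_bigr do rewrite mxE big_distrl /=.
rewrite /mxtrace.
under [LHS]eq_bigr do rewrite mxE mxE.
rewrite exchange_big /=; apply: eq_bigr => d _.
rewrite /S; under eq_bigr do rewrite summxE mulr_sumr.
rewrite exchange_big /=; apply: eq_bigr => c _.
rewrite (ricciE oU dG Gunit _ _ Ux) mulr_sumr mulr_suml; apply: eq_bigr => l _.
rewrite [X in X * _ = _]mxE [X in _ * X = _]mxE [X in _ = _ * X]mxE.
by rewrite mulrC.
Qed.

End Totally_geodesic_leaf.
End Leaf.

(** * Charts and coordinate expressions *)

Lemma within_open_continuousP {S T : topologicalType} (A : set S) (f : S -> T) :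
  open A ->
  {within A, continuous f} <-> forall x, A x -> {for x, continuous f}.
Proof.
move=> oA; rewrite subspace_continuousP.
have e x : A x -> within A (nbhs x) = nbhs x.
  by move=> Ax; apply: within_interior; exact: open_nbhs_nbhs.
by split=> fc x Ax; have := fc x Ax; rewrite e.
Qed.

Lemma open_locallyP {T : topologicalType} (A : set T) :
  open A <-> forall x, A x -> nbhs x A.
Proof. by rewrite openE. Qed.

Lemma open_preimage {S T : topologicalType} (A : set S) (B : set T) (f : S -> T) :
  open A -> open B -> (forall x, A x -> {for x, continuous f}) ->
  open (A `&` f @^-1` B).
Proof.
move=> oA oB fc; apply/open_locallyP => x [Ax Bfx]; apply: filterI.
  exact: open_nbhs_nbhs.
by apply: fc => //; exact: open_nbhs_nbhs.
Qed.

Section Charts.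
Context {R : realType} {T : topologicalType} {m : nat}.
Variable phi : chart R T m.
Hypothesis hphi : homeomorphic_chart phi.

Lemma chart_open_dom : open (dom phi). Proof. by case: hphi. Qed.

Lemma chart_open_cod : open (cod phi). Proof. by case: hphi. Qed.

Lemma chartK p : dom phi p -> cinv phi (cmap phi p) = p.
Proof. by case: hphi => _ _ K _ _ pd; apply: K; rewrite inE. Qed.

Lemma cinvP x : cod phi x -> dom phi (cinv phi x) /\ cmap phi (cinv phi x) = x.
Proof. by move=> [p pd <-]; rewrite chartK. Qed.

Lemma cod_cmap p : dom phi p -> cod phi (cmap phi p).
Proof. by exists p. Qed.

Lemma cmap_continuous p : dom phi p -> {for p, continuous (cmap phi)}.
Proof.
case: hphi => od _ _ + _; move/(within_open_continuousP _ od); exact.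
Qed.

Lemma cinv_continuous x : cod phi x -> {for x, continuous (cinv phi)}.
Proof.
case: hphi => _ oc _ _; move/(within_open_continuousP _ oc); exact.
Qed.

Lemma open_cod_preimage (B : set T) : open B -> open (cod phi `&` cinv phi @^-1` B).
Proof.
by move=> oB; apply: open_preimage => //;
  [exact: chart_open_cod|exact: cinv_continuous].
Qed.

End Charts.

Section Coordinate_maps.
Context {R : realType} {S T : topologicalType} {k m : nat}.
Variables (f : S -> T) (phi : chart R S k) (psi : chart R T m).
Hypotheses (hphi : homeomorphic_chart phi) (hpsi : homeomorphic_chart psi).

Lemma coord_domP x :
  coord_dom f phi psi x <-> cod phi x /\ dom psi (f (cinv phi x)).
Proof.
split=> [[p [pd fpd] <-]|[xc fxd]]; first by rewrite chartK //; split => //; exists p.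
by have [xd xE] := cinvP hphi xc; exists (cinv phi x).
Qed.

Lemma coord_dom_cmap p : dom phi p -> dom psi (f p) ->
  coord_dom f phi psi (cmap phi p).
Proof. by exists p. Qed.

Lemma coord_map_cmap p : dom phi p ->
  coord_map f phi psi (cmap phi p) = cmap psi (f p).
Proof. by move=> pd; rewrite /coord_map /= chartK. Qed.

Lemma cinv_coord_map x : coord_dom f phi psi x ->
  cinv psi (coord_map f phi psi x) = f (cinv phi x).
Proof. by move=> /coord_domP[_ fd]; rewrite /coord_map /= chartK. Qed.

Lemma coord_map_cod x : coord_dom f phi psi x -> cod psi (coord_map f phi psi x).
Proof. by move=> /coord_domP[_ fd]; exact: cod_cmap. Qed.

Hypothesis fc : continuous f.

Lemma open_coord_dom : open (coord_dom f phi psi).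
Proof.
rewrite (_ : coord_dom _ _ _ = cod phi `&` cinv phi @^-1` (f @^-1` dom psi)).
  apply: open_cod_preimage => //; move/continuousP : fc; apply.
  exact: chart_open_dom.
by apply/seteqP; split=> x /coord_domP.
Qed.

End Coordinate_maps.

Section Chain_rule.
Context {R : realType} {S T Z : topologicalType} {k m n : nat}.
Variables (f : S -> T) (g : T -> Z).
Variables (phi : chart R S k) (chi : chart R T m) (psi : chart R Z n).
Hypotheses (hphi : homeomorphic_chart phi) (hchi : homeomorphic_chart chi).
Hypothesis fc : continuous f.

Lemma coord_map_comp x : coord_dom f phi chi x ->
  coord_map (g \o f) phi psi x = coord_map g chi psi (coord_map f phi chi x).
Proof. by move=> xd; rewrite {1 2}/coord_map /= (cinv_coord_map hphi hchi xd). Qed.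

Lemma coord_diff_comp p : dom phi p -> dom chi (f p) ->
  differentiable (coord_map f phi chi) (cmap phi p) ->
  differentiable (coord_map g chi psi) (cmap chi (f p)) ->
  coord_diff (g \o f) phi psi p
  = coord_diff f phi chi p *m coord_diff g chi psi (f p).
Proof.
move=> pd fpd df dg; rewrite /coord_diff.
have e : coord_map f phi chi (cmap phi p) = cmap chi (f p) by exact: coord_map_cmap.
have dg' : differentiable (coord_map g chi psi) (coord_map f phi chi (cmap phi p)).
  by rewrite e.
have dgf : differentiable (fun x => coord_map g chi psi (coord_map f phi chi x))
    (cmap phi p) by exact: (differentiable_comp df dg').
rewrite -e -(jacobian_comp df dg').
apply/esym/near_eq_jacobian => //.
have nd : \forall x \near cmap phi p, coord_dom f phi chi x.
  apply: open_nbhs_nbhs; split; first exact: open_coord_dom.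
  exact: coord_dom_cmap.
by near=> x; apply/esym/coord_map_comp; exact: (near nd x).
Unshelve. all: by end_near. Qed.

End Chain_rule.

Lemma coord_diff_id {R : realType} {T : topologicalType} {m : nat}
    (phi : chart R T m) p : homeomorphic_chart phi -> dom phi p ->
  coord_diff id phi phi p = 1%:M.
Proof.
move=> hphi pd; rewrite /coord_diff -(jacobian_id (cmap phi p)).
apply/esym/near_eq_jacobian; last exact: ex_diff.
have nc : \forall x \near cmap phi p, cod phi x.
  by apply: open_nbhs_nbhs; split; [exact: chart_open_cod|exact: cod_cmap].
near=> x; have xc : cod phi x by exact: (near nc x).
by rewrite /coord_map /=; have [_ ->] := cinvP hphi xc.
Unshelve. all: by end_near. Qed.

(** * Riemannian manifolds and global vector fields *)

Lemma positive_unitmx {R : realType} {m : nat} (A : 'M[R]_m) :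
  (forall v, v != 0 -> 0 < inner A v v) -> A \in unitmx.
Proof.
move=> Apos; rewrite -row_free_unit -kermx_eq0; apply/rowV0P => v /sub_kermxP vA.
apply/eqP/negP => /negP /Apos.
by rewrite /inner vA mul0mx mxE ltxx.
Qed.

Section Riemannian_manifold.
Context {R : realType} {m : nat} {M : riemannian_data R m}.
Hypothesis hM : riemannian_manifold M.
Implicit Types (phi psi chi : chart R M m) (p : M).

Lemma atlas_homeo phi : atlas M phi -> homeomorphic_chart phi.
Proof. by case: hM => -[_ _ + _ _] _; exact. Qed.

Lemma atlas_cover p : exists2 phi, atlas M phi & dom phi p.
Proof. by case: hM => -[_ _ _ + _] _; exact. Qed.

Lemma chart_atP p : atlas M (chart_at p) /\ dom (chart_at p) p.
Proof.
have [phi ap pd] := atlas_cover p.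
exact: (@xgetPex _ _ [set phi | atlas M phi /\ dom phi p]
  (ex_intro _ phi (conj ap pd))).
Qed.

Let id_continuous : continuous (id : M -> M).
Proof. by move=> x; exact: cvg_id. Qed.

Lemma ndiff_transition phi psi n : atlas M phi -> atlas M psi ->
  ndiff n (coord_dom id phi psi) (coord_map id phi psi).
Proof.
by move=> aphi apsi; case: hM => -[_ _ _ _ sm] _; apply: smooth_on_ndiff; exact: sm.
Qed.

Lemma open_transition phi psi : atlas M phi -> atlas M psi ->
  open (coord_dom id phi psi).
Proof. by move=> aphi apsi; apply: open_coord_dom => //; exact: atlas_homeo. Qed.

Lemma transition_differentiable phi psi p : atlas M phi -> atlas M psi ->
  dom phi p -> dom psi p -> differentiable (coord_map id phi psi) (cmap phi p).
Proof.
move=> aphi apsi pd qd; apply: ndiff_differentiable (ndiff_transition 0 aphi apsi) _.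
exact: coord_dom_cmap.
Qed.

Lemma transition_chain phi psi chi p :
  atlas M phi -> atlas M psi -> atlas M chi ->
  dom phi p -> dom psi p -> dom chi p ->
  coord_diff id phi chi p = coord_diff id phi psi p *m coord_diff id psi chi p.
Proof.
move=> aphi apsi achi dphi dpsi dchi.
apply: (@coord_diff_comp _ _ _ _ _ _ _ id id) => //; try exact: atlas_homeo.
  exact: transition_differentiable.
exact: transition_differentiable.
Qed.

Lemma transitionK phi psi p : atlas M phi -> atlas M psi ->
  dom phi p -> dom psi p ->
  coord_diff id phi psi p *m coord_diff id psi phi p = 1%:M.
Proof.
move=> aphi apsi dphi dpsi; rewrite -transition_chain // coord_diff_id //.
exact: atlas_homeo.
Qed.

Lemma ndiff_metric phi n : atlas M phi -> ndiff n (cod phi) (metric phi \o cinv phi).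
Proof.
by move=> aphi; case: hM => _ [_ sm _]; apply: smooth_on_ndiff; exact: sm.
Qed.

Lemma metric_matrix_sym phi p : atlas M phi -> dom phi p ->
  (metric phi p)^T = metric phi p.
Proof. by move=> aphi pd; case: hM => _ [/(_ _ _ aphi pd)[]]. Qed.

Lemma metric_matrix_pos phi p v : atlas M phi -> dom phi p -> v != 0 ->
  0 < inner (metric phi p) v v.
Proof. by move=> aphi pd; case: hM => _ [/(_ _ _ aphi pd)[_ +]] _ _; exact. Qed.

Lemma metric_matrix_unit phi p : atlas M phi -> dom phi p -> metric phi p \in unitmx.
Proof. by move=> aphi pd; apply: positive_unitmx => v; exact: metric_matrix_pos. Qed.

Lemma metric_transition phi psi p : atlas M phi -> atlas M psi ->
  dom phi p -> dom psi p -> metric phi p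
  = coord_diff id phi psi p *m metric psi p *m (coord_diff id phi psi p)^T.
Proof. by move=> *; case: hM => _ [_ _]; exact. Qed.

Definition spread (phi0 : chart R M m) (Z : 'rV[R]_m -> 'rV[R]_m) : field_data M :=
  fun phi p => if `[< dom phi0 p >]
               then Z (cmap phi0 p) *m coord_diff id phi0 phi p else 0.

Lemma spread_in phi0 Z phi p : dom phi0 p ->
  spread phi0 Z phi p = Z (cmap phi0 p) *m coord_diff id phi0 phi p.
Proof. by move=> pd; rewrite /spread asboolT. Qed.

Lemma spread_out phi0 Z phi p : ~ dom phi0 p -> spread phi0 Z phi p = 0.
Proof. by move=> pd; rewrite /spread asboolF. Qed.

(** The image of a compact set of coordinates is closed, because M is
    Hausdorff; away from it the extended field vanishes. *)
Lemma spread_vector_field phi0 Z (K : set 'rV[R]_m) : atlas M phi0 ->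
  (forall n, ndiff n (cod phi0) Z) -> compact K -> K `<=` cod phi0 ->
  (forall x, ~ K x -> Z x = 0) -> vector_field (spread phi0 Z).
Proof.
move=> a0 dZ cK Kcod Z0; have h0 := atlas_homeo a0; split.
  move=> phi psi p aphi apsi dphi dpsi.
  have [d0|d0] := pselect (dom phi0 p).
    rewrite (spread_in Z psi d0) (spread_in Z phi d0) -mulmxA; congr (_ *m _).
    exact: transition_chain.
  by rewrite (spread_out Z psi d0) (spread_out Z phi d0) mul0mx.
move=> phi aphi; have hphi := atlas_homeo aphi.
apply: smooth_on_local => x xc; have [xd xE] := cinvP hphi xc.
have [d0|d0] := pselect (dom phi0 (cinv phi x)).
  exists (coord_dom id phi phi0), (fun y => Z (coord_map id phi phi0 y)
    *m 'J (coord_map id phi0 phi) (coord_map id phi phi0 y)).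
  have ot := open_transition aphi a0.
  split => //; first by apply/coord_domP.
    apply/smooth_onP => n; apply: ndiff_mulmx => //.
      apply: (ndiff_comp ot _ (ndiff_transition n aphi a0) (dZ n)) => y yd.
      exact: coord_map_cod yd.
    apply: (ndiff_comp (V := coord_dom id phi0 phi) (f := fun z => 'J _ z)
      ot _ (ndiff_transition n aphi a0)); last first.
      apply: ndiff_jacobian; first exact: open_transition.
      exact: ndiff_transition.
    move=> y /(coord_domP id phi0 hphi)[yc y0]; rewrite /coord_map /=.
    by apply: coord_dom_cmap => //; have [] := cinvP hphi yc.
  move=> y /(coord_domP id phi0 hphi)[yc y0] /=.
  by rewrite spread_in.
pose L := cinv phi0 @` K.
have cL : closed L.
  apply: compact_closed; first by case: hM => -[].
  apply: continuous_compact => //; apply: continuous_subspaceW Kcod _.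
  by case: h0.
exists (cod phi `&` cinv phi @^-1` (~` L)), (fun=> 0); split.
- by apply: open_cod_preimage => //; exact: closed_openC.
- split => //= -[z Kz zE]; apply: d0; rewrite -zE.
  by have [] := cinvP h0 (Kcod _ Kz).
- by apply/smooth_onP => n; exact: ndiff_cst.
move=> y [yc /= yL]; have [d0y|d0y] := pselect (dom phi0 (cinv phi y)); last first.
  by rewrite spread_out.
rewrite spread_in // Z0 ?mul0mx // => Ky; apply: yL.
by exists (cmap phi0 (cinv phi y)) => //; rewrite chartK.
Qed.

Lemma cutoff (W : set 'rV[R]_m) a : open W -> W a -> exists rho : 'rV[R]_m -> R,
  [/\ forall n, ndiff n setT rho, rho a != 0 & exists2 K, compact K & K `<=` W /\
    (forall x, ~ K x -> rho x = 0) /\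
    forall Z : 'rV[R]_m -> 'rV[R]_m, (forall n, ndiff n W Z) ->
      forall n, ndiff n setT (fun x => rho x *: Z x)].
Proof.
move=> oW Wa; have : nbhs a W by exact: open_nbhs_nbhs.
move=> /nbhs_ballP[d /= d0 dW].
have r0 : 0 < d / 2 by rewrite divr_gt0.
have rd : d / 2 < d by rewrite ltr_pdivrMr // ltr_pMr // ltr1n.
have [rho [drho rhoa rho0]] := bump_function a r0.
pose K := closed_ball a (d / 2).
have KE x : K x <-> `|a - x| <= d / 2 by rewrite /K closed_ballE.
have KW : K `<=` W.
  by move=> x /KE ax; apply: dW; rewrite -ball_normE; exact: le_lt_trans rd.
have rhoK x : ~ K x -> rho x = 0.
  move=> nK; apply: rho0; rewrite distrC leNgt; apply/negP => /ltW ax.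
  by apply: nK; apply/KE.
have clK : closed K by exact: closed_ball_closed.
exists rho; split => //; exists K; last split => //; last split => //.
  apply: bounded_closed_compact => //.
  exists (`|a| + d); split; first exact: num_real.
  move=> t td x /KE ax; have := ler_normB a (a - x); rewrite subKr => /le_trans.
  by apply; apply: le_trans (ltW td); rewrite lerD2l (le_trans ax) // ltW.
move=> Z dZ n; apply: smooth_on_ndiff; apply: smooth_on_local => x _.
have [Wx|nWx] := pselect (W x).
  exists W, (fun x => rho x *: Z x); split => //; apply/smooth_onP => k.
  by apply: ndiff_scale => //; exact: (@ndiff_sub _ _ k _ setT).
exists (~` K), (fun=> 0); split => //.
- exact: closed_openC.
- by move=> /KW.
- by apply/smooth_onP => k; exact: ndiff_cst.
- by move=> y nK; rewrite rhoK // scale0r.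
Qed.

End Riemannian_manifold.

(** * Vertical and horizontal projections *)

Section Totally_geodesic_distribution.
Context {R : realType} {m : nat} {M : riemannian_data R m}.
Hypothesis hM : riemannian_manifold M.
Variables (D : Defs.distribution M) (phi : chart R M m) (U : set 'rV[R]_m).
Variables (E E' : 'rV[R]_m -> 'M[R]_m).
Hypotheses (aphi : atlas M phi) (oU : open U) (Ucod : U `<=` cod phi).
Hypothesis D_transition : forall chi psi p v, atlas M chi -> atlas M psi ->
  dom chi p -> dom psi p -> D chi p v -> D psi p (v *m coord_diff id chi psi p).
Hypothesis D0 : forall chi p, D chi p 0.
Hypotheses (dE : forall n, ndiff n U E) (EE' : forall x, U x -> E x *m E' x = 0).
Hypothesis DE : forall x v, U x -> D phi (cinv phi x) (v *m E x).
Hypothesis DE' : forall x v, U x -> D phi (cinv phi x) v -> v *m E' x = 0.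

Let G := metric phi \o cinv phi.

(** Total geodesy speaks of global sections. Cut-off functions extend the local
    sections v E to global ones, and the condition is tensorial. *)
Lemma totally_geodesic_local x : totally_geodesic D -> U x ->
  forall v : 'rV_m, \sum_i (v *m E x) 0 i *:
    ((pder i E x + E x *m conn G i x) *m E' x) = 0.
Proof.
move=> geo Ux; have hphi := atlas_homeo hM aphi.
have [xd xE] := cinvP hphi (Ucod Ux).
have [rho [drho rhox [K cK [KU [rhoK drhoZ]]]]] := cutoff oU Ux.
have Kcod : K `<=` cod phi by move=> y /KU /Ucod.
pose Z (v : 'rV[R]_m) y := rho y *: (v *m E y).
have dZ v n : ndiff n setT (Z v).
  apply: drhoZ => k; apply: (ndiff_mulmx (A := fun=> v)) => //; exact: ndiff_cst.
have secZ v : section D (spread phi (Z v)).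
  split.
    apply: (spread_vector_field hM aphi _ cK Kcod) => [n|y nK].
      exact: ndiff_sub (dZ v n).
    by rewrite /Z rhoK // scale0r.
  move=> psi q apsi qd; have [q0|q0] := pselect (dom phi q); last first.
    by rewrite spread_out.
  have [Kq|nKq] := pselect (K (cmap phi q)); last first.
    by rewrite spread_in // /Z rhoK // scale0r mul0mx.
  rewrite spread_in // /Z scalemxAl; apply: D_transition => //.
  by rewrite -{1}(chartK hphi q0); apply: DE; exact: KU.
have local v : {near x, spread phi (Z v) phi \o cinv phi =1 Z v}.
  have nU : \forall y \near x, U y by exact: open_nbhs_nbhs.
  near=> y; have Uy : U y by exact: (near nU y).
  have [yd yE] := cinvP hphi (Ucod Uy).
  by rewrite /= spread_in // yE coord_diff_id // mulmx1.
move=> v; apply: mulmx_row_eq => w; rewrite mulmx0.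
have [_ /(_ phi (cinv phi x) aphi xd)] := geo _ _ (secZ v) (secZ w).
move=> /(DE' Ux); rewrite /levi_civita xE.
have -> : nabla G (spread phi (Z v) phi \o cinv phi)
    (spread phi (Z w) phi \o cinv phi) x = nabla G (Z v) (Z w) x.
  rewrite !nablaE; have /nbhs_singleton -> := local v.
  have /nbhs_singleton -> := local w; congr (_ + _).
  exact: near_eq_derive.
have dEx := ndiff_differentiable (dE 0) Ux.
have drx : differentiable rho x by exact: ndiff_differentiable (drho 0%N) _.
rewrite (nabla_projected _ _ _ dEx drx (EE' Ux)) => /eqP.
by rewrite scaler_eq0 expf_eq0 (negPf rhox) andbF /= => /eqP.
Unshelve. all: by end_near. Qed.

End Totally_geodesic_distribution.

Section Projections.
Context {R : realType} {m n : nat} (g : 'M[R]_m) (A : 'M[R]_(m, n)).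

(** Orthogonal projection, with respect to the inner product g, onto the
    complement of the left kernel of A. *)
Definition hproj : 'M[R]_m :=
  A *m invmx (A^T *m invmx g *m A) *m A^T *m invmx g.

Definition vproj : 'M[R]_m := 1%:M - hproj.

Lemma mulmx_vproj v : v *m A = 0 -> v *m vproj = v :> 'rV_m.
Proof. by move=> vA; rewrite mulmxBr mulmx1 /hproj !mulmxA vA !mul0mx subr0. Qed.

Hypotheses (gsym : g^T = g) (gpos : forall v, v != 0 -> 0 < inner g v v).
Hypothesis (Afull : row_full A).

Let gu : g \in unitmx := positive_unitmx gpos.

Lemma gram_unit : A^T *m invmx g *m A \in unitmx.
Proof.
rewrite -row_free_unit -kermx_eq0; apply/rowV0P => u /sub_kermxP uA.
pose w := u *m A^T *m invmx g.
have wg : inner g w w = 0.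
  have -> : inner g w w = (u *m (A^T *m invmx g *m A) *m u^T) 0 0.
    by rewrite /inner /w mulmxKV // !trmx_mul trmxK trmx_inv gsym !mulmxA.
  by rewrite uA mul0mx mxE.
have w0 : w = 0 by apply/eqP/negP => /negP /gpos; rewrite wg ltxx.
have : u *m A^T = 0 by rewrite -(mulmxKV gu (u *m A^T)) -/w w0 mul0mx.
have /row_fullP[B BA] := Afull.
move=> uA0; have := congr1 (mulmx^~ B^T) uA0.
by rewrite -mulmxA -trmx_mul BA trmx1 mulmx1 mul0mx.
Qed.

Lemma vproj_mulmx : vproj *m A = 0.
Proof.
rewrite mulmxBl mul1mx /hproj -!mulmxA (mulmxA A^T) mulVmx ?mulmx1 ?subrr //.
exact: gram_unit.
Qed.

Lemma vprojK : vproj *m vproj = vproj.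
Proof.
by rewrite {2}/vproj mulmxBr mulmx1 /hproj !mulmxA vproj_mulmx !mul0mx subr0.
Qed.

Lemma vproj_self_adjoint : vproj *m g = g *m vproj^T.
Proof.
rewrite mulmxBl mul1mx linearB /= trmx1 mulmxBr mulmx1; congr (_ - _).
rewrite /hproj mulmxKV // !trmx_mul trmxK trmx_inv gsym !trmx_inv.
by rewrite !trmx_mul trmxK trmx_inv gsym !mulmxA mulmxV // mul1mx.
Qed.

Lemma orthogonal_vproj v : v *m vproj = 0 <->
  forall w : 'rV_m, w *m A = 0 -> inner g v w = 0.
Proof.
split=> [vP w wA|vperp].
  rewrite /inner -(mulmx_vproj wA) trmx_mul -mulmxA (mulmxA g) -vproj_self_adjoint.
  by rewrite !mulmxA vP !mul0mx mxE.
apply: (can_inj (mulmxK gu)); rewrite mul0mx -mulmxA vproj_self_adjoint mulmxA.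
apply/rowP => i; rewrite [RHS]mxE.
have := vperp (row i vproj); rewrite -row_mul vproj_mulmx row0 => /(_ erefl).
by rewrite /inner tr_row colE mulmxA -colE [LHS]mxE.
Qed.

End Projections.

Section Submersion.
Context {R : realType} {m n : nat} {M : riemannian_data R m} {N : riemannian_data R n}.
Hypotheses (hM : riemannian_manifold M) (hN : riemannian_manifold N).
Variable F : M -> N.
Hypothesis hF : submersion F.
Implicit Types (phi chi : chart R M m) (psi : chart R N n).

Lemma submersion_continuous : continuous F.
Proof. by case: hF => -[]. Qed.

Lemma ndiff_submersion phi psi k : atlas M phi -> atlas N psi ->
  ndiff k (coord_dom F phi psi) (coord_map F phi psi).
Proof. by move=> ? ?; apply: smooth_on_ndiff; case: hF => -[_ +] _; exact. Qed.

Lemma open_submersion_dom phi psi : atlas M phi -> atlas N psi ->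
  open (coord_dom F phi psi).
Proof.
move=> aphi apsi; apply: open_coord_dom; first exact: (atlas_homeo hM).
  exact: (atlas_homeo hN).
exact: submersion_continuous.
Qed.

Lemma submersion_differentiable phi psi p : atlas M phi -> atlas N psi ->
  dom phi p -> dom psi (F p) -> differentiable (coord_map F phi psi) (cmap phi p).
Proof.
move=> aphi apsi pd fpd; apply: ndiff_differentiable (ndiff_submersion 0 aphi apsi) _.
exact: coord_dom_cmap.
Qed.

Lemma submersion_chain_source phi chi psi p : atlas M phi -> atlas M chi ->
  atlas N psi -> dom phi p -> dom chi p -> dom psi (F p) ->
  coord_diff F phi psi p = coord_diff id phi chi p *m coord_diff F chi psi p.
Proof.
move=> aphi achi apsi pd pd' fpd.
apply: (@coord_diff_comp _ _ _ _ _ _ _ id F) => //.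
- exact: (atlas_homeo hM).
- exact: (atlas_homeo hM).
- by move=> x; exact: cvg_id.
- exact: (transition_differentiable hM).
- exact: submersion_differentiable.
Qed.

Lemma submersion_chain_target phi psi psi' p : atlas M phi -> atlas N psi ->
  atlas N psi' -> dom phi p -> dom psi (F p) -> dom psi' (F p) ->
  coord_diff F phi psi' p = coord_diff F phi psi p *m coord_diff id psi psi' (F p).
Proof.
move=> aphi apsi apsi' pd fpd fpd'.
apply: (@coord_diff_comp _ _ _ _ _ _ _ F id) => //.
- exact: (atlas_homeo hM).
- exact: (atlas_homeo hN).
- exact: submersion_continuous.
- exact: submersion_differentiable.
- exact: (transition_differentiable hN).
Qed.

Lemma verticalP phi psi p v : atlas M phi -> atlas N psi -> dom phi p ->
  dom psi (F p) -> vertical F phi p v <-> v *m coord_diff F phi psi p = 0.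
Proof.
move=> aphi apsi pd fpd; split=> [vert|v0 psi' apsi' fpd']; first exact: vert.
by rewrite (submersion_chain_target aphi apsi apsi') // mulmxA v0 mul0mx.
Qed.

Lemma vertical_transition phi chi p v : atlas M phi -> atlas M chi ->
  dom phi p -> dom chi p -> vertical F phi p v ->
  vertical F chi p (v *m coord_diff id phi chi p).
Proof.
move=> aphi achi pd pd' vert psi apsi fpd.
by rewrite -mulmxA -submersion_chain_source //; exact: vert.
Qed.

Lemma horizontal_transition phi chi p v : atlas M phi -> atlas M chi ->
  dom phi p -> dom chi p -> horizontal F phi p v ->
  horizontal F chi p (v *m coord_diff id phi chi p).
Proof.
move=> aphi achi pd pd' hor w vert.
have := hor _ (vertical_transition achi aphi pd' pd vert).
rewrite /inner (metric_transition hM aphi achi pd pd') !trmx_mul => <-.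
rewrite !mulmxA -(mulmxA _ (coord_diff id phi chi p)^T) -trmx_mul.
by rewrite (transitionK hM achi aphi pd' pd) trmx1 mulmx1.
Qed.

Section Local_projection.
Variables (phi : chart R M m) (psi : chart R N n).
Hypotheses (aphi : atlas M phi) (apsi : atlas N psi).

Let G := metric phi \o cinv phi.
Let U := coord_dom F phi psi.
Let hphi := atlas_homeo hM aphi.
Let hpsi := atlas_homeo hN apsi.

Definition vertical_projection (x : 'rV[R]_m) : 'M[R]_m :=
  vproj (G x) ('J (coord_map F phi psi) x).
Let P := vertical_projection.

Lemma submersion_dom_cod : U `<=` cod phi.
Proof. by move=> x /(coord_domP F psi hphi)[]. Qed.

Let inU x : U x -> [/\ dom phi (cinv phi x), dom psi (F (cinv phi x)) &
  cmap phi (cinv phi x) = x].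
Proof. by move=> /(coord_domP F psi hphi)[xc fd]; have [xd xE] := cinvP hphi xc. Qed.

Lemma local_metric_sym x : U x -> (G x)^T = G x.
Proof. by move=> /inU[xd _ _]; exact: (metric_matrix_sym hM aphi xd). Qed.

Lemma local_metric_pos x v : U x -> v != 0 -> 0 < inner (G x) v v.
Proof. by move=> /inU[xd _ _]; exact: (metric_matrix_pos hM aphi xd). Qed.

Lemma local_metric_unit x : U x -> G x \in unitmx.
Proof. by move=> /inU[xd _ _]; exact: (metric_matrix_unit hM aphi xd). Qed.

Lemma ndiff_local_metric k : ndiff k U G.
Proof. exact: ndiff_sub submersion_dom_cod (ndiff_metric hM k aphi). Qed.

Lemma local_full x : U x -> row_full ('J (coord_map F phi psi) x).
Proof.
move=> /inU[xd fd xE]; case: hF => _ /(_ phi psi (cinv phi x) aphi apsi xd fd).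
by rewrite /coord_diff xE.
Qed.

Let oU : open U. Proof. exact: open_submersion_dom. Qed.

Lemma ndiff_vertical_projection k : ndiff k U P.
Proof.
have dA : ndiff k U (fun x => 'J (coord_map F phi psi) x).
  by apply: ndiff_jacobian => //; exact: ndiff_submersion.
have dG := ndiff_local_metric k.
have dGi : ndiff k U (fun x => invmx (G x)).
  by apply: ndiff_invmx => // x; exact: local_metric_unit.
apply: ndiff_add => //; first exact: ndiff_cst.
apply: ndiff_opp => //; apply: ndiff_mulmx => //; apply: ndiff_mulmx => //; last first.
  exact: ndiff_trmx.
apply: ndiff_mulmx => //; apply: ndiff_invmx => // [x Ux|].
  apply: gram_unit; [exact: local_metric_sym|move=> v; exact: local_metric_pos|].
  exact: local_full.
by apply: ndiff_mulmx => //; apply: ndiff_mulmx => //; exact: ndiff_trmx.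
Qed.

Lemma vertical_projectionP x v : U x ->
  vertical F phi (cinv phi x) v <-> v *m P x = v.
Proof.
move=> Ux; have [xd fd xE] := inU Ux.
rewrite (verticalP _ aphi apsi xd fd) /coord_diff xE; split; first exact: mulmx_vproj.
move=> <-; rewrite -mulmxA vproj_mulmx ?mulmx0 //.
- exact: local_metric_sym.
- by move=> w; exact: local_metric_pos.
- exact: local_full.
Qed.

Lemma horizontal_projectionP x v : U x ->
  horizontal F phi (cinv phi x) v <-> v *m P x = 0.
Proof.
move=> Ux; have [xd fd xE] := inU Ux.
rewrite orthogonal_vproj.
- split=> hor w wA; apply: hor.
    by apply/(verticalP _ aphi apsi xd fd); rewrite /coord_diff xE.
  by move/(verticalP _ aphi apsi xd fd) : wA; rewrite /coord_diff xE.
- exact: local_metric_sym.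
- by move=> w; exact: local_metric_pos.
- exact: local_full.
Qed.

Lemma vertical_projection_idem x : U x -> P x *m P x = P x.
Proof.
move=> Ux; apply: vprojK.
- exact: local_metric_sym.
- by move=> w; exact: local_metric_pos.
- exact: local_full.
Qed.

Lemma vertical_projection_self_adjoint x : U x -> P x *m G x = G x *m (P x)^T.
Proof.
move=> Ux; apply: vproj_self_adjoint.
- exact: local_metric_sym.
- by move=> w; exact: local_metric_pos.
Qed.

Lemma vertical_projection_parallel i x : totally_geodesic (vertical F) ->
  totally_geodesic (horizontal F) -> U x ->
  pder i P x = conn G i x *m P x - P x *m conn G i x.
Proof.
move=> vgeo hgeo Ux; have P2 := vertical_projection_idem.
pose Q y := 1%:M - P y.
have dQ k : ndiff k U Q.
  apply: ndiff_add => //; first exact: ndiff_cst.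
  by apply: ndiff_opp => //; exact: ndiff_vertical_projection.
have dPx := ndiff_differentiable (ndiff_vertical_projection 0) Ux.
have pderQ j : pder j Q x = - pder j P x.
  apply: (etrans (pder_sub j (differentiable_cst (1%:M : 'M[R]_m) x) dPx)).
  by rewrite (pder_cst (1%:M : 'M[R]_m)) sub0r.
apply: (parallel_projection oU Ux ndiff_local_metric local_metric_sym
  local_metric_unit ndiff_vertical_projection P2 vertical_projection_self_adjoint).
- have v0 chi p : vertical F chi p 0 by move=> psi' _ _; rewrite mul0mx.
  have hPQ y : U y -> P y *m Q y = 0 by move=> Uy; rewrite mulmxBr mulmx1 P2 // subrr.
  have vP y w : U y -> vertical F phi (cinv phi y) (w *m P y).
    by move=> Uy; apply/(vertical_projectionP _ Uy); rewrite -mulmxA P2.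
  have vQ y w : U y -> vertical F phi (cinv phi y) w -> w *m Q y = 0.
    by move=> Uy /(vertical_projectionP _ Uy) wP; rewrite mulmxBr mulmx1 wP subrr.
  exact: (totally_geodesic_local hM aphi oU submersion_dom_cod
    vertical_transition v0 ndiff_vertical_projection hPQ vP vQ vgeo Ux).
- have h0 chi p : horizontal F chi p 0 by move=> w _; rewrite /inner !mul0mx mxE.
  have hQP y : U y -> Q y *m P y = 0 by move=> Uy; rewrite mulmxBl mul1mx P2 // subrr.
  have hQ y w : U y -> horizontal F phi (cinv phi y) (w *m Q y).
    by move=> Uy; apply/(horizontal_projectionP _ Uy); rewrite -mulmxA hQP ?mulmx0.
  have hP y w : U y -> horizontal F phi (cinv phi y) w -> w *m P y = 0.
    by move=> Uy /(horizontal_projectionP _ Uy).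
  move=> v; have := totally_geodesic_local hM aphi oU
    submersion_dom_cod horizontal_transition h0 dQ hQP hQ hP hgeo Ux v.
  by under eq_bigr do rewrite pderQ.
Qed.

End Local_projection.
End Submersion.

(** * Embedded submanifolds *)

Section Subspace.
Context {T : topologicalType} (A : set T).

Lemma set_val_continuous : continuous (@set_val T A).
Proof. exact: initial_continuous. Qed.

Lemma continuous_into_subspace {S : topologicalType} (f : S -> A) x :
  {for x, continuous (@set_val T A \o f)} -> {for x, continuous f}.
Proof.
move=> cf B [_ /= [[W oW <-] Wfx WB]].
have nW : nbhs (set_val (f x)) W by apply: open_nbhs_nbhs.
have nfW : nbhs x ((@set_val T A \o f) @^-1` W) := cf W nW.
by apply: filterS nfW => y Wy; exact: WB.
Qed.

Lemma subspace_hausdorff_space : hausdorff_space T -> hausdorff_space A.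
Proof.
move=> hT p q pq; apply: val_inj; apply: hT => B C Bp Cq.
have [r [Br Cr]] := pq _ _ (set_val_continuous Bp) (set_val_continuous Cq).
by exists (set_val r).
Qed.

Lemma subspace_second_countable : @second_countable T -> @second_countable A.
Proof.
move=> [B cB [oB basisB]].
exists ((fun b => @set_val T A @^-1` b) @` B).
  exact: card_le_trans (card_image_le _ _) cB.
split=> [_ [b Bb <-]|x C].
  by move/continuousP : set_val_continuous; apply; exact: oB.
move=> [_ /= [[W oW <-] Wx WC]].
have [b [Bb bx] bW] := basisB (set_val x) W (open_nbhs_nbhs (conj oW Wx)).
exists (@set_val T A @^-1` b); first by split => //; exists b.
by move=> y yb; apply: WC; exact: bW.
Qed.

End Subspace.

Section Submanifold.
Context {R : realType} {m k : nat} {M : riemannian_data R m}.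
Hypothesis hM : riemannian_manifold M.
Variable A : set M.

Let S := submanifold k A.
Let inc : S -> M := @set_val M A.
Implicit Types (c d : chart R S k) (phi : chart R M m) (q : S).

Let inc_continuous : continuous inc.
Proof. exact: set_val_continuous. Qed.

Lemma sub_chart_homeo c : atlas S c -> homeomorphic_chart c.
Proof. by case. Qed.

Lemma ndiff_inclusion c phi n : atlas S c -> atlas M phi ->
  ndiff n (coord_dom inc c phi) (coord_map inc c phi).
Proof. by move=> [_ /(_ phi) + aphi] => /(_ aphi)[sm _]; exact: smooth_on_ndiff. Qed.

Lemma inclusion_free c phi q : atlas S c -> atlas M phi -> dom c q ->
  dom phi (inc q) -> row_free (coord_diff inc c phi q).
Proof. by move=> [_ /(_ phi) + aphi] => /(_ aphi)[_]; exact. Qed.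

Lemma open_inclusion_dom c phi : atlas S c -> atlas M phi ->
  open (coord_dom inc c phi).
Proof.
move=> ac aphi; apply: open_coord_dom => //; first exact: sub_chart_homeo.
exact: (atlas_homeo hM).
Qed.

Lemma inclusion_differentiable c phi q : atlas S c -> atlas M phi -> dom c q ->
  dom phi (inc q) -> differentiable (coord_map inc c phi) (cmap c q).
Proof.
move=> ac aphi qd pd; apply: ndiff_differentiable (ndiff_inclusion 0 ac aphi) _.
exact: coord_dom_cmap.
Qed.

Lemma inclusion_chain_target c phi psi q : atlas S c -> atlas M phi -> atlas M psi ->
  dom c q -> dom phi (inc q) -> dom psi (inc q) ->
  coord_diff inc c psi q = coord_diff inc c phi q *m coord_diff id phi psi (inc q).
Proof.
move=> ac aphi apsi qd pd pd'.
apply: (@coord_diff_comp _ _ _ _ _ _ _ inc id) => //.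
- exact: sub_chart_homeo.
- exact: (atlas_homeo hM).
- exact: inclusion_differentiable.
- exact: (transition_differentiable hM).
Qed.

(** The induced metric is defined with one chosen chart of M at each point. For
    smoothness the chart must stay fixed nearby, so any chart has to do. *)
Lemma sub_metricE c phi q : atlas S c -> atlas M phi -> dom c q ->
  dom phi (inc q) -> @metric _ _ S c q
  = coord_diff inc c phi q *m metric phi (inc q) *m (coord_diff inc c phi q)^T.
Proof.
move=> ac aphi qd pd; have [a0 d0] := chart_atP hM (inc q).
have -> : @metric _ _ S c q = coord_diff inc c (chart_at (inc q)) q
    *m metric (chart_at (inc q)) (inc q)
    *m (coord_diff inc c (chart_at (inc q)) q)^T by [].
rewrite (inclusion_chain_target ac aphi a0 qd pd d0).
rewrite (metric_transition hM aphi a0 pd d0).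
by rewrite trmx_mul !mulmxA.
Qed.

(** An immersion has a smooth local left inverse: compose it with a linear map
    that inverts its differential, and invert the result. Hence the transition
    between two parametrizations of A is smooth. *)
Lemma sub_transition_smooth c d : atlas S c -> atlas S d ->
  smooth_on (coord_dom id c d) (coord_map id c d).
Proof.
move=> ac ad; have hc := sub_chart_homeo ac; have hd := sub_chart_homeo ad.
have oid : open (coord_dom id c d).
  by apply: open_coord_dom => //; move=> x; exact: cvg_id.
apply: smooth_on_local => u0 ucd; have [uc ud] := (coord_domP id d hc u0).1 ucd.
have [qc cq] := cinvP hc uc; set q0 := cinv c u0 in qc cq ud.
have [phi aphi pd] := atlas_cover hM (inc q0).
pose sigma := coord_map inc d phi; pose V := coord_dom inc d phi.
have oV : open V by exact: open_inclusion_dom.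
have /row_freeP[L JL] := inclusion_free ad aphi ud pd.
pose h u := sigma u *m L.
have dh n : ndiff n V h.
  by apply: ndiff_mulmx => //; [exact: ndiff_inclusion|exact: ndiff_cst].
pose v0 := cmap d q0.
have Vv0 : V v0 by exact: coord_dom_cmap.
have Jh : 'J h v0 = 1%:M.
  have ds := inclusion_differentiable ad aphi ud pd.
  have dhv := ndiff_differentiable (dh 0) Vv0.
  rewrite -JL; apply/row_matrixP => i; apply: (etrans (row_jacobian i dhv)).
  apply: (etrans (pder_mulmx i ds (differentiable_cst L v0))).
  rewrite (pder_cst L) mulmx0 addr0 row_mul; congr (_ *m _).
  exact/esym/row_jacobian.
have [U1 [V1 [g [[oU1 oV1 U1v0 U1V] [gh _ dg]]]]] := inverse_function oV Vv0 dh Jh.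
pose O := (coord_dom id c d `&` coord_dom inc c phi)
          `&` coord_map id c d @^-1` U1.
have oO : open O.
  apply: open_preimage => //; first by apply: openI => //; exact: open_inclusion_dom.
  move=> u [/(coord_domP id d hc)[uc' ud'] _].
  apply: (@continuous_comp _ _ _ (cinv c) (cmap d)); first exact: cinv_continuous.
  exact: cmap_continuous.
have factor u : O u -> coord_map inc c phi u *m L = h (coord_map id c d u).
  move=> [[ucd' _] _]; rewrite /h /sigma; congr (_ *m L).
  exact: (@coord_map_comp _ _ _ _ _ _ _ id inc c d phi).
exists O, (fun u => g (coord_map inc c phi u *m L)); split => //.
- split; last by rewrite /= /coord_map /= -/q0.
  by split => //; apply/(coord_domP inc phi hc).
- apply/smooth_onP => n; apply: (ndiff_comp oO _ _ (dg n)).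
    by move=> u Ou; rewrite factor //; have [_ Uu] := Ou; have [] := gh _ Uu.
  apply: ndiff_mulmx => //; last exact: ndiff_cst.
  by apply: ndiff_sub (ndiff_inclusion n ac aphi) => u [[_ +] _].
- by move=> u Ou; rewrite factor //; have [_ Uu] := Ou; have [] := gh _ Uu.
Qed.

Lemma sub_transition_differentiable c d q : atlas S c -> atlas S d ->
  dom c q -> dom d q -> differentiable (coord_map id c d) (cmap c q).
Proof.
move=> ac ad qc qd.
apply: ndiff_differentiable (smooth_on_ndiff 0 (sub_transition_smooth ac ad)) _.
exact: coord_dom_cmap.
Qed.

Lemma inclusion_chain_source c d phi q : atlas S c -> atlas S d -> atlas M phi ->
  dom c q -> dom d q -> dom phi (inc q) ->
  coord_diff inc c phi q = coord_diff id c d q *m coord_diff inc d phi q.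
Proof.
move=> ac ad aphi qc qd pd.
apply: (@coord_diff_comp _ _ _ _ _ _ _ id inc) => //.
- exact: sub_chart_homeo.
- exact: sub_chart_homeo.
- by move=> x; exact: cvg_id.
- exact: sub_transition_differentiable.
- exact: inclusion_differentiable.
Qed.

Lemma sub_metric_local c phi u : atlas S c -> atlas M phi ->
  coord_dom inc c phi u ->
  (@metric _ _ S c \o cinv c) u = 'J (coord_map inc c phi) u
    *m (metric phi \o cinv phi) (coord_map inc c phi u)
    *m ('J (coord_map inc c phi) u)^T.
Proof.
move=> ac aphi ud; have hc := sub_chart_homeo ac.
have [uc pd] := (coord_domP inc phi hc u).1 ud; have [qc cq] := cinvP hc uc.
apply: (etrans (sub_metricE ac aphi qc pd)); rewrite /coord_diff cq.
have e := cinv_coord_map hc (atlas_homeo hM aphi) ud.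
by congr (_ *m _ *m _); rewrite /comp e.
Qed.

Lemma submanifold_riemannian :
  (forall q : S, exists2 c, atlas S c & dom c q) -> riemannian_manifold S.
Proof.
move=> cover; case: (hM) => -[hM1 hM2 _ _ _] _; split; split.
- exact: subspace_hausdorff_space.
- exact: subspace_second_countable.
- exact: sub_chart_homeo.
- exact: cover.
- exact: sub_transition_smooth.
- move=> c q ac qc; have [phi aphi pd] := atlas_cover hM (inc q).
  rewrite (sub_metricE ac aphi qc pd); split.
    by rewrite trmx_mul trmxK trmx_mul (metric_matrix_sym hM aphi pd) mulmxA.
  move=> v v0; have fJ := inclusion_free ac aphi qc pd.
  rewrite (_ : inner _ v v = inner (metric phi (inc q))
    (v *m coord_diff inc c phi q) (v *m coord_diff inc c phi q)).
    apply: (metric_matrix_pos hM aphi pd); apply: contra v0 => /eqP vJ.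
    by apply/eqP; apply: (row_free_inj fJ); rewrite vJ mul0mx.
  by rewrite /inner trmx_mul !mulmxA.
- move=> c ac; have hc := sub_chart_homeo ac; apply: smooth_on_local => u uc.
  have [qc cq] := cinvP hc uc.
  have [phi aphi pd] := atlas_cover hM (inc (cinv c u)).
  have oV := open_inclusion_dom ac aphi.
  exists (coord_dom inc c phi), (fun u => 'J (coord_map inc c phi) u
    *m (metric phi \o cinv phi) (coord_map inc c phi u)
    *m ('J (coord_map inc c phi) u)^T); split.
  + exact: oV.
  + by apply/(coord_domP inc phi hc).
  + apply/smooth_onP => n.
    have dJ : ndiff n (coord_dom inc c phi) (fun u => 'J (coord_map inc c phi) u).
      by apply: ndiff_jacobian => //; exact: ndiff_inclusion.
    apply: ndiff_mulmx => //; last exact: ndiff_trmx.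
    apply: ndiff_mulmx => //.
    apply: (ndiff_comp oV _ (ndiff_inclusion n ac aphi) (ndiff_metric hM n aphi)).
    by move=> v; exact: coord_map_cod.
  + by move=> v vd; apply/esym; exact: sub_metric_local.
- move=> c d q ac ad qc qd; have [phi aphi pd] := atlas_cover hM (inc q).
  rewrite (sub_metricE ac aphi qc pd) (sub_metricE ad aphi qd pd).
  by rewrite (inclusion_chain_source ac ad aphi qc qd pd) trmx_mul !mulmxA.
Qed.

End Submanifold.

(** * Fibers of a submersion *)

Lemma kernel_basis {K : fieldType} {m n} (A : 'M[K]_(m, n)) : row_full A ->
  exists E : 'M[K]_(m - n, m), [/\ row_free E, E *m A = 0 &
    forall z : 'rV_m, z *m A = 0 -> (z <= E)%MS].
Proof.
move=> Af; have r : \rank (kermx A) = (m - n)%N by rewrite mxrank_ker (eqP Af).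
have : exists E : 'M[K]_(\rank (kermx A), m), [/\ row_free E, E *m A = 0 &
    forall z : 'rV_m, z *m A = 0 -> (z <= E)%MS].
  exists (row_base (kermx A)); split; first exact: row_base_free.
    by apply/sub_kermxP; rewrite eq_row_base.
  by move=> z /sub_kermxP; rewrite eq_row_base.
by rewrite r.
Qed.

Section Fiber.
Context {R : realType} {m n : nat} {M : riemannian_data R m} {N : riemannian_data R n}.
Hypotheses (hM : riemannian_manifold M) (hN : riemannian_manifold N).
Variable F : M -> N.
Hypothesis hF : submersion F.
Variable y : N.

Let A := F @^-1` [set y].
Let S := fiber F y.
Let inc : S -> M := @set_val M A.

Lemma fiberP q : F (inc q) = y.
Proof. exact: (set_valP q). Qed.

(** Near a point x0 of the fiber, x + (f x - f x0 - (x - x0) A0) B is a local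
    diffeomorphism that straightens the fiber to the affine space x0 + ker A0,
    where f expresses F in charts, A0 is its differential at x0 and B A0 = 1. *)
Lemma straighten phi psi x0 : atlas M phi -> atlas N psi ->
  coord_dom F phi psi x0 ->
  let f := coord_map F phi psi in
  exists (A0 : 'M[R]_(m, n)) (U V : set 'rV[R]_m) (Phi g : 'rV[R]_m -> 'rV[R]_m),
  [/\ row_full A0, open U, open V, U x0 & U `<=` coord_dom F phi psi] /\
  [/\ forall x, (Phi x - x0) *m A0 = f x - f x0,
      forall k, ndiff k (coord_dom F phi psi) Phi, forall k, ndiff k V g,
      forall x, U x -> V (Phi x) /\ g (Phi x) = x &
      forall z, V z -> U (g z) /\ Phi (g z) = z].
Proof.
move=> aphi apsi x0d f.
have oW := open_submersion_dom hM hN hF aphi apsi.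
have df k : ndiff k (coord_dom F phi psi) f := ndiff_submersion hF k aphi apsi.
pose A0 := 'J f x0.
have A0full : row_full A0 by exact: (local_full hM hF aphi apsi x0d).
have /row_fullP[B BA] := A0full.
pose r x := f x - f x0 - (x - x0) *m A0.
pose Phi x := x + r x *m B.
have dr k : ndiff k (coord_dom F phi psi) r.
  apply: ndiff_add => //.
    by apply: ndiff_add => //; exact: ndiff_cst.
  apply: ndiff_opp => //; apply: ndiff_mulmx => //; last exact: ndiff_cst.
  by apply: ndiff_add => //; [exact: ndiff_id|exact: ndiff_cst].
have dPhi k : ndiff k (coord_dom F phi psi) Phi.
  apply: ndiff_add => //; first exact: ndiff_id.
  by apply: ndiff_mulmx => //; exact: ndiff_cst.
have dfx := ndiff_differentiable (df 0%N) x0d.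
have didx : differentiable (fun x : 'rV[R]_m => x) x0 by exact: ex_diff.
have pr0 i : pder i r x0 = 0.
  have d1 := differentiableB dfx (differentiable_cst (f x0) x0).
  have d2 := differentiableB didx (differentiable_cst x0 x0).
  have d3 := differentiable_mulmx d2 (differentiable_cst A0 x0).
  apply: (etrans (pder_sub i d1 d3)); apply/eqP; rewrite subr_eq0; apply/eqP.
  apply: (etrans (pder_sub i dfx (differentiable_cst (f x0) x0))).
  rewrite (pder_cst (f x0)) subr0; apply/esym.
  apply: (etrans (pder_mulmx i d2 (differentiable_cst A0 x0))).
  rewrite (pder_cst A0) mulmx0 addr0.
  rewrite (pder_sub i didx (differentiable_cst x0 x0)) (pder_cst x0) subr0.
  by rewrite /pder derive_id -rowE; exact: row_jacobian.
have JPhi : 'J Phi x0 = 1%:M.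
  have dPx := ndiff_differentiable (dPhi 0%N) x0d.
  have drx := ndiff_differentiable (dr 0%N) x0d.
  have drB := differentiable_mulmx drx (differentiable_cst B x0).
  apply/row_matrixP => i; apply: (etrans (row_jacobian i dPx)).
  apply: (etrans (pder_add i didx drB)).
  have -> : pder i (fun x => r x *m B) x0 = 0.
    apply: (etrans (pder_mulmx i drx (differentiable_cst B x0))).
    by rewrite pr0 (pder_cst B) mulmx0 mul0mx addr0.
  by rewrite addr0 row1; exact: derive_id.
have [U [V [g [[oU oV Ux0 UW] [gU gV dg]]]]] := inverse_function oW x0d dPhi JPhi.
exists A0, U, V, Phi, g; split => //; split => // x.
rewrite /Phi mulmxBl mulmxDl -mulmxA BA mulmx1 /r mulmxBl.
move: (f x - f x0) (x *m A0) (x0 *m A0) => a b d.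
by apply/rowP => i; rewrite !mxE; ring.
Qed.

(** The straightening map sends the fiber to x0 + ker A0, where the coefficients
    with respect to a basis E of ker A0 are the coordinates of a chart. *)
Lemma fiber_cover (q0 : S) : exists2 c, atlas S c & dom c q0.
Proof.
have [phi aphi p0d] := atlas_cover hM (inc q0).
have [psi apsi yd] := atlas_cover hN y.
have hphi := atlas_homeo hM aphi; have hpsi := atlas_homeo hN apsi.
pose x0 := cmap phi (inc q0).
have x0d : coord_dom F phi psi x0 by apply: coord_dom_cmap => //; rewrite fiberP.
have [A0 [U [V [Phi [g [[A0f oU oV Ux0 UW] [PhiA dPhi dg gU gV]]]]]]] :=
  straighten aphi apsi x0d.
set f := coord_map F phi psi in PhiA.
have [E [Ef EA Emax]] := kernel_basis A0f.
have /row_freeP[E' EE'] := Ef.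
have proj (z : 'rV[R]_m) : z *m A0 = 0 -> z *m E' *m E = z.
  by move=> /Emax/submxP[w ->]; rewrite -(mulmxA w E E') EE' mulmx1.
pose slice u := x0 + u *m E.
(* A default value q0 makes the inverse of the chart total. *)
pose to_fiber p : S := insubd q0 p.
have to_fiberE p : F p = y -> inc (to_fiber p) = p.
  move=> Fp; have pA : p \in A by rewrite inE.
  by rewrite /inc set_valE; exact: (insubdK q0 pA).
have incK q : to_fiber (inc q) = q by rewrite /to_fiber /inc set_valE valKd.
have fx0 : f x0 = cmap psi y by rewrite /f /x0 coord_map_cmap // fiberP.
have on_fiber u : V (slice u) -> F (cinv phi (g (slice u))) = y.
  move=> Vu; have [Ug Pg] := gV _ Vu.
  have /(coord_domP F psi hphi)[xc Fd] := UW _ Ug.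
  have := PhiA (g (slice u)); rewrite Pg /slice addrAC subrr add0r -mulmxA EA mulmx0.
  move=> /esym/eqP; rewrite subr_eq0 fx0 => /eqP e.
  by rewrite -(chartK hpsi Fd) -(chartK hpsi yd) -e.
pose c : chart R S (m - n) := Chart
  [set q | dom phi (inc q) /\ U (cmap phi (inc q))]
  (fun q => (Phi (cmap phi (inc q)) - x0) *m E')
  (fun u => to_fiber (cinv phi (g (slice u)))).
have dP := chart_open_dom hphi.
have slice_cmap q : dom c q -> slice (cmap c q) = Phi (cmap phi (inc q)).
  move=> [pd Up]; rewrite /slice /= proj ?subrKC // PhiA fx0.
  by rewrite /f coord_map_cmap // fiberP subrr.
have cinv_c u : V (slice u) -> [/\ dom c (cinv c u), cmap c (cinv c u) = u &
    inc (cinv c u) = cinv phi (g (slice u))].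
  move=> Vu; have [Ug Pg] := gV _ Vu.
  have /(coord_domP F psi hphi)[xc Fd] := UW _ Ug.
  have [xd xE] := cinvP hphi xc; have e := to_fiberE _ (on_fiber _ Vu).
  split => //=; rewrite e xE // Pg /slice addrAC subrr add0r.
  by rewrite -mulmxA EE' mulmx1.
have codE : cod c = slice @^-1` V.
  apply/seteqP; split=> [_ [q qd <-]|u /= Vu].
    by rewrite /= slice_cmap //; have [_ Uq] := qd; have [] := gU _ Uq.
  by have [ud uE _] := cinv_c _ Vu; exists (cinv c u).
have dslice u : differentiable slice u.
  apply: differentiableD; first exact: differentiable_cst.
  have did : differentiable (fun v : 'rV[R]_(m - n) => v) u by exact: ex_diff.
  exact: (differentiable_mulmx did (differentiable_cst E u)).
have inc_cont : continuous inc by exact: set_val_continuous.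
have openc : open (dom c).
  rewrite (_ : dom c = inc @^-1` (dom phi `&` cmap phi @^-1` U)).
    move/continuousP : inc_cont; apply; apply: open_preimage => //.
    exact: cmap_continuous.
  by [].
have opencod : open (cod c).
  rewrite codE; have /continuousP : continuous slice.
    by move=> u; exact/differentiable_continuous/dslice.
  exact.
have hc : homeomorphic_chart c.
  split => //.
  - move=> q; rewrite inE => qd; have [pd Up] := qd.
    rewrite /= -[X in g (X)]/(slice (cmap c q)) slice_cmap //.
    by have [_ ->] := gU _ Up; rewrite (chartK hphi pd) incK.
  - apply/(within_open_continuousP _ openc) => q [pd Up].
    have c1 : {for inc q, continuous (cmap phi)} by exact: cmap_continuous.
    have c2 : {for q, continuous (cmap phi \o inc)}.
      by apply: continuous_comp => //; exact: inc_cont.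
    have c3 : {for cmap phi (inc q), continuous (fun x => (Phi x - x0) *m E')}.
      apply: differentiable_continuous.
      have dx := ndiff_differentiable (dPhi 0) (UW _ Up).
      have d1 := differentiableB dx (differentiable_cst x0 _).
      exact: (differentiable_mulmx d1 (differentiable_cst E' _)).
    exact: (continuous_comp c2 c3).
  - apply/(within_open_continuousP _ opencod) => u; rewrite codE => Vu.
    apply: continuous_into_subspace; have [Ug Pg] := gV _ Vu.
    have /(coord_domP F psi hphi)[xc _] := UW _ Ug.
    have c1 : {for u, continuous (g \o slice)}.
      apply: continuous_comp; first exact/differentiable_continuous/dslice.
      exact/differentiable_continuous/(ndiff_differentiable (dg 0)).
    have c2 : {for u, continuous (cinv phi \o (g \o slice))}.
      by apply: continuous_comp => //; exact: cinv_continuous.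
    have nV : \forall v \near u, (slice @^-1` V) v.
      by apply: open_nbhs_nbhs; split => //; rewrite -codE.
    have e : {near u, cinv phi \o (g \o slice) =1 inc \o cinv c}.
      near=> v; have Vv : V (slice v) by exact: (near nV v).
      by have [_ _ iv] := cinv_c _ Vv; rewrite /comp iv.
    have iu : inc (cinv c u) = cinv phi (g (slice u)) by have [_ _] := cinv_c _ Vu.
    have lim_c : (inc \o cinv c) v @[v --> u] --> cinv phi (g (slice u)).
      exact: cvg_trans (near_eq_cvg e) c2.
    by move: lim_c; rewrite -iu.
have dgs k : ndiff k (cod c) (fun u => g (slice u)).
  apply: (ndiff_comp opencod _ _ (dg k)) => [u|]; first by rewrite codE.
  apply: ndiff_add => //; first exact: ndiff_cst.
  by apply: ndiff_mulmx => //; [exact: ndiff_id|exact: ndiff_cst].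
exists c => //; split => // phi' aphi'; have hphi' := atlas_homeo hM aphi'.
have odom : open (coord_dom inc c phi').
  exact: open_coord_dom.
have sm : smooth_on (coord_dom inc c phi') (coord_map inc c phi').
  apply/smooth_onP => k.
  have incd u : coord_dom inc c phi' u -> [/\ cod c u, V (slice u),
      inc (cinv c u) = cinv phi (g (slice u)) & coord_dom id phi phi' (g (slice u))].
    move=> /(coord_domP inc phi' hc)[uc ud].
    have Vu : V (slice u) by move: uc; rewrite codE.
    have [_ _ iu] := cinv_c _ Vu; split => //.
    apply/(coord_domP id phi' hphi); rewrite -iu; split => //.
    by have [Ug _] := gV _ Vu; have /(coord_domP F psi hphi)[] := UW _ Ug.
  apply: (@ndiff_eq _ _ k _ _ (fun u => coord_map id phi phi' (g (slice u)))) => //.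
    by move=> u /incd[_ _ iu _]; rewrite /coord_map /= -/inc iu.
  apply: (ndiff_comp odom _ _ (ndiff_transition hM k aphi aphi')).
    by move=> u /incd[].
  by apply: ndiff_sub (dgs k) => u /incd[].
split => // q qd q'd; have [pd Up] := qd.
(* Phi in the chart phi is a left inverse of the parametrization up to slice. *)
set u := cmap c q.
have ud : coord_dom inc c phi' u by exact: coord_dom_cmap.
have du : differentiable (coord_map inc c phi') u.
  exact: ndiff_differentiable (smooth_on_ndiff 0 sm) ud.
have e1 : coord_map inc c phi' u = cmap phi' (inc q) by exact: coord_map_cmap.
have dt : differentiable (coord_map id phi' phi) (coord_map inc c phi' u).
  by rewrite e1; exact: (transition_differentiable hM).
have e2 : coord_map id phi' phi (coord_map inc c phi' u) = cmap phi (inc q).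
  by rewrite e1; exact: coord_map_cmap.
have dPh : differentiable Phi (coord_map id phi' phi (coord_map inc c phi' u)).
  by rewrite e2; exact: ndiff_differentiable (dPhi 0) (UW _ Up).
have dtd := differentiable_comp dt dPh.
have JE : 'J slice u = E.
  apply/row_matrixP => i; apply: (etrans (row_jacobian i (dslice u))).
  have did : differentiable (fun v : 'rV[R]_(m - n) => v) u by exact: ex_diff.
  have d2 := differentiable_mulmx did (differentiable_cst E u).
  apply: (etrans (pder_add i (differentiable_cst x0 u) d2)).
  rewrite (pder_cst x0) add0r.
  apply: (etrans (pder_mulmx i did (differentiable_cst E u))).
  by rewrite (pder_cst E) mulmx0 addr0 /pder derive_id -rowE.
have Jchain : E = coord_diff inc c phi' q
    *m 'J (fun x => Phi (coord_map id phi' phi x)) (coord_map inc c phi' u).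
  rewrite -JE -(jacobian_comp du dtd); apply: near_eq_jacobian => //.
  have nd : \forall v \near u, coord_dom inc c phi' v by exact: open_nbhs_nbhs.
  near=> v; have vd : coord_dom inc c phi' v by exact: (near nd v).
  have /(coord_domP inc phi' hc)[vc vd'] := vd.
  have Vv : V (slice v) by move: vc; rewrite codE.
  have [_ _ iv] := cinv_c _ Vv; have [Ug Pg] := gV _ Vv.
  have /(coord_domP F psi hphi)[xc _] := UW _ Ug.
  have cE := cinv_coord_map hc hphi' vd.
  rewrite -[RHS]/(Phi (coord_map id phi' phi (coord_map inc c phi' v))).
  have -> : coord_map id phi' phi (coord_map inc c phi' v)
      = cmap phi (inc (cinv c v)) by rewrite -cE.
  by rewrite iv; have [_ ->] := cinvP hphi xc.
rewrite /row_free eqn_leq rank_leq_row /= -{1}(eqP Ef) {1}Jchain.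
exact: mxrankM_maxl.
Unshelve. all: by end_near. Qed.

End Fiber.

Section Fiber_geometry.
Context {R : realType} {m n : nat} {M : riemannian_data R m} {N : riemannian_data R n}.
Hypotheses (hM : riemannian_manifold M) (hN : riemannian_manifold N).
Variable F : M -> N.
Hypothesis hF : submersion F.
Variable y : N.

Let A := F @^-1` [set y].
Let S := fiber F y.
Let inc : S -> M := @set_val M A.
Implicit Types (c d : chart R S (m - n)) (phi : chart R M m) (q : S).

Lemma fiber_riemannian : riemannian_manifold S.
Proof. by apply: (submanifold_riemannian hM) => q; exact: (fiber_cover hM hN hF). Qed.

Section Local.
Variables (c : chart R S (m - n)) (phi : chart R M m) (psi : chart R N n).
Hypotheses (ac : atlas S c) (aphi : atlas M phi) (apsi : atlas N psi).
Hypothesis yd : dom psi y.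

Let hc : homeomorphic_chart c := sub_chart_homeo ac.
Let hphi := atlas_homeo hM aphi.
Let hpsi := atlas_homeo hN apsi.
Let sigma := coord_map inc c phi.
Let V := coord_dom inc c phi.
Let U := coord_dom F phi psi.
Let G := metric phi \o cinv phi.
Let H := @metric _ _ S c \o cinv c.
Let P := vertical_projection F phi psi.

Lemma fiber_open : open V.
Proof. exact: (open_inclusion_dom hM ac aphi). Qed.

Lemma ndiff_fiber_inclusion k : ndiff k V sigma.
Proof. exact: (ndiff_inclusion k ac aphi). Qed.

Lemma fiber_sub u : V u -> U (sigma u).
Proof.
move=> ud; have [uc pd] := (coord_domP inc phi hc u).1 ud.
by apply: coord_dom_cmap => //; rewrite fiberP.
Qed.

Lemma fiber_tangent_vertical u : V u ->
  'J sigma u *m 'J (coord_map F phi psi) (sigma u) = 0.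
Proof.
move=> Vu.
have ds := ndiff_differentiable (ndiff_fiber_inclusion 0) Vu.
have df := ndiff_differentiable (ndiff_submersion hF 0 aphi apsi) (fiber_sub Vu).
rewrite -(jacobian_comp ds df); apply/row_matrixP => i; rewrite row0.
have dfs := differentiable_comp ds df.
apply: (etrans (row_jacobian i dfs)).
apply: (etrans _ (pder_cst (cmap psi y) u i)); apply: near_eq_pder.
have nV : \forall v \near u, V v.
  by apply: open_nbhs_nbhs; split => //; exact: fiber_open.
near=> v; have Vv : V v by exact: (near nV v).
have e := cinv_coord_map hc hphi Vv.
by rewrite {1}/coord_map /= -/(coord_map inc c phi v) e fiberP.
Unshelve. all: by end_near. Qed.

Lemma fiber_free u : V u -> row_free ('J sigma u).
Proof.
move=> Vu; have [uc pd] := (coord_domP inc phi hc u).1 Vu.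
have [qc cq] := cinvP hc uc.
by have := inclusion_free ac aphi qc pd; rewrite /coord_diff cq.
Qed.

(** Dimension count: F being a submersion, the kernel of its differential has
    dimension m - n, as has the tangent space of the fiber. *)
Lemma fiber_tangent_max u : V u ->
  (kermx ('J (coord_map F phi psi) (sigma u)) <= 'J sigma u)%MS.
Proof.
move=> Vu; have sub : ('J sigma u <= kermx ('J (coord_map F phi psi) (sigma u)))%MS.
  by apply/sub_kermxP; exact: fiber_tangent_vertical.
rewrite -(mxrank_leqif_sup sub) mxrank_ker.
have /eqP -> := local_full hM hF aphi apsi (fiber_sub Vu).
by apply/eqP; exact/eqP/fiber_free.
Qed.

Lemma fiber_tangent_fixed u : V u -> 'J sigma u *m P (sigma u) = 'J sigma u.
Proof.
move=> Vu; apply/row_matrixP => i; rewrite row_mul; apply: mulmx_vproj.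
by rewrite -row_mul fiber_tangent_vertical // row0.
Qed.

Lemma fiber_projection_tangent u : V u -> (P (sigma u) <= 'J sigma u)%MS.
Proof.
move=> Vu; apply: submx_trans (fiber_tangent_max Vu); apply/sub_kermxP.
have Us := fiber_sub Vu; apply: vproj_mulmx.
- exact: (local_metric_sym hM aphi Us).
- by move=> v; exact: (local_metric_pos hM aphi Us).
- exact: (local_full hM hF aphi apsi Us).
Qed.

Lemma fiber_metric_unit u : V u -> H u \in unitmx.
Proof.
move=> Vu; have [uc pd] := (coord_domP inc phi hc u).1 Vu.
have [qc _] := cinvP hc uc; exact: (metric_matrix_unit fiber_riemannian ac qc).
Qed.

Lemma fiber_metric u : V u ->
  H u = 'J sigma u *m G (sigma u) *m ('J sigma u)^T.
Proof. by move=> Vu; exact: (sub_metric_local hM ac aphi Vu). Qed.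

Let oU : open U := open_submersion_dom hM hN hF aphi apsi.

Let dG k : ndiff k U G. Proof. exact: (ndiff_local_metric hM F psi aphi). Qed.

Let Gsym x : U x -> (G x)^T = G x.
Proof. exact: (local_metric_sym hM aphi). Qed.

Let Gunit x : U x -> G x \in unitmx.
Proof. exact: (local_metric_unit hM aphi). Qed.

Hypotheses (vgeo : totally_geodesic (vertical F)).
Hypotheses (hgeo : totally_geodesic (horizontal F)).

Lemma fiber_ricci u : V u ->
  ricci H u = 'J sigma u *m ricci G (sigma u) *m ('J sigma u)^T.
Proof.
apply: (leaf_ricci oU dG Gsym Gunit fiber_open fiber_sub ndiff_fiber_inclusion
  fiber_metric (ndiff_vertical_projection hM hN hF aphi apsi) _
  fiber_tangent_fixed fiber_free fiber_projection_tangent fiber_metric_unit).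
move=> i x; exact: (vertical_projection_parallel hM hN hF aphi apsi i vgeo hgeo).
Qed.

Lemma fiber_lie_horizontal (xi : field_data M) u : section (horizontal F) xi ->
  V u -> 'J sigma u *m lie_metric G (xi phi \o cinv phi) (sigma u)
         *m ('J sigma u)^T = 0.
Proof.
move=> [[_ sxi] hxi] Vu.
have dxi k : ndiff k U (xi phi \o cinv phi).
  apply: ndiff_sub (smooth_on_ndiff k (sxi _ aphi)).
  exact: (submersion_dom_cod hM aphi).
apply: (lie_metric_orthogonal (P := P) oU dG Gsym Gunit fiber_sub
  (ndiff_vertical_projection hM hN hF aphi apsi) _ fiber_tangent_fixed dxi _ _ Vu).
- move=> i x; exact: (vertical_projection_parallel hM hN hF aphi apsi i vgeo hgeo).
- move=> x Ux; have [xc _] := (coord_domP F psi hphi x).1 Ux.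
  have [xd _] := cinvP hphi xc.
  by apply/(horizontal_projectionP hM hN hF aphi apsi _ Ux); exact: hxi.
- by move=> x; exact: (vertical_projection_self_adjoint hM aphi).
Qed.

End Local.

Lemma fiber_vertical_tangent c phi q v : atlas S c -> atlas M phi -> dom c q ->
  dom phi (inc q) -> vertical F phi (inc q) v -> (v <= coord_diff inc c phi q)%MS.
Proof.
move=> ac aphi qc pd vert; have [psi apsi yd] := atlas_cover hN y.
have hphi := atlas_homeo hM aphi; have hc := sub_chart_homeo ac.
have Vq : coord_dom inc c phi (cmap c q) by exact: coord_dom_cmap.
apply: submx_trans (fiber_tangent_max ac aphi apsi yd Vq); apply/sub_kermxP.
have fd : dom psi (F (inc q)) by rewrite fiberP.
have := vert psi apsi fd; rewrite /coord_diff.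
by have -> : coord_map inc c phi (cmap c q) = cmap phi (inc q) by exact: coord_map_cmap.
Qed.

Section Vertical_field.
Variable xi : field_data M.
Hypothesis xi_vertical : section (vertical F) xi.

(** The restriction of xi to the fiber: the pseudo-inverse solves w J = xi for
    the components w, and by [fiber_field_push] w does not depend on the chart of
    M used for this. *)
Definition fiber_field : field_data S := fun c q =>
  xi (chart_at (inc q)) (inc q) *m pinvmx (coord_diff inc c (chart_at (inc q)) q).

Lemma fiber_field_push c phi q : atlas S c -> atlas M phi -> dom c q ->
  dom phi (inc q) -> fiber_field c q *m coord_diff inc c phi q = xi phi (inc q).
Proof.
move=> ac aphi qc pd; have [a0 d0] := chart_atP hM (inc q).
have [[tr _] vert] := xi_vertical.
rewrite (tr _ _ _ a0 aphi d0 pd) (inclusion_chain_target hM ac a0 aphi qc d0 pd).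
rewrite mulmxA mulmxKpV //; apply: (fiber_vertical_tangent ac a0 qc d0).
exact: vert.
Qed.

Lemma fiber_field_vector_field : vector_field fiber_field.
Proof.
have [[_ sxi] _] := xi_vertical; split.
  move=> c d q ac ad qc qd; have [phi aphi pd] := atlas_cover hM (inc q).
  apply: (row_free_inj (inclusion_free ad aphi qd pd)).
  rewrite (fiber_field_push ad aphi qd pd) -mulmxA.
  rewrite -(inclusion_chain_source hM ac ad aphi qc qd pd).
  by rewrite (fiber_field_push ac aphi qc pd).
move=> c ac; have hc := sub_chart_homeo ac; apply: smooth_on_local => u uc.
have [qc cq] := cinvP hc uc.
have [phi aphi pd] := atlas_cover hM (inc (cinv c u)).
have hphi := atlas_homeo hM aphi.
have oV := open_inclusion_dom hM ac aphi.
pose sigma := coord_map inc c phi.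
exists (coord_dom inc c phi), (fun v => (xi phi \o cinv phi) (sigma v)
  *m (metric phi \o cinv phi) (sigma v) *m ('J sigma v)^T
  *m invmx ((@metric _ _ S c \o cinv c) v)); split.
- exact: oV.
- by apply/(coord_domP inc phi hc).
- apply/smooth_onP => k; have ds := ndiff_inclusion k ac aphi.
  have codV v : coord_dom inc c phi v -> cod phi (sigma v) by exact: coord_map_cod.
  apply: ndiff_mulmx => //.
    apply: ndiff_mulmx => //.
      apply: ndiff_mulmx => //.
        exact: (ndiff_comp oV codV ds (smooth_on_ndiff k (sxi _ aphi))).
      exact: (ndiff_comp oV codV ds (ndiff_metric hM k aphi)).
    apply: ndiff_trmx => //; apply: ndiff_jacobian => //.
    exact: (ndiff_inclusion k.+1 ac aphi).
  apply: ndiff_invmx => // [v Vv|]; first exact: (fiber_metric_unit ac Vv).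
  apply: ndiff_sub (ndiff_metric fiber_riemannian k ac).
  by move=> v /(coord_domP inc phi hc)[].
move=> v Vv; have [vc vd] := (coord_domP inc phi hc v).1 Vv.
have [qv cv] := cinvP hc vc.
have push := fiber_field_push ac aphi qv vd; rewrite /coord_diff cv in push.
have e := cinv_coord_map hc hphi Vv.
have -> : (xi phi \o cinv phi) (sigma v) = fiber_field c (cinv c v) *m 'J sigma v.
  by rewrite push /comp e.
have Hu := fiber_metric_unit ac Vv.
rewrite -[RHS](mulmxK Hu); congr (_ *m _).
by rewrite (fiber_metric ac aphi Vv) !mulmxA.
Qed.

End Vertical_field.
Hypotheses (vgeo : totally_geodesic (vertical F)).
Hypotheses (hgeo : totally_geodesic (horizontal F)).
Variables (xi : field_data M) (mu : R).
Hypothesis M_soliton : ricci_soliton xi mu.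

Lemma fiber_coordinates c u : atlas S c -> cod c u -> exists phi psi,
  [/\ atlas M phi, atlas N psi, dom psi y & coord_dom inc c phi u].
Proof.
move=> ac uc; have [psi apsi yd] := atlas_cover hN y.
have [phi aphi pd] := atlas_cover hM (inc (cinv c u)).
by exists phi, psi; split => //; apply/(coord_domP inc phi (sub_chart_homeo ac)).
Qed.

(** Multiply the soliton equation of M by J and J^T: the Ricci tensor and the
    metric of M restrict to those of the fiber. *)
Lemma soliton_restricted c phi psi u : atlas S c -> atlas M phi -> atlas N psi ->
  dom psi y -> coord_dom inc c phi u ->
  let J := 'J (coord_map inc c phi) u in
  let x := coord_map inc c phi u in
  2^-1 *: (J *m lie_metric (metric phi \o cinv phi) (xi phi \o cinv phi) x *m J^T)
  + ricci (@metric _ _ S c \o cinv c) u + mu *: (@metric _ _ S c \o cinv c) u = 0.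
Proof.
move=> ac aphi apsi yd Vu J x.
have xd : cod phi x := submersion_dom_cod hM aphi (fiber_sub ac yd Vu).
rewrite (fiber_ricci ac aphi apsi yd vgeo hgeo Vu) (fiber_metric ac aphi Vu).
have [_ _ /(_ phi x aphi xd) eqM] := M_soliton.
have := congr1 (fun B => J *m B *m J^T) eqM.
by rewrite /= mulmx0 mul0mx !mulmxDr !mulmxDl -!scalemxAr -!scalemxAl.
Qed.

(** The Lie derivative restricts to the fiber as well, by naturality. *)
Lemma fiber_ricci_soliton : section (vertical F) xi -> is_ricci_soliton S.
Proof.
move=> xi_vert; exists (fiber_field xi), mu; split.
- exact: fiber_riemannian.
- exact: fiber_field_vector_field.
move=> c u ac uc H; have [phi [psi [aphi apsi yd Vu]]] := fiber_coordinates ac uc.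
have := soliton_restricted ac aphi apsi yd Vu; rewrite /= => <-.
congr (_ *: _ + _ + _).
have hc := sub_chart_homeo ac.
have [[_ sxi] _] := xi_vert; have [_ sw] := fiber_field_vector_field xi_vert.
apply: (lie_metric_pull (U := cod phi) _ _ (open_inclusion_dom hM ac aphi) _
  (fun k => ndiff_inclusion k ac aphi) (fiber_metric ac aphi) _ _ _ Vu).
- by move=> k; exact: (ndiff_metric hM k aphi).
- move=> x xc; have [xd _] := cinvP (atlas_homeo hM aphi) xc.
  exact: (metric_matrix_sym hM aphi xd).
- by move=> v; exact: coord_map_cod.
- by move=> k; exact: smooth_on_ndiff (sxi _ aphi).
- move=> k; apply: ndiff_sub (smooth_on_ndiff k (sw _ ac)).
  by move=> v /(coord_domP inc phi hc)[].
move=> v Vv; have [vc vd] := (coord_domP inc phi hc v).1 Vv.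
have [qv cv] := cinvP hc vc.
have := fiber_field_push xi_vert ac aphi qv vd; rewrite /coord_diff cv => push.
apply: (etrans push); have e := cinv_coord_map hc (atlas_homeo hM aphi) Vv.
by rewrite /comp e.
Qed.

(** Along a horizontal field the metric of the totally geodesic fibers does not
    change to first order, so the Lie derivative drops out. *)
Lemma fiber_einstein : section (horizontal F) xi -> is_einstein S.
Proof.
move=> xi_hor; split; first exact: fiber_riemannian.
exists (- mu) => c u ac uc H.
have [phi [psi [aphi apsi yd Vu]]] := fiber_coordinates ac uc.
have := soliton_restricted ac aphi apsi yd Vu.
rewrite /= (fiber_lie_horizontal ac aphi apsi yd vgeo hgeo xi_hor Vu).
rewrite scaler0 add0r scaleNr => /eqP; rewrite addr_eq0 => /eqP; exact.
Qed.

End Fiber_geometry.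

Theorem theorem4p1 (R : realType) (m n : nat)
    (M : riemannian_data R m) (N : riemannian_data R n)
    (xi : field_data M) (mu : R) (F : M -> N) (lambda : M -> R)
    (M_soliton : ricci_soliton xi mu)
    (N_riemannian : riemannian_manifold N)
    (F_conformal : horizontally_conformal_submersion F lambda)
    (vertical_geodesic : totally_geodesic (vertical F))
    (horizontal_geodesic : totally_geodesic (horizontal F)) :
  (section (vertical F) xi -> forall y : N, is_ricci_soliton (fiber F y))
  /\
  (section (horizontal F) xi -> forall y : N, is_einstein (fiber F y)).
Proof.
have [hM _ _] := M_soliton; have [hF _ _ _ _] := F_conformal.
split=> xi_sec y.
  exact: (fiber_ricci_soliton hM N_riemannian hF y vertical_geodesic
    horizontal_geodesic M_soliton xi_sec).
exact: (fiber_einstein hM N_riemannian hF y vertical_geodesic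
  horizontal_geodesic M_soliton xi_sec).
Qed.
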